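(* Fix an iteration $k\ge 0$ of the regularized proximal point algorithm (rPPA) described in the context, with parameter $\sigma_k>0$ and current iterate $(\Theta^k,\Omega^k,\bar X^k)$. Let $\widehat{\Phi}_k:\mathcal{Y}\to\mathbb{R}$ be the continuously differentiable, strongly concave function maximized in that iteration, $$\widehat{\Phi}_k(X)=\Phi_k(X)-\frac{1}{2\sigma_k}\|X-\bar X^k\|^2,$$ $$\Phi_k(X)=\inf_{\Theta,\Omega}\Big\{\sum_{l=1}^L\big(\vartheta(\Omega^{(l)})+\langle S^{(l)},\Theta^{(l)}\rangle\big)+\mathcal{P}(\Theta)-\langle\Theta-\Omega,X\rangle+\frac{1}{2\sigma_k}\big(\|\Theta-\Theta^k\|^2+\|\Omega-\Omega^k\|^2\big)\Big\}.$$ Let $\{X^j\}$ be the infinite sequence generated by the semismooth Newton (SSN) method described in the context, with parameters $\mu\in(0,1/2)$, $\bar\eta\in(0,1)$, $\tau\in(0,1]$, $\rho\in(0,1)$, for solving $\nabla\widehat{\Phi}_k(X)=0$. Then $\{X^j\}$ converges to the unique optimal solution $\widehat{X}$ of $\nabla\widehat{\Phi}_k(X)=0$, and $$\|X^{j+1}-\widehat{X}\|=\mathcal{O}\big(\|X^j-\widehat{X}\|^{1+\tau}\big).$$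
   Context: Notation: $\mathbb{S}^p$ is the space of real symmetric $p\times p$ matrices; $\mathbb{S}^p_+$ and $\mathbb{S}^p_{++}$ are the positive semidefinite and positive definite ones. $L\ge2$; $\mathcal{Y}=\mathbb{S}^p\times\cdots\times\mathbb{S}^p$ and $\mathcal{X}=\mathbb{S}^p_+\times\cdots\times\mathbb{S}^p_+$ ($L$ copies each), with the product of trace inner products and the induced (Frobenius) norm. For $X\in\mathcal{Y}$, $X_{[ij]}:=[X^{(1)}_{ij};\dots;X^{(L)}_{ij}]\in\mathbb{R}^L$. $S=(S^{(1)},\dots,S^{(L)})$ is a given tuple of $p\times p$ sample covariance matrices. $\vartheta(A)=-\log\det A$ if $A\in\mathbb{S}^p_{++}$ and $+\infty$ otherwise. $\mathrm{Prox}_g(u)=\arg\min_{u'}\{g(u')+\frac12\|u'-u\|^2\}$. With $\lambda_1,\lambda_2\ge0$, the fused graphical Lasso regularizer is $$\mathcal{P}(\Theta)=\lambda_1\sum_{l=1}^L\sum_{i\ne j}|\Theta^{(l)}_{ij}|+\lambda_2\sum_{l=2}^L\sum_{i\ne j}|\Theta^{(l)}_{ij}-\Theta^{(l-1)}_{ij}|=\sum_{i\ne j}\varphi(\Theta_{[ij]}),$$ with $\varphi(x)=\lambda_1\|x\|_1+\lambda_2\|Bx\|_1$ on $\mathbb{R}^L$ and $Bx=[x_1-x_2;\dots;x_{L-1}-x_L]$. Log-determinant part: for $\beta>0$ and $A\in\mathbb{S}^p$ with eigenvalue decomposition $A=Q\,\mathrm{Diag}(d_1,\dots,d_p)Q^T$,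 $\phi^+_\beta(A)=Q\,\mathrm{Diag}(\phi^+_\beta(d_1),\dots,\phi^+_\beta(d_p))Q^T$, where $\phi^+_\beta(x)=(\sqrt{x^2+4\beta}+x)/2$ for real $x$. One has $\mathrm{Prox}_{\beta\vartheta}=\phi^+_\beta$, and $\phi^+_\beta$ is continuously differentiable on $\mathbb{S}^p$, with derivative denoted $(\phi^+_\beta)'(A)[\cdot]$. rPPA (for minimizing $\sum_{l}(\vartheta(\Omega^{(l)})+\langle S^{(l)},\Theta^{(l)}\rangle)+\mathcal{P}(\Theta)$ subject to $\Theta-\Omega=0$): choose $\Theta^0,\Omega^0\in\mathcal{X}$; for $k=0,1,2,\dots$, with positive scalars $\sigma_k\uparrow\sigma_\infty\le\infty$: (1) compute $\bar X^{k+1}\approx\arg\max_X\widehat{\Phi}_k(X)$; (2) set $\Theta^{k+1}=\mathrm{Prox}_{\sigma_k\mathcal{P}}(\Theta^k+\sigma_k(\bar X^{k+1}-S))$ and $(\Omega^{(l)})^{k+1}=\phi^+_{\sigma_k}((\Omega^{(l)})^k-\sigma_k(\bar X^{(l)})^{k+1})$, $l=1,\dots,L$; (3) update $\sigma_{k+1}$. Surrogate generalized Jacobian of $\mathrm{Prox}_\varphi$ at $v\in\mathbb{R}^L$: let $x_{\lambda_2}(v)=\arg\min_x\{\lambda_2\|Bx\|_1+\frac12\|x-v\|^2\}$, $z_{\lambda_2}(u)=\arg\min_z\{\frac12\|B^Tz\|^2-\langle z,u\rangle:\|z\|_\infty\le\lambda_2\}$, $\mathcal{I}_z(v)=\{i\in\{1,\dots,L-1\}:|(z_{\lambda_2}(Bv))_i|=\lambda_2\}$,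 $\mathcal{K}_z(v)=\{K\subseteq\{1,\dots,L-1\}:\mathrm{supp}(Bx_{\lambda_2}(v))\subseteq K\subseteq\mathcal{I}_z(v)\}$ (supp = set of indices of nonzero entries). For $K\subseteq\{1,\dots,L-1\}$ let $\Sigma_K$ be the diagonal $(L-1)\times(L-1)$ matrix with $i$-th diagonal entry $0$ if $i\in K$ and $1$ otherwise. Set $\mathcal{Q}_x(v)=\{I-B^T(\Sigma_KBB^T\Sigma_K)^\dagger B:K\in\mathcal{K}_z(v)\}$ ($\dagger$ = Moore–Penrose pseudoinverse) and $$\widehat{\partial}\mathrm{Prox}_\varphi(v)=\{M\in\mathbb{S}^L_+:M=\Upsilon Q,\ \Upsilon\in\partial_B\mathrm{Prox}_{\lambda_1\|\cdot\|_1}(x_{\lambda_2}(v)),\ Q\in\mathcal{Q}_x(v)\},$$ where the B-subdifferential $\partial_BF(x)$ is the set of limits of Jacobians $F'(x^i)$ along sequences $x^i\to x$ of differentiability points of $F$. Surrogate generalized Jacobian of $\mathrm{Prox}_{\mathcal{P}}$ at $Z\in\mathcal{Y}$: a linear operator $\mathcal{W}$ on $\mathcal{Y}$ is in $\widehat{\partial}\mathrm{Prox}_{\mathcal{P}}(Z)$ iff there are $M^{(ij)}\in\widehat{\partial}\mathrm{Prox}_\varphi(Z_{[ij]})$, $i<j$, such that for all $Y\in\mathcal{Y}$: $(\mathcal{W}[Y])_{[ij]}=M^{(ij)}Y_{[ij]}$ if $i<j$, $=Y_{[ii]}$ if $i=j$, $=M^{(ji)}Y_{[ij]}$ if $j<i$.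 Let $U_k(X)=\Theta^k+\sigma_k(X-S)$ and $W_k^{(l)}(X)=(\Omega^{(l)})^k-\sigma_kX^{(l)}$. Then $\nabla\Phi_k(X)=-\mathrm{Prox}_{\sigma_k\mathcal{P}}(U_k(X))+(\phi^+_{\sigma_k}(W_k^{(1)}(X)),\dots,\phi^+_{\sigma_k}(W_k^{(L)}(X)))$ and $\nabla\widehat{\Phi}_k(X)=\nabla\Phi_k(X)-(X-\bar X^k)/\sigma_k$. The surrogate generalized Jacobian $\widehat{\partial}(\nabla\Phi_k)(X)$ consists of all linear operators $\mathcal{V}$ on $\mathcal{Y}$ of the form $$\mathcal{V}[D]=-\sigma_k\mathcal{G}[D]-\sigma_k\big((\phi^+_{\sigma_k})'(W_k^{(1)}(X))[D^{(1)}],\dots,(\phi^+_{\sigma_k})'(W_k^{(L)}(X))[D^{(L)}]\big),\quad \mathcal{G}\in\widehat{\partial}\mathrm{Prox}_{\mathcal{P}}(U_k(X)/\sigma_k).$$ SSN method: choose $X^0\in\mathbb{S}^p_{++}\times\cdots\times\mathbb{S}^p_{++}$. For $j=0,1,\dots$: Step 1 (Newton direction). Choose one specific $\mathcal{V}_j\in\widehat{\partial}(\nabla\Phi_k)(X^j)$. Apply the conjugate gradient (CG) method to find an approximate solution $D^j$ to $(\mathcal{V}_j-\sigma_k^{-1}I)[D]=-\nabla\widehat{\Phi}_k(X^j)$ such that $\|(\mathcal{V}_j-\sigma_k^{-1}I)[D^j]+\nabla\widehat{\Phi}_k(X^j)\|\le\min(\bar\eta,\|\nabla\widehat{\Phi}_k(X^j)\|^{1+\tau})$.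 Step 2 (line search). Set $\alpha_j=\rho^{m_j}$, where $m_j$ is the smallest nonnegative integer $m$ for which $\widehat{\Phi}_k(X^j+\rho^mD^j)\ge\widehat{\Phi}_k(X^j)+\mu\rho^m\langle\nabla\widehat{\Phi}_k(X^j),D^j\rangle$. Step 3. Set $X^{j+1}=X^j+\alpha_jD^j$. *)

(* Defs.v *)
From HB Require Import structures.
From mathcomp Require Import all_boot all_order all_algebra.
From mathcomp Require Import all_classical all_reals all_analysis.
From mathcomp Require Import ring.
Set Implicit Arguments.
Unset Strict Implicit.
Unset Printing Implicit Defensive.
Import Order.TTheory GRing.Theory Num.Theory.
Import numFieldNormedType.Exports.
Local Open Scope classical_set_scope.
Local Open Scope ring_scope.

Lemma inner_minkowski (R : rcfType) (V : lmodType R) (f : V -> V -> R) :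
  (forall x y, f x y = f y x) ->
  (forall a x y z, f (a *: x + y) z = a * f x z + f y z) ->
  (forall x, 0 <= f x x) ->
  forall x y, Num.sqrt (f (x + y) (x + y)) <= Num.sqrt (f x x) + Num.sqrt (f y y).
Proof.
move=> fC fL f0 x y.
have fD u v w : f (u + v) w = f u w + f v w.
  by have := fL 1 u v w; rewrite scale1r mul1r.
have fDr u v w : f w (u + v) = f w u + f w v by rewrite fC fD !(fC w).
have f00 w : f 0 w = 0.
  by apply: (@addrI _ (f 0 w)); rewrite addr0 -fD addr0.
have fZ a u w : f (a *: u) w = a * f u w.
  by have := fL a u 0 w; rewrite !addr0 f00 addr0.
have fZr a u w : f w (a *: u) = a * f w u by rewrite fC fZ fC.
have key (t : R) : 0 <= f x x + t * (f x y *+ 2) + t ^+ 2 * f y y.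
  have := f0 (x + t *: y).
  rewrite !(fD, fDr, fZ, fZr) (fC y x) mulr2n mulrDr expr2 !addrA.
  by rewrite !mulrA.
set a := f x x in key *; set b := f x y in key *; set c := f y y in key *.
have a0 : 0 <= a by exact: f0.
have c0 : 0 <= c by exact: f0.
have CS : b ^+ 2 <= a * c.
  have [c_eq0|c_neq0] := eqVneq c 0.
    have [->|b_neq0] := eqVneq b 0; first by rewrite expr0n /= mulr_ge0.
    have := key (- (a + 1) / (b *+ 2)).
    rewrite c_eq0 mulr0 addr0 -mulrA mulVf ?mulrn_eq0// mulr1.
    by rewrite opprD addrA subrr add0r oppr_ge0 ler10.
  have cp : 0 < c by rewrite lt_def c_neq0.
  have := key (- b / c).
  have -> : a + - b / c * (b *+ 2) + (- b / c) ^+ 2 * c = a - b ^+ 2 / c.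
    by field.
  by rewrite subr_ge0 ler_pdivrMr.
have -> : f (x + y) (x + y) = a + b *+ 2 + c.
  by rewrite !(fD, fDr) (fC y x) mulr2n !addrA.
have s0 : 0 <= Num.sqrt a + Num.sqrt c by rewrite addr_ge0 ?sqrtr_ge0.
rewrite -(ger0_norm s0) -sqrtr_sqr ler_sqrt ?sqr_ge0//.
rewrite sqrrD !sqr_sqrtr// lerD2r lerD2l lerMn2r -sqrtrM//=.
apply: le_trans (ler_norm b) _.
by rewrite -sqrtr_sqr ler_sqrt ?mulr_ge0.
Qed.

Definition symmx_pred (R : nzRingType) (p : nat) : {pred 'M[R]_p} :=
  fun A => A^T == A.

Lemma symmx_submod (R : nzRingType) (p : nat) :
  submod_closed (@symmx_pred R p).
Proof.
split=> [|a A B /eqP sA /eqP sB]; first by rewrite unfold_in trmx0.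
by rewrite unfold_in linearP /= sA sB.
Qed.

HB.instance Definition _ (R : nzRingType) (p : nat) :=
  GRing.isSubmodClosed.Build R 'M[R]_p (@symmx_pred R p) (@symmx_submod R p).

(* S^p, normed below by the Frobenius norm (and not by the max norm which the
   library puts on 'M[R]_p). *)
Record symmx (R : nzRingType) (p : nat) :=
  SymMx { symmx_val :> 'M[R]_p ; _ : symmx_val \in @symmx_pred R p }.

HB.instance Definition _ (R : nzRingType) (p : nat) :=
  [isSub for @symmx_val R p].
HB.instance Definition _ (R : nzRingType) (p : nat) :=
  [Choice of symmx R p by <:].
HB.instance Definition _ (R : nzRingType) (p : nat) :=
  [SubChoice_isSubLmodule of symmx R p by <:].

Section Frobenius.
Context {R : realType} {p : nat}.
Implicit Types A B C : symmx R p.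

Definition mxinner A B : R := \tr (A^T *m B).

Lemma mxinnerE A B : mxinner A B = \sum_i \sum_j A i j * B i j.
Proof.
rewrite /mxinner /mxtrace exchange_big /=; apply: eq_bigr => i _.
by rewrite mxE; apply: eq_bigr => j _; rewrite mxE.
Qed.

Lemma mxinnerC A B : mxinner A B = mxinner B A.
Proof.
by rewrite !mxinnerE; do 2!apply: eq_bigr => ? _; rewrite mulrC.
Qed.

Lemma mxinnerL a A B C : mxinner (a *: A + B) C = a * mxinner A C + mxinner B C.
Proof.
by rewrite /mxinner [val _]/= linearP /= mulmxDl -scalemxAl linearP.
Qed.

Lemma mxinner_ge0 A : 0 <= mxinner A A.
Proof. by rewrite mxinnerE; do 2!apply: sumr_ge0 => ? _; rewrite -expr2 sqr_ge0. Qed.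

Lemma mxinner_eq0 A : mxinner A A = 0 -> A = 0.
Proof.
rewrite mxinnerE => /eqP; rewrite psumr_eq0 => [|i _]; last first.
  by apply: sumr_ge0 => j _; rewrite -expr2 sqr_ge0.
move=> /allP A0; apply: val_inj; apply/matrixP => i j /=.
have /implyP := A0 i (mem_index_enum _).
rewrite psumr_eq0 => [/(_ isT)/allP/(_ j (mem_index_enum _))/=|k _]; last first.
  by rewrite -expr2 sqr_ge0.
by rewrite mulf_eq0 orbb mxE => /eqP.
Qed.

Definition mxnorm A : R := Num.sqrt (mxinner A A).

Lemma mxnormD A B : mxnorm (A + B) <= mxnorm A + mxnorm B.
Proof. exact: (inner_minkowski mxinnerC mxinnerL mxinner_ge0). Qed.

Lemma mxinnerZZ a A : mxinner (a *: A) (a *: A) = a ^+ 2 * mxinner A A.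
Proof.
rewrite !mxinnerE mulr_sumr; apply: eq_bigr => i _; rewrite mulr_sumr.
by apply: eq_bigr => j _ /=; rewrite !mxE expr2 mulrACA.
Qed.

Lemma mxnormZ a A : mxnorm (a *: A) = `|a| * mxnorm A.
Proof. by rewrite /mxnorm mxinnerZZ sqrtrM ?sqr_ge0// sqrtr_sqr. Qed.

Lemma mxnorm_eq0 A : mxnorm A = 0 -> A = 0.
Proof.
move/eqP; rewrite sqrtr_eq0 => A0; apply: mxinner_eq0.
by apply/eqP; rewrite eq_le A0 mxinner_ge0.
Qed.

HB.instance Definition _ :=
  Lmodule_isNormed.Build R (symmx R p) mxnormD mxnormZ mxnorm_eq0.

End Frobenius.

(* The space Y = S^p x ... x S^p. *)
Definition symtup (R : realType) (L p : nat) := {ffun 'I_L -> symmx R p}.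

HB.instance Definition _ (R : realType) (L p : nat) :=
  GRing.Lmodule.on (symtup R L p).

Section ProductNorm.
Context {R : realType} {L p : nat}.
Implicit Types X Y Z : symtup R L p.

Definition inner X Y : R := \sum_l mxinner (X l) (Y l).

Lemma innerC X Y : inner X Y = inner Y X.
Proof. by apply: eq_bigr => l _; rewrite mxinnerC. Qed.

Lemma innerL a X Y Z : inner (a *: X + Y) Z = a * inner X Z + inner Y Z.
Proof.
rewrite /inner mulr_sumr -big_split; apply: eq_bigr => l _.
by rewrite !ffunE mxinnerL.
Qed.

Lemma inner_ge0 X : 0 <= inner X X.
Proof. by apply: sumr_ge0 => l _; exact: mxinner_ge0. Qed.

Definition tupnorm X : R := Num.sqrt (inner X X).

Lemma tupnormD X Y : tupnorm (X + Y) <= tupnorm X + tupnorm Y.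
Proof. exact: (inner_minkowski innerC innerL inner_ge0). Qed.

Lemma tupnormZ a X : tupnorm (a *: X) = `|a| * tupnorm X.
Proof.
rewrite /tupnorm.
have -> : inner (a *: X) (a *: X) = a ^+ 2 * inner X X.
  rewrite /inner mulr_sumr; apply: eq_bigr => l _.
  by rewrite !ffunE mxinnerZZ.
by rewrite sqrtrM ?sqr_ge0// sqrtr_sqr.
Qed.

Lemma tupnorm_eq0 X : tupnorm X = 0 -> X = 0.
Proof.
move/eqP; rewrite sqrtr_eq0 => X0.
have /eqP : inner X X = 0 by apply/eqP; rewrite eq_le X0 inner_ge0.
rewrite psumr_eq0 => [/allP X00|l _]; last exact: mxinner_ge0.
apply/ffunP => l; rewrite ffunE; apply: mxinner_eq0.
exact/eqP/(X00 l (mem_index_enum _)).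
Qed.

HB.instance Definition _ :=
  Lmodule_isNormed.Build R (symtup R L p) tupnormD tupnormZ tupnorm_eq0.

End ProductNorm.

Section GeneralNotions.
Context {R : realType}.

Definition psdmx p (A : 'M[R]_p) : Prop :=
  A^T = A /\ forall x : 'cV[R]_p, 0 <= (x^T *m A *m x) 0 0.

Definition pdmx p (A : 'M[R]_p) : Prop :=
  A^T = A /\ forall x : 'cV[R]_p, x != 0 -> 0 < (x^T *m A *m x) 0 0.

Definition argmin (T : pointedType) (C : set T) (f : T -> R) : T :=
  xget point [set x | C x /\ forall y, C y -> f x <= f y].

Definition cvnorm n (x : 'cV[R]_n) : R := Num.sqrt (\sum_i x i 0 ^+ 2).

Definition cvnorm1 n (x : 'cV[R]_n) : R := \sum_i `|x i 0|.

(* Prox on R^n for the Euclidean norm; `|x| would be the max norm of x. *)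
Definition prox_cv n (g : 'cV[R]_n -> R) (u : 'cV[R]_n) : 'cV[R]_n :=
  argmin setT (fun x => g x + 2^-1 * cvnorm (x - u) ^+ 2).

Definition prox_tup L p (g : symtup R L p -> R) (U : symtup R L p) :
    symtup R L p :=
  argmin setT (fun X => g X + 2^-1 * `|X - U| ^+ 2).

(* J is the Jacobian matrix of F at x, acting on column vectors. *)
Definition is_jacobian n (F : 'cV[R]_n -> 'cV[R]_n) (x : 'cV[R]_n)
    (J : 'M[R]_n) : Prop :=
  differentiable F x /\ forall h, 'd F x h = J *m h.

Definition Bsubdiff n (F : 'cV[R]_n -> 'cV[R]_n) (x : 'cV[R]_n) :
    set 'M[R]_n :=
  [set M | exists (u : nat -> 'cV[R]_n) (J : nat -> 'M[R]_n),
    [/\ u @ \oo --> x, forall i, is_jacobian F (u i) (J i) & J @ \oo --> M]].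

(* The four Penrose equations: G is the pseudoinverse of A. *)
Definition is_pinv m n (A : 'M[R]_(m, n)) (G : 'M[R]_(n, m)) : Prop :=
  [/\ A *m G *m A = A, G *m A *m G = G,
      (A *m G)^T = A *m G & (G *m A)^T = G *m A].

Definition is_grad L p (f : symtup R L p -> R) (X G : symtup R L p) : Prop :=
  differentiable (f : symtup R L p -> R^o) X /\
  forall H, 'd (f : symtup R L p -> R^o) X H = inner G H.

Definition grad L p (f : symtup R L p -> R) (X : symtup R L p) : symtup R L p :=
  xget 0 [set G | is_grad f X G].

End GeneralNotions.

Section LogDet.
Context {R : realType} {p : nat}.

Definition neglogdet (A : symmx R p) : \bar R :=
  if `[< pdmx A >] then (- ln (\det A))%:E else +oo%E.

Definition phi_plus1 (beta x : R) : R := (Num.sqrt (x ^+ 2 + 4 * beta) + x) / 2.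

(* The value does not depend on the chosen eigenvalue decomposition of A. *)
Definition phi_plus (beta : R) (A : symmx R p) : symmx R p :=
  xget 0 [set M : symmx R p | exists (Q : 'M[R]_p) (d : 'rV[R]_p),
    [/\ Q^T *m Q = 1%:M, A = Q *m diag_mx d *m Q^T :> 'M[R]_p &
        M = Q *m diag_mx (map_mx (phi_plus1 beta) d) *m Q^T :> 'M[R]_p]].

End LogDet.

Section FusedLasso.
Context {R : realType} {L p : nat}.
Variables lam1 lam2 : R.

Definition Bmx : 'M[R]_(L.-1, L) :=
  \matrix_(i, j) ((j == i :> nat)%:R - (j == i.+1 :> nat)%:R).

Definition fused (x : 'cV[R]_L) : R :=
  lam1 * cvnorm1 x + lam2 * cvnorm1 (Bmx *m x).

Definition entry (X : symtup R L p) (i j : 'I_p) : 'cV[R]_L := \col_l X l i j.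

Definition fgl (X : symtup R L p) : R :=
  \sum_i \sum_(j | i != j) fused (entry X i j).

Definition x_tv (v : 'cV[R]_L) : 'cV[R]_L :=
  prox_cv (fun x => lam2 * cvnorm1 (Bmx *m x)) v.

Definition z_tv (u : 'cV[R]_L.-1) : 'cV[R]_L.-1 :=
  argmin [set z : 'cV[R]_L.-1 | forall i, `|z i 0| <= lam2]
    (fun z => 2^-1 * cvnorm (Bmx^T *m z) ^+ 2 - (z^T *m u) 0 0).

(* supp (B x_tv(v)) \subset K \subset I_z(v) *)
Definition Kset (v : 'cV[R]_L) : set {set 'I_L.-1} :=
  [set K : {set 'I_L.-1} | (forall i, (Bmx *m x_tv v) i 0 != 0 -> i \in K) /\
           (forall i, i \in K -> `|z_tv (Bmx *m v) i 0| = lam2)].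

Definition Sigma_mx (K : {set 'I_L.-1}) : 'M[R]_L.-1 :=
  diag_mx (\row_i (i \notin K)%:R).

Definition Qset (v : 'cV[R]_L) : set 'M[R]_L :=
  [set Q | exists (K : {set 'I_L.-1}) (G : 'M[R]_L.-1),
    [/\ Kset v K,
        is_pinv (Sigma_mx K *m Bmx *m Bmx^T *m Sigma_mx K) G &
        Q = 1%:M - Bmx^T *m G *m Bmx]].

Definition jac_prox_fused (v : 'cV[R]_L) : set 'M[R]_L :=
  [set M | psdmx M /\ exists Ups Q : 'M[R]_L,
    [/\ Bsubdiff (prox_cv (fun x => lam1 * cvnorm1 x)) (x_tv v) Ups,
        Qset v Q & M = Ups *m Q]].

Definition jac_prox_fgl (Z : symtup R L p) :
    set {linear symtup R L p -> symtup R L p} :=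
  [set W : {linear symtup R L p -> symtup R L p} | exists M : 'I_p -> 'I_p -> 'M[R]_L,
    (forall i j : 'I_p, (i < j)%N -> jac_prox_fused (entry Z i j) (M i j)) /\
    forall (Y : symtup R L p) (i j : 'I_p),
      entry (W Y) i j =
        if (i < j)%N then M i j *m entry Y i j
        else if i == j then entry Y i i
        else M j i *m entry Y i j].

End FusedLasso.

Section RPPA.
Context {R : realType} {L p : nat}.
Variables (S : symtup R L p) (lam1 lam2 : R).
Implicit Types (sigma : R) (Theta Omega Xbar X : symtup R L p).

(* X_bar^(k+1) is only required to approximate a maximiser, to an accuracy that
   is left open; it is therefore an unconstrained input of the iteration. *)
Record rppa (sigma : nat -> R) (Theta Omega Xbar : nat -> symtup R L p) : Prop :=
  RPPA {
    rppa_sigma_gt0 : forall k, 0 < sigma k ;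
    rppa_sigma_incr : forall m n, (m <= n)%N -> sigma m <= sigma n ;
    rppa_Theta0 : forall l, psdmx (Theta 0%N l) ;
    rppa_Omega0 : forall l, psdmx (Omega 0%N l) ;
    rppa_ThetaS : forall k, Theta k.+1 =
      prox_tup (fun X => sigma k * fgl lam1 lam2 X)
               (Theta k + sigma k *: (Xbar k.+1 - S)) ;
    rppa_OmegaS : forall k l, Omega k.+1 l =
      phi_plus (sigma k) (Omega k l - sigma k *: Xbar k.+1 l)
  }.

Definition Phi sigma Theta Omega X : \bar R :=
  ereal_inf [set v | exists T O : symtup R L p, v =
    (\sum_l (neglogdet (O l) + (mxinner (S l) (T l))%:E)
     + (fgl lam1 lam2 T - inner (T - O) X
        + (2 * sigma)^-1 * (`|T - Theta| ^+ 2 + `|O - Omega| ^+ 2))%:E)%E].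

(* For 0 < sigma the infimum is finite, so that fine does not lose information. *)
Definition Phi_hat sigma Theta Omega Xbar X : R :=
  fine (Phi sigma Theta Omega X) - (2 * sigma)^-1 * `|X - Xbar| ^+ 2.

Definition jac_grad_Phi sigma Theta Omega X :
    set {linear symtup R L p -> symtup R L p} :=
  [set V : {linear symtup R L p -> symtup R L p} | exists2 G : {linear symtup R L p -> symtup R L p},
    jac_prox_fgl lam1 lam2 (sigma^-1 *: (Theta + sigma *: (X - S))) G &
    forall (D : symtup R L p) (l : 'I_L),
      V D l = - (sigma *: G D l)
        - sigma *: 'd (@phi_plus R p sigma) (Omega l - sigma *: X l) (D l)].

End RPPA.

Section SSN.
Context {R : realType} {L p : nat}.
Implicit Types (A : symtup R L p -> symtup R L p) (b : symtup R L p).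

(* Hestenes-Stiefel conjugate gradients for A x = b from the zero initial guess;
   the state is (iterate, residual, search direction).  Since 0^-1 = 0, the
   iteration is stationary once the residual vanishes. *)
Definition cg_step A (s : symtup R L p * symtup R L p * symtup R L p) :=
  let: (x, r, d) := s in
  let a := inner r r / inner d (A d) in
  let r' := r - a *: A d in
  (x + a *: d, r', r' + (inner r' r' / inner r r) *: d).

Definition cg A b (n : nat) : symtup R L p := (iter n (cg_step A) (0, b, b)).1.1.

Variables (f : symtup R L p -> R)
  (jac : symtup R L p -> set {linear symtup R L p -> symtup R L p})
  (sigma mu eta tau rho : R).

Definition armijo (X D : symtup R L p) (m : nat) : Prop :=
  f (X + rho ^+ m *: D) >= f X + mu * rho ^+ m * inner (grad f X) D.

(* SSN for grad f = 0, where jac is the surrogate generalized Jacobian of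
   x |-> grad f x + sigma^-1 x (up to a constant). *)
Record ssn (X : nat -> symtup R L p) : Prop := SSN {
  ssn_init : forall l, pdmx (X 0%N l) ;
  ssn_step : forall j,
    exists (V : {linear symtup R L p -> symtup R L p}) (D : symtup R L p)
           (m : nat),
    let N := fun Y : symtup R L p => V Y - sigma^-1 *: Y in
    [/\ jac (X j) V,
        (exists n, D = cg N (- grad f (X j)) n),
        `|N D + grad f (X j)| <= Num.min eta (`|grad f (X j)| `^ (1 + tau)),
        (armijo (X j) D m /\ forall n, (n < m)%N -> ~ armijo (X j) D n) &
        X j.+1 = X j + rho ^+ m *: D]
}.

End SSN.

(* Main.v *)
(* Idea.  The infimum defining Phi is attained at Theta = Prox_{sigma P}(U(X)) and
   Omega = phi_plus(W(X)), so Phi_hat is strongly concave with the Lipschitz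
   gradient g = Omega - Theta - (X - Xbar) / sigma.  The prox of P acts entrywise
   through Prox_phi, which is piecewise affine, and near any point every element
   of the surrogate Jacobian maps increments of the prox exactly; phi_plus is
   smooth, its remainder being quadratic because M = phi_plus(A) solves
   M - sigma M^-1 = A.  Hence g is strongly semismooth with respect to the
   surrogate Jacobian, and the Newton operators are uniformly negative definite
   and bounded.
   A CG iterate D satisfies <N D, D> = - <g, D>, and is therefore an ascent
   direction; strong concavity and the Armijo rule give g(X_j) -> 0, hence
   convergence.  Near the solution X_j + D_j is within O(|X_j - Xhat|^(1+tau)) of
   it.  As g is also positively homogeneous around Xhat up to a quadratic error,
   Phi_hat has there a second order expansion along rays with a cubic error, so
   that mu < 1/2 makes the unit step acceptable. *)

Require Import Defs.
From HB Require Import structures.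
From mathcomp Require Import all_boot all_order all_algebra.
From mathcomp Require Import all_classical all_reals all_analysis.
From mathcomp Require Import complex ring lra.
Set Implicit Arguments.
Unset Strict Implicit.
Unset Printing Implicit Defensive.
Import Order.TTheory GRing.Theory Num.Theory.
Import numFieldNormedType.Exports.
Local Open Scope classical_set_scope.
Local Open Scope ring_scope.

(** * Symmetric matrices *)

(** [argmin], [prox_cv], [z_tv], [phi_plus] and [grad] are defined by choice, so each value is first
    tied to a certificate: a subgradient inequality for proximal points, KKT conditions for total
    variation, the equation [M - s M^-1 = A] for [phi_plus]. Estimates then come from comparing
    certificates at two points. The obstacle is that [g] need not be differentiable, so [Phi_hat]
    has no Hessian to expand with. Exactness of the surrogate Jacobian and homogeneity along rays
    replace it, and for total variation both have one source, the local structure of the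
    complementarity relation ([complementarity_near]). For soft thresholding, homogeneity is carried
    over to limits of Jacobians by Euler's relation. Semismoothness and homogeneity are only needed
    around one fixed centre, since only increments to the limit matter in the end. The bound
    [tau <= 1] lets quadratic errors fit into the order [1 + tau]; the bound [eta < 1] keeps the
    residual below a fixed fraction of the gradient, so that a direction is never too short. *)

Section InnerProduct.
Variables (R : rcfType) (V : lmodType R) (f : V -> V -> R).
Hypothesis fC : forall x y, f x y = f y x.
Hypothesis fL : forall a x y z, f (a *: x + y) z = a * f x z + f y z.
Hypothesis f0 : forall x, 0 <= f x x.

Lemma ip0l y : f 0 y = 0.
Proof.
have := fL 1 0 0 y; rewrite scaler0 addr0 mul1r => /eqP.
by rewrite -subr_eq0 opprD addrA subrr sub0r oppr_eq0 => /eqP.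
Qed.

Lemma ipDl x y z : f (x + y) z = f x z + f y z.
Proof. by have := fL 1 x y z; rewrite scale1r mul1r. Qed.

Lemma ipZl a x z : f (a *: x) z = a * f x z.
Proof. by have := fL a x 0 z; rewrite addr0 ip0l addr0. Qed.

Lemma ipNl x z : f (- x) z = - f x z.
Proof. by rewrite -scaleN1r ipZl mulN1r. Qed.

Lemma ipDr x y z : f z (x + y) = f z x + f z y.
Proof. by rewrite fC ipDl !(fC z). Qed.

Lemma ipZr a x z : f z (a *: x) = a * f z x.
Proof. by rewrite fC ipZl fC. Qed.

Lemma ipNr x z : f z (- x) = - f z x.
Proof. by rewrite fC ipNl fC. Qed.

Lemma ip_CS x y : f x y <= Num.sqrt (f x x) * Num.sqrt (f y y).
Proof.
have := inner_minkowski fC fL f0 x y.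
rewrite -ler_sqr ?nnegrE ?addr_ge0 ?sqrtr_ge0//.
rewrite sqr_sqrtr ?f0// sqrrD !sqr_sqrtr ?f0//.
rewrite ipDl !ipDr (fC y x); lra.
Qed.

End InnerProduct.

Lemma sum_CS (R : rcfType) n (a b : 'I_n -> R) :
  (\sum_i a i * b i) ^+ 2 <= (\sum_i a i ^+ 2) * (\sum_i b i ^+ 2).
Proof.
pose f (x y : 'rV[R]_n) := \sum_i x 0 i * y 0 i.
have fC x y : f x y = f y x by apply: eq_bigr => i _; rewrite mulrC.
have fL c x y z : f (c *: x + y) z = c * f x z + f y z.
  by rewrite /f mulr_sumr -big_split; apply: eq_bigr => i _; rewrite !mxE/=; ring.
have f0 x : 0 <= f x x by apply: sumr_ge0 => i _; rewrite -expr2 sqr_ge0.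
pose u := \row_i a i; pose v := \row_i b i.
have -> : \sum_i a i * b i = f u v by apply: eq_bigr => i _; rewrite !mxE.
have -> : \sum_i a i ^+ 2 = f u u by apply: eq_bigr => i _; rewrite !mxE expr2.
have -> : \sum_i b i ^+ 2 = f v v by apply: eq_bigr => i _; rewrite !mxE expr2.
rewrite -real_normK ?num_real// -[leRHS]sqr_sqrtr ?mulr_ge0//.
rewrite ler_sqr ?nnegrE ?sqrtr_ge0// sqrtrM// ler_norml ip_CS// andbT.
rewrite lerNl -(ipNl fL) (le_trans (ip_CS fC fL f0 _ _))//.
by rewrite (ipNl fL) (ipNr fC fL) opprK.
Qed.

Section Frob.
Variable R : rcfType.

Definition frob m n (A : 'M[R]_(m, n)) : R := Num.sqrt (\tr (A^T *m A)).

Lemma trmulE m n (A B : 'M[R]_(m, n)) :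
  \tr (A^T *m B) = \sum_i \sum_j A i j * B i j.
Proof.
rewrite exchange_big; apply: eq_bigr => j _; rewrite mxE.
by apply: eq_bigr => i _; rewrite mxE.
Qed.

Lemma trmul_ge0 m n (A : 'M[R]_(m, n)) : 0 <= \tr (A^T *m A).
Proof.
by rewrite trmulE; do 2!apply: sumr_ge0 => ? _; rewrite -expr2 sqr_ge0.
Qed.

Lemma frob_ge0 m n (A : 'M[R]_(m, n)) : 0 <= frob A.
Proof. exact: sqrtr_ge0. Qed.

Lemma frobM m n q (A : 'M[R]_(m, n)) (B : 'M[R]_(n, q)) :
  frob (A *m B) <= frob A * frob B.
Proof.
rewrite /frob -sqrtrM ?trmul_ge0// ler_sqrt ?mulr_ge0 ?trmul_ge0//.
rewrite !trmulE mulr_suml; apply: ler_sum => i _.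
rewrite [X in _ <= _ * X]exchange_big mulr_sumr; apply: ler_sum => j _ /=.
have := sum_CS (fun k => A i k) (fun k => B k j); rewrite !mxE -expr2.
by congr (_ <= _ * _); apply: eq_bigr => k _; rewrite expr2.
Qed.

Lemma frobB m n (A B : 'M[R]_(m, n)) : frob (A - B) <= frob A + frob B.
Proof.
pose f (x y : 'M[R]_(m, n)) := \tr (x^T *m y).
have fC x y : f x y = f y x by rewrite /f -mxtrace_tr trmx_mul trmxK.
have fL c x y z : f (c *: x + y) z = c * f x z + f y z.
  by rewrite /f linearP /= mulmxDl -scalemxAl linearP.
have := inner_minkowski fC fL (@trmul_ge0 m n) A (- B).
by rewrite (ipNl fL) (ipNr fC fL) opprK.
Qed.

Lemma trmul_CS m n (A B : 'M[R]_(m, n)) : \tr (A^T *m B) <= frob A * frob B.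
Proof.
pose f (x y : 'M[R]_(m, n)) := \tr (x^T *m y).
have fC x y : f x y = f y x by rewrite /f -mxtrace_tr trmx_mul trmxK.
have fL c x y z : f (c *: x + y) z = c * f x z + f y z.
  by rewrite /f linearP /= mulmxDl -scalemxAl linearP.
exact: (ip_CS fC fL (@trmul_ge0 m n) A B).
Qed.

Lemma frobZ m n a (A : 'M[R]_(m, n)) : frob (a *: A) = `|a| * frob A.
Proof.
rewrite /frob.
have -> : \tr ((a *: A)^T *m (a *: A)) = a ^+ 2 * \tr (A^T *m A).
  rewrite !trmulE mulr_sumr; apply: eq_bigr => i _; rewrite mulr_sumr.
  by apply: eq_bigr => j _; rewrite !mxE expr2 mulrACA.
by rewrite sqrtrM ?sqr_ge0// sqrtr_sqr.
Qed.

End Frob.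

(** * The spectral theorem for real symmetric matrices *)

Section Spectral.
Variable R : rcfType.

(** Over [R[i]] the matrix is Hermitian, hence unitarily diagonalisable with real spectrum. Such an
    eigenvalue is a root of the characteristic polynomial, and this property descends to [R]. *)
Lemma symmetric_eigenvalue n (A : 'M[R]_n.+1) :
  A^T = A -> exists r, eigenvalue A r.
Proof.
move=> sA; pose AC := map_mx (real_complex R) A.
have realA : AC \is a realmx.
  by apply/mxOverP => i j; rewrite mxE; apply/Creal_ImP; rewrite -complexIm.
have hA : AC \is hermsymmx.
  apply: realsym_hermsym => //; apply/is_hermitianmxP.
  by rewrite expr0 scale1r map_mx_id// /AC map_trmx sA.
have /orthomx_spectralP := hermitian_normalmx hA.
have := hermitian_spectral_diag_real hA.
set P := spectralmx AC; set d := spectral_diag AC => dR AE.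
have Pu : P \in unitmx by exact: spectral_unit.
have eA : eigenvalue AC (d 0 0).
  apply/eigenvalueP; exists (row 0 P).
    rewrite -row_mul {1}AE -mulmxA mulKVmx// row_mul row_diag_mx.
    by rewrite -scalemxAl -rowE.
  apply/eqP => P0; have := congr1 (row 0) (mulmxV Pu).
  rewrite row_mul P0 mul0mx => /rowP/(_ 0).
  by rewrite !mxE eqxx/= => /eqP; rewrite eq_sym oner_eq0.
exists (complex.Re (d 0 0)).
move: eA; rewrite !eigenvalue_root_char /AC -map_char_poly.
have -> : d 0 0 = (complex.Re (d 0 0))%:C%C.
  by apply/esym/RRe_real; exact/mxOverP.
by rewrite fmorph_root.
Qed.

Lemma rowdot_gt0 n (v : 'rV[R]_n) : v != 0 -> 0 < (v *m v^T) 0 0.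
Proof.
have E : (v *m v^T) 0 0 = \sum_i v 0 i ^+ 2.
  by rewrite mxE; apply: eq_bigr => i _; rewrite mxE expr2.
rewrite lt_def {}E sumr_ge0 ?andbT => [|i _]; last exact: sqr_ge0.
apply: contra; rewrite psumr_eq0 => [/allP z|i _]; last exact: sqr_ge0.
apply/eqP/rowP => i; have := z i (mem_index_enum _).
by rewrite sqrf_eq0 mxE => /eqP.
Qed.

(** The reflection along [u - e], with [e] the first basis vector, exchanges [e] and [u]; when
    [u = e] it degenerates and the identity serves. It completes a unit eigenvector to an orthogonal
    matrix. *)
Lemma householder n (u : 'rV[R]_n.+1) : u *m u^T = 1 ->
  exists H : 'M[R]_n.+1, [/\ H^T = H, H *m H = 1%:M & row 0 H = u].
Proof.
move=> u1; pose e : 'rV[R]_n.+1 := delta_mx 0 0.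
have [w wE] : exists w, w = u - e by exists (u - e).
have [w0|w0] := eqVneq w 0.
  exists 1%:M; split; rewrite ?trmx1 ?mulmx1//.
  by rewrite row1 -/e; apply/esym/eqP; rewrite -subr_eq0 -wE w0.
have dotC (x y : 'rV[R]_n.+1) : (x *m y^T) 0 0 = (y *m x^T) 0 0.
  by rewrite -[in LHS](trmxK (x *m y^T)) mxE trmx_mul trmxK.
have BE (x y : 'M[R]_1) : (x - y) 0 0 = x 0 0 - y 0 0 by rewrite !mxE.
pose c := (w *m w^T) 0 0.
have ee : (e *m e^T) 0 0 = 1.
  by rewrite trmx_delta mul_delta_mx mxE !eqxx.
have uu : (u *m u^T) 0 0 = 1 by rewrite u1 mxE eqxx.
have cE : c = 2 - 2 * (e *m u^T) 0 0.
  by rewrite /c wE linearB /= mulmxBl !mulmxBr !BE uu ee (dotC u e); ring.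
have c0 : c != 0 by rewrite gt_eqF// rowdot_gt0.
have wwc : w *m w^T = c%:M by rewrite [LHS]mx11_scalar.
exists (1%:M - (2 / c) *: (w^T *m w)); split.
- by rewrite linearB linearZ /= trmx1 trmx_mul trmxK.
- rewrite mulmxBl mul1mx mulmxBr mulmx1 -!scalemxAl -!scalemxAr.
  rewrite mulmxA -(mulmxA _ w) wwc mul_mx_scalar -scalemxAl !scalerA.
  have -> : 2 / c * (2 / c * c) = 2 / c + 2 / c by field.
  by rewrite opprB scalerDl addrK subrK.
- rewrite rowE -/e mulmxBr mulmx1 -scalemxAr mulmxA.
  rewrite (mx11_scalar (e *m w^T)) mul_scalar_mx scalerA.
  rewrite {1}wE linearB /= mulmxBr BE ee.
  have -> : 2 / c * ((e *m u^T) 0 0 - 1) = -1.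
    have -> : (e *m u^T) 0 0 - 1 = - c / 2 by rewrite cE; field.
    by field.
  by rewrite scaleN1r opprK wE addrC subrK.
Qed.

(** Deflation: conjugating by the reflection whose first row is a unit eigenvector makes the first
    row, and by symmetry the first column, vanish off the diagonal. Induction then applies to the
    lower right block. *)
Lemma spectral_sym n (A : 'M[R]_n) : A^T = A ->
  exists (Q : 'M[R]_n) (d : 'rV[R]_n), Q^T *m Q = 1%:M /\ A = Q *m diag_mx d *m Q^T.
Proof.
elim: n A => [|n IH] A sA.
  by exists 1%:M, 0; split; apply/matrixP => -[].
have [r /eigenvalueP[v vA v0]] := symmetric_eigenvalue sA.
pose c := (v *m v^T) 0 0.
have c0 : 0 < c by exact: rowdot_gt0.
pose u := (Num.sqrt c)^-1 *: v.
have u1 : u *m u^T = 1.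
  rewrite linearZ /= -scalemxAl -scalemxAr scalerA [v *m _]mx11_scalar -/c.
  rewrite scale_scalar_mx -invfM -expr2 sqr_sqrtr ?ltW// mulVf ?gt_eqF//.
have uA : u *m A = r *: u by rewrite -scalemxAl vA scalerA mulrC -scalerA.
have [H [sH HH Hu]] := householder u1.
pose B : 'M[R]_(1 + n) := H *m A *m H.
have sB : B^T = B by rewrite /B !trmx_mul sH sA mulmxA.
have B0 : row 0 B = r *: delta_mx 0 0.
  rewrite /B !row_mul Hu uA -scalemxAl; congr (_ *: _).
  by rewrite -Hu -row_mul HH row1.
have B0j j : B 0 j = r * (j == 0)%:R.
  by have := congr1 (fun M : 'rV_n.+1 => M 0 j) B0; rewrite !mxE eqxx.
have ul : ulsubmx B = r%:M.
  apply/matrixP => i j; rewrite !ord1 [LHS]mxE [LHS]mxE.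
  have -> : lshift n (0 : 'I_1) = 0 :> 'I_(1 + n) by exact: val_inj.
  by rewrite B0j mulr1 mxE.
have ur : ursubmx B = 0.
  apply/matrixP => i j; rewrite ord1 [LHS]mxE [LHS]mxE.
  have -> : lshift n (0 : 'I_1) = 0 :> 'I_(1 + n) by exact: val_inj.
  rewrite B0j (_ : _ == _ = false) ?mulr0 ?mxE//.
have dl : dlsubmx B = 0 by rewrite -sB -trmx_ursub ur trmx0.
have sD : (drsubmx B)^T = drsubmx B by rewrite trmx_drsub sB.
have [Q' [d' [QQ DE]]] := IH _ sD.
pose Q1 : 'M[R]_(1 + n) := block_mx 1%:M 0 0 Q'.
have Q11 : Q1^T *m Q1 = 1%:M.
  rewrite /Q1 tr_block_mx trmx1 !trmx0 mulmx_block !mulmx0 !mul0mx QQ.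
  by rewrite !mulmx1 !add0r !addr0 -scalar_mx_block.
have BE : B = Q1 *m diag_mx (row_mx r%:M d') *m Q1^T.
  rewrite -[LHS]submxK ul ur dl DE diag_mx_row /Q1 tr_block_mx trmx1 !trmx0.
  rewrite !mulmx_block !mulmx0 !mul0mx !mulmx1 !mul1mx !add0r !addr0.
  rewrite !mul0mx; congr block_mx.
  by apply/matrixP => i j; rewrite !ord1 !mxE eqxx !mulr1n.
pose Q2 : 'M[R]_n.+1 := H *m Q1.
exists Q2, (row_mx r%:M d'); rewrite /Q2; split.
  by rewrite trmx_mul sH -mulmxA (mulmxA H) HH mul1mx.
rewrite trmx_mul sH !mulmxA -2!(mulmxA H) -BE /B !mulmxA HH mul1mx.
by rewrite -mulmxA HH mulmx1.
Qed.

End Spectral.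

(** Both differentials of the development, that of [phi_plus] and that of the objective, are
    obtained from this criterion. The bound [k] on [D] supplies its continuity, which is part of
    differentiability. *)
Lemma differentiable_quadratic (R : realType) (V W : normedModType R)
    (F : V -> W) (x : V) (D : {linear V -> W}) (k C : R) :
  0 <= k -> 0 <= C -> (forall h, `|D h| <= k * `|h|) ->
  (forall h, `|h| <= 1 -> `|F (h + x) - F x - D h| <= C * `|h| ^+ 2) ->
  differentiable F x /\ 'd F x = D :> (V -> W).
Proof.
move=> k0 C0 Dk FC.
have cD : continuous D.
  apply: bounded_linear_continuous; exists k; split; first exact: num_real.
  move=> M kM; apply/nbhs_norm0P; exists 1 => //= y /ltW y1.
  by rewrite /= (le_trans (Dk _))// (le_trans _ (ltW kM))// ler_piMr.
have oD : F \o shift x = cst (F x) + D +o_ 0 id.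
  apply/eqaddoP => eps eps0; apply/nbhs_norm0P.
  exists (Num.min 1 (eps / (C + 1))).
    by rewrite /= lt_min ltr01 divr_gt0// ltr_wpDl.
  move=> h /=; rewrite lt_min => /andP[/ltW h1 he].
  rewrite -[_ h]/(F (h + x) - (F x + D h)) opprD addrA.
  rewrite (le_trans (FC _ h1))// expr2 mulrA ler_wpM2r//.
  move: he; rewrite ltr_pdivlMr ?ltr_wpDl// => /ltW; apply: le_trans.
  by rewrite mulrC ler_wpM2l// lerDl.
have dE : 'd F x = D :> (V -> W) by apply: diff_unique.
by split=> //; apply/diff_locallyP; rewrite dE.
Qed.

Section SymMatrices.
Context {R : realType} {p : nat}.
Implicit Types A B K : symmx R p.

Lemma symmxT A : (A : 'M[R]_p)^T = A.
Proof. by case: A => A /= /eqP. Qed.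

Lemma symmx_normE A : `|A| = frob (A : 'M[R]_p).
Proof. by []. Qed.

Lemma mxinner_normE A : mxinner A A = `|A| ^+ 2.
Proof. by rewrite symmx_normE sqr_sqrtr// trmul_ge0. Qed.

Lemma mxinnerNl A K : mxinner (- A) K = - mxinner A K.
Proof. exact: (ipNl mxinnerL). Qed.
Lemma mxinnerNr A K : mxinner K (- A) = - mxinner K A.
Proof. exact: (ipNr mxinnerC mxinnerL). Qed.
Lemma mxinnerZl a A K : mxinner (a *: A) K = a * mxinner A K.
Proof. exact: (ipZl mxinnerL). Qed.
Lemma mxinnerZr a A K : mxinner K (a *: A) = a * mxinner K A.
Proof. exact: (ipZr mxinnerC mxinnerL). Qed.

Lemma mxinner_CS A B : mxinner A B <= `|A| * `|B|.
Proof. exact: (ip_CS mxinnerC mxinnerL mxinner_ge0). Qed.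

End SymMatrices.

(** The trace is the squared Frobenius norm of [N^T H K]. Hence [H |-> P1 H P2] is a positive
    operator whenever [P1] and [P2] are of the form [N N^T]. *)
Lemma trmul_congr_ge0 (R : rcfType) n (N K H : 'M[R]_n) :
  0 <= \tr (H^T *m (N *m N^T *m H *m (K *m K^T))).
Proof.
have := trmul_ge0 (N^T *m H *m K); rewrite !trmx_mul trmxK.
rewrite -!mulmxA mxtrace_mulC; congr (0 <= \tr _).
by rewrite !mulmxA.
Qed.

(** * The proximal map of the log-determinant *)

(* [phi_plus s A] is the positive definite solution [M] of [M - s M^-1 = A];
   [Q] and [e] diagonalise the inverse of [M]. *)
Section PhiPlus.
Context {R : realType} {p : nat}.
Implicit Types (s : R) (Q : 'M[R]_p) (e : 'rV[R]_p).

Definition spec Q e : 'M[R]_p := Q *m diag_mx e *m Q^T.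

Record phi_cert s (A M : 'M[R]_p) Q e : Prop := PhiCert {
  phi_cert_orth : Q^T *m Q = 1%:M ;
  phi_cert_gt0 : forall i, 0 < e 0 i ;
  phi_cert_inv : M *m spec Q e = 1%:M ;
  phi_cert_eq : M - A = s *: spec Q e }.

(** Not the symmetric root: a factor [N] with [spec Q e = N N^T] is all that the positivity
    arguments use. *)
Definition spec_sqrt Q e : 'M[R]_p := Q *m diag_mx (map_mx Num.sqrt e).

Lemma spec_sqrtE Q e : (forall i, 0 < e 0 i) ->
  spec Q e = spec_sqrt Q e *m (spec_sqrt Q e)^T.
Proof.
move=> e0; rewrite /spec_sqrt trmx_mul tr_diag_mx mulmxA -(mulmxA Q).
rewrite mulmx_diag /spec; congr (_ *m diag_mx _ *m _).
by apply/rowP => i; rewrite !mxE -expr2 sqr_sqrtr// ltW.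
Qed.

Lemma phi_plus1_gt0 s d : 0 < s -> 0 < phi_plus1 s d.
Proof.
move=> s0; rewrite /phi_plus1 divr_gt0// -ltrBlDr sub0r.
have [d0|d0] := ltP 0 d.
  by rewrite (lt_le_trans _ (sqrtr_ge0 _))// oppr_lt0.
rewrite -[ltLHS]ger0_norm ?oppr_ge0// normrN -sqrtr_sqr ltr_sqrt; last first.
  by rewrite ltr_wpDl ?sqr_ge0// mulr_gt0.
by rewrite ltrDl mulr_gt0.
Qed.

Lemma phi_plus1_eq s d : 0 < s -> phi_plus1 s d - d = s / phi_plus1 s d.
Proof.
move=> s0; have f0 := phi_plus1_gt0 d s0.
apply: (mulIf (lt0r_neq0 f0)); rewrite divfK ?gt_eqF// /phi_plus1.
set r := Num.sqrt _; have : r ^+ 2 = d ^+ 2 + 4 * s.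
  by rewrite sqr_sqrtr// addr_ge0 ?sqr_ge0// mulr_ge0// ltW.
by move=> rE; apply: (@mulfI _ 4) => //; rewrite [RHS](_ : _ = r ^+ 2 - d ^+ 2); [field|rewrite rE; ring].
Qed.

(** The spectral theorem makes the set behind [xget] nonempty, so the chosen value comes with some
    decomposition of [A]. Inverting its eigenvalues gives [e], and the scalar identity
    [phi_plus1_eq] becomes the matrix equation. *)
Lemma phi_plusP s (A : symmx R p) : 0 < s ->
  exists Q e, phi_cert s A (phi_plus s A) Q e.
Proof.
move=> s0; rewrite /phi_plus; set E := [set _ | _].
have /(xgetPex 0) : exists M, E M.
  have [Q [d [QQ AE]]] := spectral_sym (symmxT A).
  pose M := Q *m diag_mx (map_mx (phi_plus1 s) d) *m Q^T.
  have sM : M \in @symmx_pred R p.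
    by apply/eqP; rewrite /M !trmx_mul trmxK tr_diag_mx mulmxA.
  by exists (SymMx sM), Q, d.
move: (xget 0 E) => M [Q [d [QQ AE ME]]].
exists Q, (map_mx (fun x => (phi_plus1 s x)^-1) d); split => //.
- by move=> i; rewrite mxE invr_gt0 phi_plus1_gt0.
- rewrite ME /spec !mulmxA -(mulmxA _ _ Q) QQ mulmx1 -(mulmxA Q) mulmx_diag.
  rewrite (_ : \row_j _ = const_mx 1) ?diag_const_mx ?mulmx1; last first.
    by apply/rowP => i; rewrite !mxE mulfV// gt_eqF// phi_plus1_gt0.
  exact: mulmx1C.
- rewrite ME {1}AE -mulmxBl -mulmxBr /spec -linearB /= scalemxAl scalemxAr -linearZ /=.
  congr (_ *m diag_mx _ *m _).
  by apply/rowP => i; rewrite !mxE phi_plus1_eq.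
Qed.

(** With [P1], [P2] the inverses and [H = M1 - M2], the resolvent identity [P1 H P2 = P2 - P1] turns
    the difference of the two equations into [A1 - A2 = H + s P1 H P2]. The last term pairs
    nonnegatively with [H]. *)
Lemma phi_cert_mono s (A1 M1 A2 M2 : symmx R p) Q1 e1 Q2 e2 : 0 < s ->
  phi_cert s A1 M1 Q1 e1 -> phi_cert s A2 M2 Q2 e2 ->
  `|M1 - M2| ^+ 2 <= mxinner (M1 - M2) (A1 - A2).
Proof.
move=> s0 [_ e10 I1 E1] [_ e20 I2 E2];
have [H HE] : exists H : 'M[R]_p, H = (M1 : 'M[R]_p) - M2 by eexists.
have E : (A1 : 'M[R]_p) - A2 = H + s *: (spec Q1 e1 *m H *m spec Q2 e2).
  have -> : spec Q1 e1 *m H *m spec Q2 e2 = spec Q2 e2 - spec Q1 e1.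
    rewrite HE mulmxBr mulmxBl.
    by rewrite (mulmx1C I1) mul1mx -mulmxA I2 mulmx1.
  rewrite scalerBr -E1 -E2 HE.
  by apply/matrixP => i j; rewrite !mxE; ring.
have -> : `|M1 - M2| ^+ 2 = \tr (H^T *m H) by rewrite -mxinner_normE HE.
have -> : mxinner (M1 - M2) (A1 - A2) = \tr (H^T *m ((A1 : 'M[R]_p) - A2)).
  by rewrite HE.
rewrite E.
rewrite mulmxDr linearD /= lerDl.
rewrite -scalemxAr linearZ /= mulr_ge0 ?(ltW s0)//.
by rewrite !spec_sqrtE// trmul_congr_ge0.
Qed.

Lemma phi_plus_lip s (A1 A2 : symmx R p) : 0 < s ->
  `|phi_plus s A1 - phi_plus s A2| <= `|A1 - A2|.
Proof.
move=> s0; have [Q1 [e1 C1]] := phi_plusP A1 s0.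
have [Q2 [e2 C2]] := phi_plusP A2 s0.
have := le_trans (phi_cert_mono s0 C1 C2) (mxinner_CS _ _).
set h := phi_plus s A1 - _; have := normr_ge0 h.
rewrite le_eqVlt => /orP[/eqP <-//|h0].
by rewrite expr2 ler_pM2l.
Qed.

(** The factor [1 / (1 + s e_i e_j)] is the divided difference of the scalar map [phi_plus1 s] at
    the i-th and j-th eigenvalues, because [d = m - s / m] when [m = phi_plus1 s d]. *)
Definition dphi_mx s Q e (K : 'M[R]_p) : 'M[R]_p :=
  Q *m (\matrix_(i, j) ((Q^T *m K *m Q) i j / (1 + s * (e 0 i * e 0 j)))) *m Q^T.

Lemma dphi_mx_sym s Q e K : K^T = K -> (dphi_mx s Q e K)^T = dphi_mx s Q e K.
Proof.
move=> sK; rewrite /dphi_mx !trmx_mul trmxK mulmxA; congr (_ *m _ *m _).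
apply/matrixP => i j; rewrite 3!mxE mulrC [RHS]mulrC (mulrC (e 0 j)); congr (_ * _).
have -> : (Q^T *m K *m Q) j i = (Q^T *m K *m Q)^T i j by rewrite [RHS]mxE.
by rewrite !trmx_mul trmxK sK mulmxA.
Qed.

Fact dphi_subproof s Q e (K : symmx R p) :
  dphi_mx s Q e K \in @symmx_pred R p.
Proof. by apply/eqP/dphi_mx_sym/symmxT. Qed.

(* The inverse of the operator [H |-> H + s P H P], where [P := spec Q e]. *)
Definition dphi s Q e (K : symmx R p) : symmx R p :=
  SymMx (dphi_subproof s Q e K).

Fact dphi_linear s Q e : linear (dphi s Q e).
Proof.
move=> a K H; apply/val_inj/matrixP => i j.
rewrite -[val (dphi _ _ _ _)]/(dphi_mx s Q e (a *: (K : 'M[R]_p) + (H : 'M[R]_p))).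
rewrite -[RHS]/((a *: dphi_mx s Q e K + dphi_mx s Q e H) i j).
rewrite /dphi_mx scalemxAl scalemxAr -mulmxDl -mulmxDr; congr ((_ *m _ *m _) i j).
apply/matrixP => k l; rewrite mulmxDr mulmxDl -scalemxAr -scalemxAl !mxE.
by rewrite mulrDl -mulrA.
Qed.

HB.instance Definition _ s Q e :=
  GRing.isLinear.Build R (symmx R p) (symmx R p) *:%R (dphi s Q e)
    (dphi_linear s Q e).

Lemma dphiK s Q e (K : symmx R p) : 0 < s -> Q^T *m Q = 1%:M ->
  (forall i, 0 < e 0 i) ->
  (dphi s Q e K : 'M[R]_p)
    + s *: (spec Q e *m dphi s Q e K *m spec Q e) = K.
Proof.
move=> s0 QQ e0; rewrite -[symmx_val (dphi _ _ _ _)]/(dphi_mx s Q e K).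
have QQ' := mulmx1C QQ.
rewrite /dphi_mx /spec; set N := \matrix_(_, _) _.
have -> : Q *m diag_mx e *m Q^T *m (Q *m N *m Q^T) *m (Q *m diag_mx e *m Q^T)
    = Q *m (diag_mx e *m N *m diag_mx e) *m Q^T.
  by rewrite !mulmxA -(mulmxA _ Q^T Q) QQ mulmx1 -(mulmxA _ Q^T Q) QQ mulmx1.
rewrite scalemxAl scalemxAr -mulmxDl -mulmxDr.
have -> : N + s *: (diag_mx e *m N *m diag_mx e) = Q^T *m K *m Q.
  apply/matrixP => i j; rewrite mxE [X in _ + X]mxE mul_mx_diag mxE.
  rewrite mul_diag_mx mxE /N !mxE.
  field; rewrite gt_eqF// addr_gt0// mulr_gt0// mulr_gt0//.
by rewrite !mulmxA QQ' mul1mx -mulmxA QQ' mulmx1.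
Qed.

(** By [dphiK], each argument can be rewritten as the image of its [dphi] under [H |-> H + s P H P],
    which is self-adjoint by cyclicity of the trace. *)
Lemma dphi_selfadj s Q e (K H : symmx R p) : 0 < s -> Q^T *m Q = 1%:M ->
  (forall i, 0 < e 0 i) ->
  mxinner (dphi s Q e K) H = mxinner K (dphi s Q e H).
Proof.
move=> s0 QQ e0; rewrite /mxinner -(dphiK H s0 QQ e0) -[in RHS](dphiK K s0 QQ e0).
set k := symmx_val (dphi _ _ _ K); set h := symmx_val (dphi _ _ _ H).
have sP : (spec Q e)^T = spec Q e.
  by rewrite /spec !trmx_mul trmxK tr_diag_mx mulmxA.
rewrite mulmxDr !linearD /= mulmxDl linearD /=; congr (_ + _).
rewrite -scalemxAr [(s *: _)^T]linearZ /= -scalemxAl !mxtraceZ; congr (_ * _).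
clearbody k h; move: (spec Q e) sP => P sP.
by rewrite trmx_mul sP trmx_mul sP !mulmxA mxtrace_mulC !mulmxA.
Qed.

Lemma dphi_norm s Q e (K : symmx R p) : 0 < s -> Q^T *m Q = 1%:M ->
  (forall i, 0 < e 0 i) -> `|dphi s Q e K| ^+ 2 <= mxinner (dphi s Q e K) K.
Proof.
move=> s0 QQ e0; rewrite -mxinner_normE /mxinner -[in leRHS](dphiK K s0 QQ e0).
rewrite mulmxDr linearD lerDl -scalemxAr linearZ /= mulr_ge0 ?(ltW s0)//.
by rewrite spec_sqrtE// trmul_congr_ge0.
Qed.

Lemma dphi_bound s Q e (K : symmx R p) : 0 < s -> Q^T *m Q = 1%:M ->
  (forall i, 0 < e 0 i) -> `|dphi s Q e K| <= `|K|.
Proof.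
move=> s0 QQ e0; have := le_trans (dphi_norm K s0 QQ e0) (mxinner_CS _ _).
have := normr_ge0 (dphi s Q e K).
by rewrite le_eqVlt => /orP[/eqP <-//|h0]; rewrite expr2 ler_pM2l.
Qed.

(** A bound for the inverse [P] of [phi_plus s A], read off [s P = phi_plus s A - A]. It varies in a
    controlled way with [A] because [phi_plus] is nonexpansive. *)
Definition phi_inv_bound s (A : symmx R p) := (`|phi_plus s A| + `|A|) / s.

Lemma phi_inv_bound_ge0 s A : 0 < s -> 0 <= phi_inv_bound s A.
Proof. by move=> s0; rewrite divr_ge0 ?addr_ge0// ltW. Qed.

Lemma phi_inv_boundP s (A : symmx R p) Q e : 0 < s ->
  phi_cert s A (phi_plus s A) Q e -> frob (spec Q e) <= phi_inv_bound s A.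
Proof.
move=> s0 [_ _ _ E]; rewrite ler_pdivlMr// mulrC.
have := frobB (phi_plus s A) A.
by rewrite E frobZ gtr0_norm.
Qed.

Lemma phi_inv_bound_near s (A B : symmx R p) : 0 < s ->
  phi_inv_bound s B <= phi_inv_bound s A + 2 * `|B - A| / s.
Proof.
move=> s0; rewrite -mulrDl ler_pM2r ?invr_gt0//.
have h1 := phi_plus_lip B A s0.
have h2 := ler_normD (phi_plus s B - phi_plus s A) (phi_plus s A).
have h3 := ler_normD (B - A) A.
by rewrite !subrK in h2 h3; lra.
Qed.

(** Apply [X |-> X + s P X P] to the remainder [d]. With [H] the increment of [phi_plus], the
    resolvent identity reduces the result to [s P H P H P'], which is quadratic in [H]. The operator
    is at least the identity, so [d] is no larger than this, and [H] is no larger than [A' - A]. *)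
Lemma phi_plus_taylor s (A A' : symmx R p) Q e : 0 < s ->
  phi_cert s A (phi_plus s A) Q e ->
  `|phi_plus s A' - phi_plus s A - dphi s Q e (A' - A)|
    <= s * phi_inv_bound s A ^+ 2 * phi_inv_bound s A' * `|A' - A| ^+ 2.
Proof.
move=> s0 C; have [Q' [e' C']] := phi_plusP A' s0.
have b := phi_inv_boundP s0 C; have b' := phi_inv_boundP s0 C'.
have HA := phi_plus_lip A' A s0.
case: C => QQ e0 I E; case: C' => _ _ I' E'.
set d := phi_plus s A' - phi_plus s A - dphi s Q e (A' - A).
set P := spec Q e in b I E; set P' := spec Q' e' in b' I' E'.
have [H HE] : exists H : 'M[R]_p, H = (phi_plus s A' : 'M[R]_p) - phi_plus s A.
  by eexists.
have HA' : frob H <= `|A' - A| by rewrite HE.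
have PP : P *m H *m P' = P - P'.
  by rewrite HE mulmxBr mulmxBl (mulmx1C I) mul1mx -mulmxA I' mulmx1.
have dE : (d : 'M[R]_p) = H - dphi s Q e (A' - A) by rewrite HE.
clearbody d.
have LE : (d : 'M[R]_p) + s *: (P *m d *m P)
    = s *: (P *m H *m (P *m H *m P')).
  have := dphiK (A' - A) s0 QQ e0; rewrite -/P dE.
  set D := symmx_val (dphi _ _ _ _) => DE.
  rewrite mulmxBr mulmxBl scalerBr addrACA -opprD DE PP mulmxBr.
  rewrite -[_ *m P']mulmxA mulmxA PP scalerBr.
  have -> : (A' - A : symmx R p) = (H - s *: (P' - P)) :> 'M[R]_p.
    rewrite scalerBr -E -E' HE.
    by apply/matrixP => i j; rewrite !mxE; ring.
  by apply/matrixP => i j; rewrite !mxE; ring.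
have d2 : `|d| ^+ 2 <= `|d| * frob (s *: (P *m H *m (P *m H *m P'))).
  rewrite -LE; apply: le_trans (trmul_CS _ _).
  rewrite -mxinner_normE /mxinner mulmxDr linearD lerDl -scalemxAr linearZ /=.
  by rewrite mulr_ge0 ?(ltW s0)// /P spec_sqrtE// trmul_congr_ge0.
have {d2} : `|d| <= frob (s *: (P *m H *m (P *m H *m P'))).
  move: d2; have := normr_ge0 d; rewrite le_eqVlt => /orP[/eqP <- _|h0].
    exact: frob_ge0.
  by rewrite expr2 ler_pM2l.
move/le_trans; apply; rewrite frobZ gtr0_norm//.
have -> : s * phi_inv_bound s A ^+ 2 * phi_inv_bound s A' * `|A' - A| ^+ 2
    = s * (phi_inv_bound s A * `|A' - A|
           * (phi_inv_bound s A * `|A' - A| * phi_inv_bound s A')).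
  by ring.
rewrite ler_pM2l//.
have bb := phi_inv_bound_ge0 A s0.
have PH : frob (P *m H) <= phi_inv_bound s A * `|A' - A|.
  by rewrite (le_trans (frobM _ _))// ler_pM// frob_ge0.
have PHP : frob (P *m H *m P') <= phi_inv_bound s A * `|A' - A| * phi_inv_bound s A'.
  by rewrite (le_trans (frobM _ _))// ler_pM// frob_ge0.
apply: le_trans (frobM _ _) _.
exact: ler_pM (frob_ge0 _) (frob_ge0 _) PH PHP.
Qed.

Lemma phi_plus_diff s (A : symmx R p) Q e : 0 < s ->
  phi_cert s A (phi_plus s A) Q e ->
  'd (@phi_plus R p s) A = dphi s Q e :> (symmx R p -> symmx R p).
Proof.
move=> s0 C; have b0 := phi_inv_bound_ge0 A s0.
have [] // := @differentiable_quadratic R (symmx R p) (symmx R p)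
  (phi_plus s) A (dphi s Q e) 1
  (s * phi_inv_bound s A ^+ 2 * (phi_inv_bound s A + 2 / s)).
- by rewrite mulr_ge0 ?addr_ge0 ?divr_ge0 ?(ltW s0)// mulr_ge0 ?sqr_ge0 ?ltW.
- by move=> h; rewrite mul1r; case: C => ? ? _ _; exact: dphi_bound.
- move=> h h1; have := phi_plus_taylor (h + A) s0 C; rewrite addrK.
  move/le_trans; apply; rewrite ler_wpM2r ?sqr_ge0// ler_wpM2l//.
    by rewrite mulr_ge0 ?sqr_ge0// ltW.
  apply: le_trans (phi_inv_bound_near A (h + A) s0) _.
  by rewrite addrK lerD2l ler_pM2r ?invr_gt0// -[leRHS]mulr1 ler_pM2l.
Qed.

Lemma diff_phi_plus_selfadj s (A K H : symmx R p) : 0 < s ->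
  mxinner ('d (@phi_plus R p s) A K) H = mxinner K ('d (@phi_plus R p s) A H).
Proof.
move=> s0; have [Q [e C]] := phi_plusP A s0.
by rewrite (phi_plus_diff s0 C) dphi_selfadj//; case: C.
Qed.

Lemma diff_phi_plus_ge0 s (A K : symmx R p) : 0 < s ->
  0 <= mxinner ('d (@phi_plus R p s) A K) K.
Proof.
move=> s0; have [Q [e C]] := phi_plusP A s0.
rewrite (phi_plus_diff s0 C); apply: le_trans (dphi_norm _ s0 _ _).
- exact: sqr_ge0.
- by case: C.
- by case: C.
Qed.

Lemma diff_phi_plus_bound s (A K : symmx R p) : 0 < s ->
  `|'d (@phi_plus R p s) A K| <= `|K|.
Proof.
move=> s0; have [Q [e C]] := phi_plusP A s0.
by rewrite (phi_plus_diff s0 C) dphi_bound//; case: C.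
Qed.

Lemma phi_plus_local s (A0 : symmx R p) : 0 < s ->
  exists2 C, 0 <= C & forall A A', `|A - A0| <= 1 -> `|A' - A0| <= 1 ->
  `|phi_plus s A' - phi_plus s A - 'd (@phi_plus R p s) A (A' - A)|
     <= C * `|A' - A| ^+ 2.
Proof.
move=> s0; set b := phi_inv_bound s A0 + 2 / s.
have b0 : 0 <= b by rewrite addr_ge0 ?phi_inv_bound_ge0// divr_ge0// ltW.
have bP (A : symmx R p) : `|A - A0| <= 1 -> phi_inv_bound s A <= b.
  move=> A1; apply: le_trans (phi_inv_bound_near A0 A s0) _.
  by rewrite lerD2l ler_pM2r ?invr_gt0// -[leRHS]mulr1 ler_pM2l.
exists (s * b ^+ 2 * b); first by rewrite !mulr_ge0 ?sqr_ge0// ltW.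
move=> A A' /bP bA /bP bA'; have [Q [e C]] := phi_plusP A s0.
rewrite (phi_plus_diff s0 C); apply: le_trans (phi_plus_taylor _ s0 C) _.
rewrite ler_wpM2r ?sqr_ge0// ler_pM ?phi_inv_bound_ge0//.
  by rewrite mulr_ge0 ?sqr_ge0// ltW.
by rewrite ler_pM2l// ler_sqr ?nnegrE ?phi_inv_bound_ge0.
Qed.

(** The gradient inequality of the concave function [ln det] at [M]. Writing the inverse of [M] as
    [N N^T], the eigenvalues [d] of [N^T X N] are positive, their product is [det X / det M], and
    the sum of [d_i - 1] is the right-hand side; then [ln t <= t - 1]. *)
Lemma ln_det_le s (A M X : symmx R p) Q e :
  phi_cert s A M Q e -> pdmx X ->
  ln (\det X) - ln (\det M) <= \tr (spec Q e *m (X - M)).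
Proof.
case=> QQ e0 I _ [_ Xpd]; set N := spec_sqrt Q e.
have PE := spec_sqrtE Q e0; rewrite -/N in PE; clearbody N.
have sY : (N^T *m X *m N)^T = N^T *m X *m N.
  by rewrite trmx_mul [(N^T *m X)^T]trmx_mul trmxK symmxT mulmxA.
have [U [d [UU YE]]] := spectral_sym sY.
have UU' := mulmx1C UU.
have Nu : N \in unitmx.
  have := mulmx1_unit I => -[_]; rewrite PE.
  by rewrite !unitmxE det_mulmx unitrM => /andP[].
have dE : diag_mx d = U^T *m (N^T *m X *m N) *m U.
  by rewrite YE !mulmxA UU mul1mx -mulmxA UU mulmx1.
have d0 i : 0 < d 0 i.
  (* The i-th eigenvector of [N^T X N] carried back by [N]: its quadratic form under [X] is
     [d_i]. *)
  pose x := N *m U *m delta_mx i 0 : 'cV[R]_p.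
  have -> : d 0 i = (x^T *m X *m x) 0 0.
    have -> : x^T *m X *m x
        = delta_mx 0 i *m (U^T *m (N^T *m X *m N) *m U) *m delta_mx i 0.
      by rewrite /x !trmx_mul trmx_delta !mulmxA.
    by rewrite -dE -rowE -colE !mxE eqxx.
  apply: Xpd; rewrite /x; apply/eqP => x0.
  have : U^T *m invmx N *m (N *m U *m delta_mx i 0) = 0 :> 'cV[R]_p.
    by rewrite x0 mulmx0.
  rewrite !mulmxA -(mulmxA _ (invmx N)) mulVmx// mulmx1 UU mul1mx.
  by move/matrixP/(_ i 0); rewrite !mxE !eqxx => /eqP; rewrite oner_eq0.
have detP : \det X / \det M = \prod_i d 0 i.
  have := congr1 determinant dE; rewrite det_diag => ->.
  have UU1 : \det U^T * \det U = 1 by rewrite -det_mulmx UU det1.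
  have MM1 : \det M * (\det N * \det N^T) = 1.
    by rewrite -det_mulmx -PE -det_mulmx I det1.
  rewrite !det_mulmx mulrAC UU1.
  have M0 : \det M != 0.
    by apply/eqP => M0; move: MM1; rewrite M0 mul0r => /eqP; rewrite eq_sym oner_eq0.
  by apply: (mulIf M0); rewrite divfK//; ring: MM1.
have N1 : \tr (spec Q e *m (X - M)) = \sum_i (d 0 i - 1).
  have -> : \sum_i (d 0 i - 1) = \tr (diag_mx d) - p%:R.
    by rewrite mxtrace_diag big_split /= sumrN sumr_const card_ord.
  rewrite -[symmx_val (X - M)]/((X : 'M[R]_p) - M) mulmxBr (mulmx1C I).
  rewrite linearB /= mxtrace1 dE; congr (_ - _).
  rewrite [RHS]mxtrace_mulC [U *m _]mulmxA UU' mul1mx [RHS]mxtrace_mulC PE.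
  by rewrite [N *m (_ *m _)]mulmxA.
have Mdet : 0 < \det M.
  have : \det M * (\det N * \det N) = 1.
    by rewrite -[X in _ * (_ * X)]det_tr -det_mulmx -PE -det_mulmx I det1.
  move=> MN; rewrite -[ltRHS]mulr1 -(@pmulr_lgt0 _ (\det N ^+ 2)) ?mulr1.
    by rewrite expr2 MN.
  by rewrite exprn_even_gt0//= -unitfE -unitmxE.
have Xdet : 0 < \det X.
  rewrite -(@pmulr_lgt0 _ (\det M)^-1) ?invr_gt0// detP.
  by apply: prodr_gt0 => i _.
rewrite -ln_div ?posrE// detP N1.
have : 0 < \prod_i d 0 i /\ ln (\prod_i d 0 i) = \sum_i ln (d 0 i).
  apply: (big_rec2 (fun a b => 0 < a /\ ln a = b)) => [|i a b _ [a0 <-]].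
    by rewrite ln1.
  by split; [rewrite mulr_gt0|rewrite lnM ?posrE].
case=> _ ->; apply: ler_sum => i _.
have := @le_ln1Dx R (d 0 i - 1); rewrite subrKC; apply.
by rewrite ltrBrDr addNr.
Qed.

(** With [P = N N^T] the inverse of [M], one has [M = M P M = (M N)(M N)^T]; invertibility gives
    strictness. *)
Lemma phi_cert_pd s (A M : symmx R p) Q e : phi_cert s A M Q e -> pdmx M.
Proof.
case=> QQ e0 I _; split; first exact: symmxT.
move=> x x0; have PE := spec_sqrtE Q e0; set N := spec_sqrt Q e in PE.
have ME : (M : 'M[R]_p) = ((M : 'M[R]_p) *m N) *m (M *m N)^T.
  by rewrite trmx_mul symmxT mulmxA -(mulmxA _ N) -PE I mul1mx.
pose y := x^T *m M *m N.
have -> : (x^T *m M *m x) 0 0 = (y *m y^T) 0 0.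
  by rewrite ME /y !trmx_mul !symmxT !trmxK !mulmxA.
apply: rowdot_gt0; apply/eqP => y0; have : y *m N^T *m x = 0.
  by rewrite y0 !mul0mx.
rewrite /y -(mulmxA _ N) -PE -(mulmxA _ M) I mulmx1 => xx.
have := @rowdot_gt0 R p x^T; rewrite trmxK xx mxE ltxx; case/(_ _)/wrap => //.
by apply: contra x0 => /eqP xT; rewrite -[x]trmxK xT trmx0.
Qed.

End PhiPlus.

(** * The proximal map of the fused Lasso *)

Section ColumnDot.
Context {R : realType} {n : nat}.
Implicit Types x y z : 'cV[R]_n.

Definition dot x y : R := \tr (x^T *m y).

Lemma dotE x y : dot x y = \sum_i x i 0 * y i 0.
Proof. by rewrite /dot trmulE; apply: eq_bigr => i _; rewrite big_ord1. Qed.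

Lemma dotC x y : dot x y = dot y x.
Proof. by rewrite !dotE; apply: eq_bigr => i _; rewrite mulrC. Qed.

Lemma dotL a x y z : dot (a *: x + y) z = a * dot x z + dot y z.
Proof.
rewrite !dotE mulr_sumr -big_split; apply: eq_bigr => i _.
by rewrite !mxE mulrDl mulrA.
Qed.

Lemma dot_ge0 x : 0 <= dot x x.
Proof. exact: trmul_ge0. Qed.

Lemma dotDl x y z : dot (x + y) z = dot x z + dot y z.
Proof. exact: (ipDl dotL). Qed.
Lemma dotDr x y z : dot z (x + y) = dot z x + dot z y.
Proof. exact: (ipDr dotC dotL). Qed.
Lemma dotNl x z : dot (- x) z = - dot x z.
Proof. exact: (ipNl dotL). Qed.
Lemma dotNr x z : dot z (- x) = - dot z x.
Proof. exact: (ipNr dotC dotL). Qed.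
Lemma dotZl a x z : dot (a *: x) z = a * dot x z.
Proof. exact: (ipZl dotL). Qed.
Lemma dotZr a x z : dot z (a *: x) = a * dot z x.
Proof. exact: (ipZr dotC dotL). Qed.

Lemma dot_CS x y : dot x y <= frob x * frob y.
Proof. exact: trmul_CS. Qed.

Lemma frob_sqr x : frob x ^+ 2 = dot x x.
Proof. by rewrite sqr_sqrtr// dot_ge0. Qed.

Lemma frob0_eq0 x : frob x <= 0 -> x = 0.
Proof.
move=> x0; have : dot x x = 0.
  by rewrite -frob_sqr (_ : frob x = 0) ?expr0n//; apply/le_anti; rewrite x0 frob_ge0.
rewrite dotE => /eqP; rewrite psumr_eq0 => [/allP z|i _]; last first.
  by rewrite -expr2 sqr_ge0.
apply/colP => i; have := z i (mem_index_enum _).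
by rewrite -expr2 sqrf_eq0 mxE => /eqP.
Qed.

Lemma cvnormE x : cvnorm x = frob x.
Proof.
by rewrite /cvnorm /frob -/(dot x x) dotE.
Qed.

Lemma ler_frobD x y : frob (x + y) <= frob x + frob y.
Proof. exact: (inner_minkowski dotC dotL dot_ge0). Qed.

Lemma frobN x : frob (- x) = frob x.
Proof. by rewrite -scaleN1r frobZ normrN normr1 mul1r. Qed.

Lemma frob_distC x y : frob (x - y) = frob (y - x).
Proof. by rewrite -frobN opprB. Qed.

Lemma coord_le_frob x i : `|x i 0| <= frob x.
Proof.
rewrite -ler_sqr ?nnegrE ?frob_ge0// frob_sqr dotE real_normK ?num_real//.
rewrite (bigD1 i)//= -expr2 lerDl sumr_ge0// => j _.
by rewrite -expr2 sqr_ge0.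
Qed.

Lemma le_frob_sqr x y : dot x x <= dot y x -> frob x <= frob y.
Proof.
rewrite -frob_sqr => /le_trans-/(_ _ (dot_CS y x)).
have := frob_ge0 x; rewrite le_eqVlt => /orP[/eqP <- _|x0].
  exact: frob_ge0.
by rewrite expr2 ler_pM2r.
Qed.

End ColumnDot.

Lemma dot_mul (R : realType) m n (A : 'M[R]_(m, n)) x y :
  dot (A *m x) y = dot x (A^T *m y).
Proof. by rewrite /dot trmx_mul mulmxA. Qed.

(** Limits and differentials of matrices refer to the maximum norm, whereas the estimates are
    Euclidean; this direction of the norm equivalence is the one needed to pass over. *)
Lemma frob_le_norm (R : realType) m n :
  exists2 c : R, 0 <= c & forall A : 'M[R]_(m, n), frob A <= c * `|A|.
Proof.
exists (Num.sqrt (m%:R * n%:R)) => [|A]; first exact: sqrtr_ge0.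
rewrite -ler_sqr ?nnegrE ?frob_ge0 ?mulr_ge0 ?sqrtr_ge0//.
rewrite /frob sqr_sqrtr ?trmul_ge0// exprMn sqr_sqrtr ?mulr_ge0//.
rewrite trmulE; have : forall i j, A i j * A i j <= `|A| ^+ 2.
  move=> i j; rewrite -expr2 -(real_normK (num_real (A i j))) ler_sqr ?nnegrE//.
  rewrite -[`|A|]/(mx_norm A) mx_normrE.
  exact: (le_bigmax_cond _ (fun ij : 'I_m * 'I_n => `|A ij.1 ij.2|) (j := (i, j))).
move=> h; apply: (@le_trans _ _ (\sum_(i < m) \sum_(j < n) `|A| ^+ 2)).
  by do 2!apply: ler_sum => ? _.
by rewrite !sumr_const !card_ord -[leRHS]mulrA mulr_natl mulr_natl -mulrnA mulrnA.
Qed.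

Section Prox.
Context {R : realType} {n : nat}.
Implicit Types (g : 'cV[R]_n -> R) (u x w : 'cV[R]_n).

(** Expanding the square around [x] shows that the prox objective exceeds its value at [x] by at
    least [|w - x|^2 / 2]. So [x] is a minimiser, and the only one, whence the choice in [argmin]
    must return it. *)
Lemma prox_cvP g u x :
  (forall w, g x + dot (u - x) (w - x) <= g w) -> prox_cv g u = x.
Proof.
move=> gx.
have E w : g x + 2^-1 * cvnorm (x - u) ^+ 2 + 2^-1 * frob (w - x) ^+ 2
    <= g w + 2^-1 * cvnorm (w - u) ^+ 2.
  have := gx w; rewrite !cvnormE !frob_sqr !(dotDl, dotDr, dotNl, dotNr).
  by rewrite (dotC x u) (dotC w u) (dotC x w); lra.
apply: xget_unique.
  split=> // w _; apply: le_trans (E w).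
  by rewrite lerDl mulr_ge0 ?sqr_ge0// invr_ge0.
move=> y [_ /(_ x I)] /(le_trans (E y)); rewrite gerDl => y0.
apply/eqP; rewrite -subr_eq0; apply/eqP/frob0_eq0.
rewrite leNgt; apply/negP => h; move: y0.
by rewrite leNgt mulr_gt0 ?invr_gt0// exprn_gt0.
Qed.

Lemma subgrad_mono g u x u' x' :
  (forall w, g x + dot (u - x) (w - x) <= g w) ->
  (forall w, g x' + dot (u' - x') (w - x') <= g w) ->
  frob (x - x') <= frob (u - u').
Proof.
move=> /(_ x') h /(_ x) h'; apply: le_frob_sqr.
move: h h'; rewrite !(dotDl, dotDr, dotNl, dotNr).
by rewrite (dotC x' x) ; lra.
Qed.

End Prox.

(** * Soft thresholding on the line *)

Section SoftThreshold.
Context {R : realType}.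
Implicit Types (lam t : R).

Definition soft1 lam t : R :=
  if lam < t then t - lam else if t < - lam then t + lam else 0.

Lemma soft1P lam t : 0 <= lam ->
  `|t - soft1 lam t| <= lam /\
  (t - soft1 lam t) * soft1 lam t = lam * `|soft1 lam t|.
Proof.
move=> l0; rewrite /soft1; case: ltP => h1.
  rewrite opprB addrC subrK ger0_norm// ger0_norm// subr_ge0 ltW//.
case: ltP => h2.
  rewrite opprD addrA subrr sub0r normrN ger0_norm//; split=> //.
  rewrite ler0_norm; [by rewrite mulrN mulNr|lra].
by rewrite subr0 normr0 !mulr0 ler_norml; split=> //; apply/andP.
Qed.

Lemma soft1_ge lam t : 0 <= lam -> lam <= t -> soft1 lam t = t - lam.
Proof.
move=> l0; rewrite /soft1 le_eqVlt => /orP[/eqP <-|->//].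
by rewrite ltxx subrr ifF//; apply/negbTE; rewrite -leNgt lerNl; lra.
Qed.

Lemma soft1_mid lam t : - lam <= t -> t <= lam -> soft1 lam t = 0.
Proof. by rewrite /soft1 => h1 h2; rewrite !ifF//; apply/negbTE; rewrite -leNgt. Qed.

Lemma soft1_leN lam t : 0 <= lam -> t <= - lam -> soft1 lam t = t + lam.
Proof.
move=> l0; rewrite le_eqVlt => /orP[/eqP ->|h]; first by rewrite soft1_mid ?addNr//; lra.
by rewrite /soft1 h ifF//; apply/negbTE; rewrite -leNgt; lra.
Qed.

Lemma soft1_mono lam t t' : 0 <= lam -> t <= t' -> soft1 lam t <= soft1 lam t'.
Proof.
move=> l0 tt'; have [h|h] := leP lam t; first by rewrite !soft1_ge//; lra.
have [h'|h'] := leP t' (- lam); first by rewrite !soft1_leN//; lra.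
apply: (@le_trans _ _ 0).
  have [k|k] := leP t (- lam); first by rewrite soft1_leN//; lra.
  by rewrite soft1_mid// ltW.
have [k|k] := leP lam t'; first by rewrite soft1_ge//; lra.
by rewrite soft1_mid// ltW.
Qed.

(** Near [a] the increment of [soft1] is one of [h], [0], [max(h, 0)] and [min(h, 0)], all
    positively homogeneous. The kinks lie at [lam] and [- lam] and merge into a smooth point when
    [lam = 0]. *)
Lemma soft1_homogeneous lam a : 0 <= lam -> exists2 e : R, 0 < e &
  forall h t : R, `|h| < e -> 0 <= t <= 1 ->
  soft1 lam (a + t * h) - soft1 lam a = t * (soft1 lam (a + h) - soft1 lam a).
Proof.
move=> l0.
have key (e : R) : 0 < e -> (forall h : R, `|h| < e ->
    soft1 lam (a + h) - soft1 lam a = h) \/ (forall h : R, `|h| < e ->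
    soft1 lam (a + h) - soft1 lam a = 0) \/ (forall h : R, `|h| < e ->
    soft1 lam (a + h) - soft1 lam a = Num.max h 0) \/ (forall h : R, `|h| < e ->
    soft1 lam (a + h) - soft1 lam a = Num.min h 0) ->
  forall h t : R, `|h| < e -> 0 <= t <= 1 ->
  soft1 lam (a + t * h) - soft1 lam a = t * (soft1 lam (a + h) - soft1 lam a).
  move=> e0 H h t he /andP[t0 t1].
  have the : `|t * h| < e.
    by rewrite normrM ger0_norm// (le_lt_trans _ he)// ler_piMl.
  case: H => [H|[H|[H|H]]]; rewrite !H//; first by rewrite mulr0.
    by rewrite maxr_pMr// mulr0.
  by rewrite minr_pMr// mulr0.
have [l1|l1|l1] := ltgtP lam a.
- exists (a - lam); rewrite ?subr_gt0//; apply: key; rewrite ?subr_gt0//.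
  left=> h; rewrite ltr_norml => /andP[h1 h2].
  by rewrite !soft1_ge//; lra.
- have [l2|l2|l2] := ltgtP (- lam) a.
  + have e0 : 0 < Num.min (lam - a) (a + lam) by rewrite lt_min; apply/andP; lra.
    exists (Num.min (lam - a) (a + lam)) => //; apply: key => //.
    right; left => h; rewrite lt_min !ltr_norml => /andP[/andP[h1 h2] /andP[h3 h4]].
    by rewrite !soft1_mid//; lra.
  + exists (- lam - a); rewrite ?subr_gt0//; apply: key; rewrite ?subr_gt0//.
    left=> h; rewrite ltr_norml => /andP[h1 h2].
    by rewrite !soft1_leN//; lra.
  + exists (2 * lam); first lra; apply: key; first lra.
    right; right; right => h; rewrite ltr_norml => /andP[h1 h2].
    rewrite minEle (soft1_leN l0 (t := a)) -?l2//.
    by case: (leP h 0) => hh; [rewrite soft1_leN//; lra|rewrite soft1_mid//; lra].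
- have [l2|l2] := ltP 0 lam.
  + exists (2 * lam); first lra; apply: key; first lra.
    right; right; left => h; rewrite ltr_norml => /andP[h1 h2].
    rewrite maxEle (soft1_ge l0 (t := a)) -?l1//.
    by case: (leP h 0) => hh; [rewrite soft1_mid//; lra|rewrite soft1_ge//; lra].
  + exists 1 => //; apply: key => //; left => h _.
    rewrite (soft1_ge l0 (t := a)) -?l1//.
    have [hh|hh] := leP 0 h; first by rewrite soft1_ge//; lra.
    by rewrite soft1_leN//; lra.
Qed.

End SoftThreshold.

(** * Jacobians and B-subdifferentials *)

Section Jacobian.
Context {R : realType} {n : nat}.
Implicit Types (F : 'cV[R]_n -> 'cV[R]_n) (x y h : 'cV[R]_n) (J M : 'M[R]_n).

Lemma jacobian_near F x J h (e : R) : is_jacobian F x J -> 0 < e ->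
  exists2 d : R, 0 < d & forall t : R, 0 < t < d ->
    frob (F (x + t *: h) - F x - t *: (J *m h)) <= e * t.
Proof.
move=> [dF FJ] e0; have [c c0 cP] := frob_le_norm R n 1.
have /diff_locallyP[_ /eqaddoP] := dF; set k := c * (`|h| + 1) + 1.
have k0 : 0 < k by rewrite ltr_wpDl// mulr_ge0// addr_ge0.
move=> /(_ (e / k)); rewrite divr_gt0// => /(_ isT) /nbhs_norm0P[d /= d0 dP].
exists (d / (`|h| + 1)) => [|t /andP[t0 td]]; first by rewrite divr_gt0// ltr_wpDl.
have th : `|t *: h| < d.
  rewrite normrZ gtr0_norm//; apply: le_lt_trans (_ : t * (`|h| + 1) < d).
    by rewrite ler_pM2l// lerDl.
  by rewrite -ltr_pdivlMr// ltr_wpDl.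
have := dP _ th; rewrite /= -[(_ - _) _]/(F (t *: h + x) - (F x + 'd F x (t *: h))).
rewrite linearZ /= FJ opprD addrA (addrC _ x) normrZ gtr0_norm// => H.
apply: le_trans (cP _) _; apply: le_trans (ler_wpM2l c0 H) _.
rewrite mulrA mulrA [leLHS](_ : _ = (e * t) * (c * `|h| / k)); last by ring.
rewrite ler_piMr ?mulr_ge0 ?(ltW e0) ?(ltW t0)// ler_pdivrMr// mul1r.
by rewrite /k mulrDr mulr1 -addrA lerDl addr_ge0.
Qed.

(** A one-sided ray determines [J h], so homogeneity for nonnegative factors is enough to compute
    it. *)
Lemma jacobian_dir F x J h c (d : R) : is_jacobian F x J -> 0 < d ->
  (forall t : R, 0 < t < d -> F (x + t *: h) - F x = t *: c) -> J *m h = c.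
Proof.
move=> FJ d0 Fc; apply/eqP; rewrite eq_sym -subr_eq0; apply/eqP/frob0_eq0.
apply/ler_addgt0Pl => e e0; rewrite addr0.
have [d' d'0 /(_ (Num.min d d' / 2))] := jacobian_near h FJ e0.
set t := _ / 2; have m0 : 0 < Num.min d d' by rewrite lt_min d0.
have t0 : 0 < t by rewrite divr_gt0.
have : t < Num.min d d' by rewrite ltr_pdivrMr// mulr_natr mulr2n ltrDl.
rewrite lt_min => /andP[td td']; rewrite t0 td' => /(_ isT).
rewrite Fc ?t0// -scalerBr frobZ gtr0_norm// mulrC.
by rewrite ler_pM2r.
Qed.

Lemma jacobian_lip F x J h : is_jacobian F x J ->
  (forall y y', frob (F y - F y') <= frob (y - y')) ->
  frob (J *m h) <= frob h.
Proof.
move=> FJ Fl; apply/ler_addgt0Pl => e e0.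
have [d d0 /(_ (d / 2))] := jacobian_near h FJ e0.
set t := d / 2; have t0 : 0 < t by rewrite divr_gt0.
have td : t < d by rewrite ltr_pdivrMr// mulr_natr mulr2n ltrDl.
rewrite t0 td => /(_ isT) H; rewrite -(ler_pM2l t0).
have := ler_frobD (F (x + t *: h) - F x) (- (F (x + t *: h) - F x - t *: (J *m h))).
rewrite frobN opprB addrC subrK frobZ gtr0_norm// => /le_trans; apply.
rewrite mulrDr addrC [t * e]mulrC lerD//; apply: le_trans (Fl _ _) _.
by rewrite addrC addKr frobZ gtr0_norm.
Qed.

(** One term of the defining sequences is enough below: identities proved at points of
    differentiability pass to [M] up to an arbitrary error. *)
Lemma Bsubdiff_approx F x M (e : R) : Bsubdiff F x M -> 0 < e ->
  exists u J, [/\ is_jacobian F u J, frob (x - u) < e & frob (J - M) < e].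
Proof.
move=> [u [J [ux FJ JM]]] e0.
have [c c0 cP] := frob_le_norm R n 1; have [c' c'0 cP'] := frob_le_norm R n n.
pose d := e / (Num.max c c' + 1).
have k0 : 0 < Num.max c c' + 1 by rewrite ltr_wpDl// le_max c0.
have d0 : 0 < d by rewrite divr_gt0.
have : \forall i \near \oo, `|x - u i| < d /\ `|M - J i| < d.
  by near=> i; split; near: i; [move/cvgrPdist_lt : ux|move/cvgrPdist_lt : JM]; exact.
case=> N _ /(_ N (leqnn N)) [xu MJ]; exists (u N), (J N); split=> //.
  apply: le_lt_trans (cP _) _.
  apply: le_lt_trans (_ : (Num.max c c' + 1) * `|x - u N| < e).
    by rewrite ler_wpM2r// (le_trans (_ : _ <= Num.max c c')) ?le_max ?lexx// lerDl.
  by rewrite mulrC -ltr_pdivlMr.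
apply: le_lt_trans (cP' _) _.
apply: le_lt_trans (_ : (Num.max c c' + 1) * `|M - J N| < e).
  rewrite distrC ler_wpM2r// (le_trans (_ : _ <= Num.max c c')) ?lerDl//.
  by rewrite le_max lexx orbT.
by rewrite mulrC -ltr_pdivlMr.
Unshelve. all: by end_near. Qed.

End Jacobian.

Lemma ex_eps_forall (R : realType) (I : finType) (P : I -> R -> Prop) :
  (forall i, exists2 e : R, 0 < e & P i e) ->
  (forall i e e', e' <= e -> P i e -> P i e') ->
  exists2 e : R, 0 < e & forall i, P i e.
Proof.
move=> Pe Pd.
have /boolp.choice[f fP] i : exists e, 0 < e /\ P i e.
  by have [e e0 Pie] := Pe i; exists e.
exists (\big[Num.min/1]_i f i) => [|i].
  by apply: lt_bigmin => // i _; have [] := fP i.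
by apply: Pd (proj2 (fP i)); exact: bigmin_le_cond.
Qed.

Section SoftVector.
Context {R : realType} {n : nat}.
Variables (lam : R) (lam0 : 0 <= lam).
Implicit Types (x y w h : 'cV[R]_n) (M : 'M[R]_n).

Definition softv x : 'cV[R]_n := \col_i soft1 lam (x i 0).

Lemma softv_subgrad x w :
  lam * cvnorm1 (softv x) + dot (x - softv x) (w - softv x) <= lam * cvnorm1 w.
Proof.
rewrite /cvnorm1 dotE !mulr_sumr -big_split; apply: ler_sum => i _.
rewrite !mxE; have [h1 h2] := soft1P (x i 0) lam0.
rewrite /= mulrBr h2 addrC subrK.
by apply: le_trans (ler_norm _) _; rewrite normrM ler_wpM2r.
Qed.

Lemma prox_softv : prox_cv (fun x => lam * cvnorm1 x) = softv.
Proof. by apply/funext => x; apply: prox_cvP => w; exact: softv_subgrad. Qed.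

Lemma softv_lip x x' : frob (softv x - softv x') <= frob (x - x').
Proof.
exact: (subgrad_mono (g := fun w => lam * cvnorm1 w)
  (softv_subgrad x) (softv_subgrad x')).
Qed.

Lemma softv_homogeneous x : exists2 e : R, 0 < e &
  forall h (t : R), frob h < e -> 0 <= t <= 1 ->
  softv (x + t *: h) - softv x = t *: (softv (x + h) - softv x).
Proof.
have [i|i e e' ee' H h t he|e e0 H] := @ex_eps_forall R 'I_n (fun i e =>
  forall h t : R, `|h| < e -> 0 <= t <= 1 ->
  soft1 lam (x i 0 + t * h) - soft1 lam (x i 0) =
    t * (soft1 lam (x i 0 + h) - soft1 lam (x i 0))).
- exact: soft1_homogeneous.
- by apply: H; exact: lt_le_trans he ee'.
exists e => // h t he t01; apply/colP => i; rewrite !mxE H//.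
exact: le_lt_trans (coord_le_frob h i) he.
Qed.

Lemma Bsubdiff_softv_bound x M h : Bsubdiff softv x M ->
  frob (M *m h) <= frob h.
Proof.
move=> BM; apply/ler_addgt0Pl => e e0.
have d0 : 0 < e / (frob h + 1) by rewrite divr_gt0// ltr_wpDl// frob_ge0.
have [u [J [FJ _ JM]]] := Bsubdiff_approx BM d0.
have -> : M *m h = J *m h + - ((J - M) *m h) by rewrite mulmxBl opprB addrC subrK.
apply: le_trans (ler_frobD _ _) _; rewrite addrC lerD//; last first.
  exact: jacobian_lip FJ softv_lip.
rewrite frobN (le_trans (frobM _ _))//.
apply: (@le_trans _ _ (frob (J - M) * (frob h + 1))).
  by rewrite ler_wpM2l ?frob_ge0// lerDl.
by rewrite -ler_pdivlMr ?ltW// ltr_wpDl// frob_ge0.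
Qed.

(** Euler's relation: homogeneity around [x0] makes the increment along the ray from [x0] through
    [u] linear beyond [u], so a Jacobian [J] at [u] satisfies [J (u - x0) = softv u - softv x0].
    This passes to limits since [softv] and its Jacobians are nonexpansive. *)
Lemma Bsubdiff_softv_local x0 : exists2 e : R, 0 < e &
  forall x M, frob (x - x0) < e -> Bsubdiff softv x M ->
  softv x - softv x0 = M *m (x - x0).
Proof.
have [e e0 H] := softv_homogeneous x0.
have Jdir u J : is_jacobian softv u J -> frob (u - x0) < e / 2 ->
    J *m (u - x0) = softv u - softv x0.
  move=> FJ uh; apply: (jacobian_dir FJ ltr01) => t /andP[t0 t1].
  set h := u - x0 in uh *; have -> : u = x0 + h by rewrite /h addrC subrK.
  have t'0 : 0 < 1 + t by rewrite addr_gt0.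
  have hh : frob ((1 + t) *: h) < e.
    rewrite frobZ gtr0_norm// (@le_lt_trans _ _ (2 * frob h))//.
      by rewrite ler_wpM2r ?frob_ge0//; lra.
    by rewrite mulrC -ltr_pdivlMr.
  (* Homogeneity holds only for factors at most 1, so it is applied to the longer vector [(1 + t) h]
     with factor [(1 + t)^-1]. This is why [u] has to stay within [e / 2]. *)
  have e1 : softv (x0 + h) - softv x0
      = (1 + t)^-1 *: (softv (x0 + (1 + t) *: h) - softv x0).
    have := H _ (1 + t)^-1 hh.
    rewrite scalerA mulVf ?gt_eqF// scale1r => -> //.
    by rewrite invr_ge0 ltW//= invf_le1// lerDl ltW.
  clearbody h; have -> : x0 + h + t *: h = x0 + (1 + t) *: h.
    by rewrite scalerDl scale1r addrA.
  set a := softv (x0 + _ *: _) in e1 *; set b := softv (x0 + h) in e1 *.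
  have aE : a - softv x0 = (1 + t) *: (b - softv x0).
    by rewrite e1 scalerA mulfV ?gt_eqF// scale1r.
  have -> : a - b = (a - softv x0) - (b - softv x0) by rewrite opprB addrA subrK.
  by rewrite aE scalerDl scale1r addrAC subrr add0r.
exists (e / 4) => [|x M xe BM]; first by rewrite divr_gt0.
apply/eqP; rewrite -subr_eq0; apply/eqP/frob0_eq0.
apply/ler_addgt0Pl => eps eps0; rewrite addr0.
(* The first bound keeps [u] within [e / 2] of [x0]. The second serves the final error
   [2 |x - u| + |J - M| |x - x0|]. *)
pose d := Num.min (e / 4) (eps / (2 + frob (x - x0))).
have k0 : 0 < 2 + frob (x - x0) by rewrite ltr_pwDl// frob_ge0.
have d0 : 0 < d by rewrite lt_min !divr_gt0.
have [u [J [FJ]]] := Bsubdiff_approx BM d0.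
rewrite lt_min => /andP[xu1 xu2]; rewrite lt_min => /andP[_ JM].
have ux : frob (u - x0) < e / 2.
  have -> : u - x0 = (x - x0) + (u - x) by rewrite [RHS]addrC addrA subrK.
  apply: le_lt_trans (ler_frobD _ _) _; rewrite (frob_distC u).
  by lra.
have -> : softv x - softv x0 - M *m (x - x0) =
    (softv x - softv u) + J *m (u - x) + (J - M) *m (x - x0).
  have -> : softv u = softv x0 + J *m (u - x0) by rewrite (Jdir u J)// addrC subrK.
  rewrite mulmxBl !mulmxBr; apply/matrixP => i j; rewrite !mxE.
  by ring.
apply: le_trans (ler_frobD _ _) _.
apply: le_trans (lerD (ler_frobD _ _) (frobM _ _)) _.
have h1 := softv_lip x u; have h2 := jacobian_lip (u - x) FJ softv_lip.
rewrite (frob_distC u) in h2.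
have h3 : frob (J - M) * frob (x - x0)
    <= eps / (2 + frob (x - x0)) * frob (x - x0).
  by rewrite ler_wpM2r ?frob_ge0// ltW.
set k := eps / _ in xu2 JM h3.
have -> : eps = k * (2 + frob (x - x0)) by rewrite divfK// gt_eqF.
by lra.
Qed.

End SoftVector.

(** * Pseudoinverses of symmetric matrices *)

Section SymmetricPinv.
Context {R : realType} {n : nat}.
Variables (A G : 'M[R]_n).
Hypotheses (A_sym : A^T = A) (pG : is_pinv A G).

Lemma pinv_range : G = A *m (G^T *m G) /\ G = G *m G^T *m A.
Proof.
have [h1 h2 h3 h4] := pG; split.
  by rewrite -{1}h2 -{1}h4 trmx_mul A_sym !mulmxA.
by rewrite -{1}h2 -mulmxA -{1}h3 trmx_mul A_sym mulmxA.
Qed.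

(** The transpose of [G] also satisfies the Penrose equations for the symmetric [A]; what follows is
    the usual uniqueness argument applied to [G] and its transpose. *)
Lemma pinv_sym : G^T = G.
Proof.
have [h1 h2 h3 h4] := pG.
have h1' : A *m G^T *m A = A.
  by rewrite -[RHS]A_sym -[in RHS]h1 !trmx_mul A_sym mulmxA.
have e3 : (A *m G^T)^T = A *m G^T by rewrite trmx_mul trmxK A_sym -h4 trmx_mul A_sym.
have e4 : (G^T *m A)^T = G^T *m A by rewrite trmx_mul trmxK A_sym -h3 trmx_mul A_sym.
have h3' : A *m G = A *m G^T.
  transitivity ((A *m G^T *m (A *m G))^T); first by rewrite mulmxA h1' h3.
  by rewrite trmx_mul h3 e3 mulmxA h1.
have h4' : G *m A = G^T *m A.
  transitivity ((G *m A *m (G^T *m A))^T).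
    by rewrite -(mulmxA G) (mulmxA A) h1' h4.
  by rewrite trmx_mul h4 e4 -(mulmxA G^T) (mulmxA A) h1.
have h2' : G^T *m A *m G^T = G^T.
  by rewrite -[in RHS]h2 !trmx_mul A_sym mulmxA.
by rewrite -h2' -h4' -mulmxA -h3' mulmxA h2.
Qed.

End SymmetricPinv.

(** * The proximal map of total variation and its dual *)

Section TotalVariation.
Context {R : realType} {L : nat}.
Variables (lam : R) (lam0 : 0 <= lam).
Implicit Types x v w : 'cV[R]_L.
Local Notation B := (@Bmx R L).

(** The two scalar conditions say that [z i 0] is a subgradient of [lam |.|] at [(B x)_i], so
    [B^T z] is a subgradient of the penalty at [x]. *)
Definition tv_kkt v x (z : 'cV[R]_L.-1) : Prop :=
  x = v - B^T *m z /\
  forall i, `|z i 0| <= lam /\ z i 0 * (B *m x) i 0 = lam * `|(B *m x) i 0|.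

Lemma tv_kkt_subgrad v x z w : tv_kkt v x z ->
  lam * cvnorm1 (B *m x) + dot (v - x) (w - x) <= lam * cvnorm1 (B *m w).
Proof.
case=> xE K; have -> : v - x = B^T *m z by rewrite xE opprB addrC subrK.
rewrite dot_mul trmxK mulmxBr /cvnorm1 dotE !mulr_sumr -big_split.
apply: ler_sum => i _; have [h1 h2] := K i.
rewrite [X in z i 0 * X]mxE [X in z i 0 * (_ + X)]mxE /= mulrBr h2 addrC subrK.
by apply: le_trans (ler_norm _) _; rewrite normrM ler_wpM2r.
Qed.

Lemma tv_kkt_x v x z : tv_kkt v x z -> x_tv lam v = x.
Proof. by move=> K; apply: prox_cvP => w; exact: tv_kkt_subgrad K. Qed.

Definition tvq (u z : 'cV[R]_L.-1) : R :=
  2^-1 * dot (B^T *m z) (B^T *m z) - dot z u.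

(** A continuous function attains its minimum on the compact box, so the choice in [z_tv] is a true
    minimiser. The transposes move the problem to row vectors, where [rV_compact] and [EVT_min_rV]
    apply. *)
Lemma z_tvP (u : 'cV[R]_L.-1) :
  (forall i, `|z_tv lam u i 0| <= lam) /\
  forall z : 'cV[R]_L.-1, (forall i, `|z i 0| <= lam) -> tvq u (z_tv lam u) <= tvq u z.
Proof.
have qE : (fun z => 2^-1 * cvnorm (B^T *m z) ^+ 2 - (z^T *m u) 0 0) = tvq u.
  by apply/funext => z; rewrite cvnormE frob_sqr -trace_mx11.
rewrite /z_tv qE.
pose A := [set z : 'rV[R]_L.-1 | forall i, `[- lam, lam]%classic (z ord0 i)].
have AP (z : 'rV[R]_L.-1) : A z <-> forall i, `|z^T i 0| <= lam.
  by split=> zA i; have := zA i; rewrite mxE /= in_itv/= ler_norml.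
have cA : compact A := rV_compact (fun i => @segment_compact R (- lam) lam).
have A0 : A !=set0 by exists 0; apply/AP => i; rewrite !mxE normr0.
have csum n (F : 'I_n -> 'rV[R]_L.-1 -> R) :
    (forall i, continuous (F i)) -> continuous (fun z => \sum_i F i z).
  move=> cF; apply: (@continuous_big R^o _ +%R 0 xpredT) => [|i _]; last exact: cF.
  exact: add_continuous.
have cmul (f g : 'rV[R]_L.-1 -> R) :
    continuous f -> continuous g -> continuous (fun z => f z * g z).
  by move=> cf cg z; exact: (cvgM (cf z) (cg z)).
have cst (a : R) : continuous (fun _ : 'rV[R]_L.-1 => a) by exact: cst_continuous.
have cc i : continuous (fun z : 'rV[R]_L.-1 => z^T i 0).
  rewrite (_ : (fun _ => _) = (fun z : 'rV[R]_L.-1 => z 0 i)).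
    exact: coord_continuous.
  by apply/funext => z; rewrite mxE.
have cq : continuous (fun z : 'rV[R]_L.-1 => tvq u z^T).
  have cB j : continuous (fun z : 'rV[R]_L.-1 => (B^T *m z^T) j 0).
    rewrite (_ : (fun _ => _) = (fun z : 'rV[R]_L.-1 => \sum_k B^T j k * z^T k 0)).
      apply: (csum _ (fun k (z : 'rV[R]_L.-1) => B^T j k * z^T k 0)) => k.
      exact: (cmul (fun=> B^T j k) (fun z => z^T k 0)).
    by apply/funext => z; rewrite mxE.
  have c1 : continuous (fun z : 'rV[R]_L.-1 =>
      \sum_j (B^T *m z^T) j 0 * (B^T *m z^T) j 0).
    apply: (csum _ (fun j (z : 'rV[R]_L.-1) => (B^T *m z^T) j 0 * (B^T *m z^T) j 0)).
    by move=> j; apply: (cmul (fun z => (B^T *m z^T) j 0) (fun z => (B^T *m z^T) j 0)).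
  have c2 : continuous (fun z : 'rV[R]_L.-1 => \sum_j z^T j 0 * u j 0).
    apply: (csum _ (fun j (z : 'rV[R]_L.-1) => z^T j 0 * u j 0)) => j.
    exact: (cmul (fun z => z^T j 0) (fun=> u j 0)).
  rewrite (_ : (fun _ => _) = (fun z : 'rV[R]_L.-1 => 2^-1 *
    (\sum_j (B^T *m z^T) j 0 * (B^T *m z^T) j 0) - \sum_j z^T j 0 * u j 0)).
    by move=> z; exact: (cvgB (cmul _ _ (cst 2^-1) c1 z) (c2 z)).
  by apply/funext => z; rewrite /tvq !dotE.
have [z zA zmin] := EVT_min_rV A0 cA (continuous_subspaceT cq).
rewrite /argmin; set E := [set _ | _].
have /(xgetPex point) : exists z, E z.
  exists z^T; split=> [|y yA]; first by apply/AP; rewrite inE in zA.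
  by rewrite -[y]trmxK; apply: zmin; rewrite inE; apply/AP; rewrite trmxK.
by [].
Qed.

(** Only complementarity needs the optimality of [z]. Moving the single coordinate [i] a fraction
    [t] of the way to [lam sg(g)] stays in the box and changes the dual objective by
    [t^2 c - t s g]. Minimality thus gives [s g <= t c] for all small [t], so [s g <= 0], and [s g]
    is exactly the complementarity gap. *)
Lemma z_tv_kkt v : tv_kkt v (v - B^T *m z_tv lam (B *m v)) (z_tv lam (B *m v)).
Proof.
split=> // i; have [zl zmin] := z_tvP (B *m v).
set z := z_tv _ _ in zl zmin *; split=> //.
set x := v - _; have gE : (B *m x) i 0 = dot (B *m x) (delta_mx i 0).
  by rewrite dotE (bigD1 i)//= big1 => [|j ji]; rewrite !mxE ?eqxx ?mulr1 ?addr0 ?(negbTE ji) ?mulr0.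
set g := (B *m x) i 0 in gE *.
have [->|gn0] := eqVneq g 0; first by rewrite normr0 !mulr0.
apply/le_anti/andP; split.
  by apply: le_trans (ler_norm _) _; rewrite normrM ler_wpM2r.
pose s := lam * Num.sg g - z i 0.
pose d : 'cV[R]_L.-1 := delta_mx i 0.
pose c := 2^-1 * s ^+ 2 * dot (B^T *m d) (B^T *m d).
have c0 : 0 <= c by rewrite mulr_ge0 ?dot_ge0// mulr_ge0 ?sqr_ge0// invr_ge0.
have key t : 0 < t <= 1 -> s * g <= t * c.
  move=> /andP[t0 t1].
  have := zmin (z + (t * s) *: d); rewrite /tvq.
  rewrite linearD /= -scalemxAr !(dotDl, dotDr, dotZl, dotZr).
  have -> : dot (B^T *m d) (B^T *m z) = dot (B^T *m z) (B^T *m d) by exact: dotC.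
  have zd : dot (B^T *m z) (B^T *m d) - dot d (B *m v) = - g.
    have -> : dot d (B *m v) = dot v (B^T *m d) by rewrite dotC dot_mul.
    by rewrite gE [dot (B *m x) _]dot_mul -/d /x dotDl dotNl; ring.
  have zbox j : `|(z + (t * s) *: d) j 0| <= lam.
    rewrite !mxE; case: eqVneq => [->|_]; last by rewrite mulr0 addr0.
    rewrite mulr1 /s; have /ler_normlP[z1 z2] := zl i.
    have : `|Num.sg g| <= 1 by rewrite normr_sg; case: (g != 0).
    move=> /ler_normlP[g1 g2]; rewrite ler_norml.
    have := ler_wpM2l lam0 g1; have := ler_wpM2l lam0 g2.
    rewrite mulrN mulr1; move: (lam * Num.sg g) => y y1 y2.
    have t1' : 0 <= 1 - t by rewrite subr_ge0.
    have := ler_wpM2l (ltW t0) y1; have := ler_wpM2l (ltW t0) y2.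
    have := ler_wpM2l t1' z1; have := ler_wpM2l t1' z2.
    by move=> *; apply/andP; split; lra.
  move=> /(_ zbox) H; rewrite -(ler_pM2l t0) /c.
  move: zd H; set p := dot _ (_ *m d); set q := dot d _; set r := dot (B^T *m d) _.
  by move=> zd H; nra.
have sg : s * g = lam * `|g| - z i 0 * g by rewrite mulrBl -mulrA -normrEsg.
rewrite -subr_le0 -sg; apply/ler_addgt0Pl => e e0; rewrite addr0.
have t0 : 0 < Num.min 1 (e / (c + 1)) by rewrite lt_min ltr01 divr_gt0// ltr_wpDl.
apply: le_trans (key (Num.min 1 (e / (c + 1))) _) _.
  by rewrite t0 ge_min lexx.
apply: (@le_trans _ _ (e / (c + 1) * c)); first by rewrite ler_wpM2r// ge_min lexx orbT.
by rewrite mulrAC ler_pdivrMr ?ltr_wpDl// ler_wpM2l ?(ltW e0)// lerDl.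
Qed.

Lemma x_tvE v : x_tv lam v = v - B^T *m z_tv lam (B *m v).
Proof. exact: tv_kkt_x (z_tv_kkt v). Qed.

Lemma x_tv_lip v v' : frob (x_tv lam v - x_tv lam v') <= frob (v - v').
Proof.
apply: (subgrad_mono (g := fun w => lam * cvnorm1 (B *m w))) => w;
  rewrite x_tvE; exact: tv_kkt_subgrad (z_tv_kkt _).
Qed.

(** Partial summation inverts differencing. Injectivity of [B^T] makes the multiplier a Lipschitz
    function of the datum. *)
Lemma Bmx_tr_linv : exists C : 'M[R]_(L.-1, L), C *m B^T = 1%:M.
Proof.
exists (\matrix_(i, k) (k <= i)%:R); apply/matrixP => i j.
have jL : (j < L)%N by apply: leq_trans (ltn_ord j) (leq_pred _).
have jL1 : (j.+1 < L)%N by rewrite -ltn_predRL.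
rewrite !mxE.
under eq_bigr do rewrite !mxE mulrBr.
rewrite sumrB (bigD1 (Ordinal jL))//= eqxx mulr1 big1 ?addr0; last first.
  by move=> k; rewrite -val_eqE /= => /negbTE ->; rewrite mulr0.
rewrite (bigD1 (Ordinal jL1))//= eqxx mulr1 big1 ?addr0; last first.
  by move=> k; rewrite -val_eqE /= => /negbTE ->; rewrite mulr0.
rewrite -val_eqE /=; case: (ltngtP i j) => // h; rewrite ?subrr ?subr0//.
Qed.

Lemma z_tv_lip : exists2 c : R, 0 <= c & forall v v' i,
  `|z_tv lam (B *m v) i 0 - z_tv lam (B *m v') i 0| <= c * frob (v - v') /\
  `|(B *m x_tv lam v) i 0 - (B *m x_tv lam v') i 0| <= c * frob (v - v').
Proof.
have [C CB] := Bmx_tr_linv.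
exists (2 * frob C + frob B) => [|v v' i].
  by rewrite addr_ge0 ?mulr_ge0 ?frob_ge0.
have xl := x_tv_lip v v'; split.
- set z := z_tv _ _; set z' := z_tv _ (_ *m v').
  have -> : z i 0 - z' i 0 = (C *m (B^T *m (z - z'))) i 0.
    by rewrite mulmxA CB mul1mx !mxE.
  apply: le_trans (coord_le_frob _ _) _; apply: le_trans (frobM _ _) _.
  have -> : B^T *m (z - z') = (v - v') - (x_tv lam v - x_tv lam v').
    rewrite !x_tvE -/z -/z' mulmxBr; apply/matrixP => k l; rewrite !mxE.
    by ring.
  rewrite mulrDl -[leLHS]addr0 lerD ?mulr_ge0 ?frob_ge0//.
  rewrite [2 * _]mulrC -mulrA ler_wpM2l ?frob_ge0//.
  apply: le_trans (ler_frobD _ _) _; rewrite frobN; lra.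
- have -> : (B *m x_tv lam v) i 0 - (B *m x_tv lam v') i 0
      = (B *m (x_tv lam v - x_tv lam v')) i 0 by rewrite mulmxBr !mxE.
  apply: le_trans (coord_le_frob _ _) _; apply: le_trans (frobM _ _) _.
  rewrite mulrDl -[leLHS]add0r lerD ?mulr_ge0 ?mulr_ge0 ?frob_ge0//.
  by rewrite ler_wpM2l ?frob_ge0.
Qed.

(** The pairs [(z, g)] form the graph of the subdifferential of [lam |.|], a vertical segment with
    two horizontal rays. A pair close to [(z0, g0)] lies on a common piece with it, which gives all
    five conclusions. *)
Lemma complementarity_near (z0 g0 : R) :
  `|z0| <= lam -> z0 * g0 = lam * `|g0| -> exists2 e : R, 0 < e &
  forall z g : R, `|z| <= lam -> z * g = lam * `|g| ->
    `|z - z0| < e -> `|g - g0| < e ->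
  [/\ z * g0 = lam * `|g0|, z0 * g = lam * `|g|, `|z| = lam -> z0 = z,
      g = 0 -> g0 = 0 & 0 <= g0 * g].
Proof.
move=> z0l zg0.
have absP (z g : R) : `|z| <= lam -> z * g = lam * `|g| ->
    (0 < g -> z = lam) /\ (g < 0 -> z = - lam).
  move=> _ zg; split=> g'.
    by apply: (mulIf (lt0r_neq0 g')); rewrite zg gtr0_norm.
  by apply: (mulIf (ltr0_neq0 g')); rewrite zg ltr0_norm// mulrN mulNr.
have [ap an] := absP _ _ z0l zg0.
have [g0p|g0n|g00] := ltgtP 0 g0.
- exists g0 => // z g zl zg _; rewrite ltr_distl => /andP[h1 h2].
  have gp : 0 < g by lra.
  have [-> // _] := absP _ _ zl zg.
  rewrite ap// (gtr0_norm g0p) (gtr0_norm gp); split=> //; last by rewrite mulr_ge0// ltW.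
  by move=> gE; rewrite gE ltxx in gp.
- exists (- g0) => [|z g zl zg _]; first by rewrite oppr_gt0.
  rewrite ltr_distl => /andP[h1 h2].
  have gn : g < 0 by lra.
  have [_ -> //] := absP _ _ zl zg.
  rewrite an// (ltr0_norm g0n) (ltr0_norm gn) mulNr mulrN mulNr mulrN; split=> //.
    by move=> gE; rewrite gE ltxx in gn.
  by rewrite nmulr_rge0// ltW.
(* For [lam = 0] the segment shrinks to a point and all multipliers vanish. *)
- rewrite -g00 normr0 !mulr0; have [l0|l0] := ltP 0 lam; last first.
    have l00 : lam = 0 by apply/le_anti; rewrite l0 lam0.
    exists 1 => // z g zl zg _ _; move: zl z0l; rewrite l00 !normr_le0.
    by move=> /eqP -> /eqP ->; rewrite mulr0 !mul0r.
  have [zi|ze] := ltP `|z0| lam.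
    exists (lam - `|z0|) => [|z g zl zg zz _]; first by rewrite subr_gt0.
    have {zz} zz : `|z| < lam.
      have := ler_normD (z - z0) z0; rewrite subrK; lra.
    have g0' : g = 0.
      apply/eqP; apply: contraTT zz => g0'; rewrite -leNgt.
      rewrite -(ler_pM2r (_ : 0 < `|g|)) ?normr_gt0// -zg -normrM.
      exact: ler_norm.
    rewrite g0' normr0 !mulr0; split=> // zE.
    by rewrite zE ltxx in zz.
  (* At a corner the opposite bound is at distance [2 lam], so radius [lam] excludes it. *)
  exists lam => // z g zl zg zz _.
  have z0E : `|z0| = lam by apply/le_anti; rewrite z0l ze.
  have same : `|z| = lam -> z0 = z.
    move=> zE; move: zz; rewrite ltr_distl => /andP[h1 h2].
    by move: zE z0E; case: (ger0P z) => ?; case: (ger0P z0) => ?; lra.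
  rewrite !mul0r !mulr0; split=> //; have [->|gN] := eqVneq g 0.
    by rewrite normr0 !mulr0.
  rewrite same// ; apply/le_anti; rewrite zl /=.
  by rewrite -(ler_pM2r (_ : 0 < `|g|)) ?normr_gt0// -zg -normrM ler_norm.
Qed.

(** Expanding the product leaves four terms, two of them mixed. Cross complementarity evaluates the
    mixed ones, and agreement of signs makes the absolute value additive. *)
Lemma complementarity_segment (z0 g0 z g t : R) : 0 <= t -> t <= 1 ->
  `|z0| <= lam -> `|z| <= lam -> z0 * g0 = lam * `|g0| -> z * g = lam * `|g| ->
  z * g0 = lam * `|g0| -> z0 * g = lam * `|g| -> 0 <= g0 * g ->
  `|z0 + t * (z - z0)| <= lam /\
  (z0 + t * (z - z0)) * (g0 + t * (g - g0)) = lam * `|g0 + t * (g - g0)|.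
Proof.
move=> t0 t1 z0l zl e1 e2 e3 e4 gg; have t1' : 0 <= 1 - t by rewrite subr_ge0.
have E (a b : R) : a + t * (b - a) = (1 - t) * a + t * b by ring.
rewrite !E; split.
  apply: le_trans (ler_normD _ _) _; rewrite !normrM (ger0_norm t0) (ger0_norm t1').
  by have := ler_wpM2l t0 zl; have := ler_wpM2l t1' z0l; lra.
have -> : `|(1 - t) * g0 + t * g| = (1 - t) * `|g0| + t * `|g|.
  have [h0|h0] := leP 0 g0; have [h|h] := leP 0 g.
  - by rewrite !ger0_norm// addr_ge0// mulr_ge0.
  - have -> : g0 = 0 by apply/le_anti; rewrite h0 andbT -(nmulr_lge0 _ h).
    by rewrite normr0 !mulr0 !add0r normrM ger0_norm.
  - have -> : g = 0 by apply/le_anti; rewrite h andbT -(nmulr_rge0 _ h0).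
    by rewrite normr0 !mulr0 !addr0 normrM ger0_norm.
  - rewrite (ltr0_norm h0) (ltr0_norm h) ler0_norm; last first.
      by rewrite -oppr_ge0 opprD addr_ge0// -mulrN mulr_ge0// oppr_ge0 ltW.
    by rewrite !mulrN opprD.
have -> : ((1 - t) * z0 + t * z) * ((1 - t) * g0 + t * g) =
  (1 - t) ^+ 2 * (z0 * g0) + (1 - t) * t * (z0 * g) + t * (1 - t) * (z * g0)
  + t ^+ 2 * (z * g) by ring.
by rewrite e1 e2 e3 e4; ring.
Qed.

Lemma tv_near v0 : exists2 e : R, 0 < e & forall v, frob (v - v0) < e ->
  let z := z_tv lam (B *m v) in let z0 := z_tv lam (B *m v0) in
  let g := B *m x_tv lam v in let g0 := B *m x_tv lam v0 in
  forall i, [/\ z i 0 * g0 i 0 = lam * `|g0 i 0|,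
    z0 i 0 * g i 0 = lam * `|g i 0|, `|z i 0| = lam -> z0 i 0 = z i 0,
    g i 0 = 0 -> g0 i 0 = 0 & 0 <= g0 i 0 * g i 0].
Proof.
have [c c0 cP] := z_tv_lip.
have kkt v i : `|z_tv lam (B *m v) i 0| <= lam /\
    z_tv lam (B *m v) i 0 * (B *m x_tv lam v) i 0 = lam * `|(B *m x_tv lam v) i 0|.
  by rewrite x_tvE; have [_] := z_tv_kkt v; apply.
have [i|i e e' ee' H v he|e e0 H] := @ex_eps_forall R 'I_L.-1 (fun i e =>
  forall v, (c + 1) * frob (v - v0) < e ->
  let z := z_tv lam (B *m v) in let z0 := z_tv lam (B *m v0) in
  let g := B *m x_tv lam v in let g0 := B *m x_tv lam v0 in
  [/\ z i 0 * g0 i 0 = lam * `|g0 i 0|,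
    z0 i 0 * g i 0 = lam * `|g i 0|, `|z i 0| = lam -> z0 i 0 = z i 0,
    g i 0 = 0 -> g0 i 0 = 0 & 0 <= g0 i 0 * g i 0]).
- have [zl zg] := kkt v0 i; have [e e0 H] := complementarity_near zl zg.
  exists e => // v ve; have [zl' zg'] := kkt v i; have [h1 h2] := cP v v0 i.
  have cl : c * frob (v - v0) <= (c + 1) * frob (v - v0).
    by rewrite ler_wpM2r ?frob_ge0// lerDl.
  by apply: H => //; [apply: le_lt_trans h1 _|apply: le_lt_trans h2 _];
    apply: le_lt_trans cl ve.
- by apply: H; exact: lt_le_trans he ee'.
have c1 : 0 < c + 1 by rewrite ltr_wpDl.
exists (e / (c + 1)) => [|v]; first by rewrite divr_gt0.
by rewrite ltr_pdivlMr// mulrC => ve z z0 g g0 i; exact: H.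
Qed.

(** The KKT pairs at [v0] and [v0 + h] lie on common pieces, so their convex combinations are KKT
    pairs for the intermediate data. *)
Lemma x_tv_homogeneous v0 : exists2 e : R, 0 < e &
  forall h (t : R), frob h < e -> 0 <= t <= 1 ->
  x_tv lam (v0 + t *: h) - x_tv lam v0 = t *: (x_tv lam (v0 + h) - x_tv lam v0).
Proof.
have [e e0 H] := tv_near v0; exists e => // h t he /andP[t0 t1].
have := H (v0 + h); rewrite {1}[v0 + h]addrC addrK => /(_ he).
set v := v0 + h; move=> /= N.
pose z := z_tv lam (B *m v); pose z0 := z_tv lam (B *m v0).
suff K : tv_kkt (v0 + t *: h) (x_tv lam v0 + t *: (x_tv lam v - x_tv lam v0))
    (z0 + t *: (z - z0)) by rewrite (tv_kkt_x K) addrC addKr.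
split.
  rewrite !x_tvE -/z -/z0 /v mulmxDr -scalemxAr mulmxBr.
  by apply/matrixP => k l; rewrite !mxE; ring.
move=> i; have [n1 n2 _ _ n3] := N i.
have [_ /(_ i)] := z_tv_kkt v; rewrite -x_tvE -/z => -[l1 k1].
have [_ /(_ i)] := z_tv_kkt v0; rewrite -x_tvE -/z0 => -[l2 k2].
rewrite -/z -/z0 in n1 n2; rewrite mulmxDr -scalemxAr mulmxBr.
have [] := complementarity_segment t0 t1 l2 l1 k2 k1 n1 n2 n3.
have E n (P Q : 'cV[R]_n) k : (P + t *: (Q - P)) k 0 = P k 0 + t * (Q k 0 - P k 0).
  by rewrite !mxE.
by rewrite !E.
Qed.

Local Notation Sgm := (@Sigma_mx R L).

Lemma Sigma_mx_sym (K : {set 'I_L.-1}) : (Sgm K)^T = Sgm K.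
Proof. exact: tr_diag_mx. Qed.

Lemma Sigma_mx_idem (K : {set 'I_L.-1}) : Sgm K *m Sgm K = Sgm K.
Proof.
rewrite mulmx_diag; congr diag_mx; apply/rowP => i; rewrite !mxE.
by case: (i \in K); rewrite ?mulr0 ?mulr1.
Qed.

Lemma Sigma_mxE (K : {set 'I_L.-1}) (z : 'cV[R]_L.-1) i :
  (Sgm K *m z) i 0 = if i \in K then 0 else z i 0.
Proof. by rewrite mul_diag_mx !mxE; case: (i \in K); rewrite ?mul0r ?mul1r. Qed.

Section Pinv.
Variables (K : {set 'I_L.-1}) (G : 'M[R]_L.-1).
Local Notation Sg := (Sgm K).
Local Notation A := (Sg *m B *m B^T *m Sg).
Hypothesis pG : is_pinv A G.

Let A_sym : A^T = A.
Proof. by rewrite !trmx_mul trmxK Sigma_mx_sym !mulmxA. Qed.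

Lemma pinv_Sigma : Sg *m G = G /\ G *m Sg = G.
Proof.
have [E1 E2] := pinv_range A_sym pG.
have SA : Sg *m A = A by rewrite !mulmxA Sigma_mx_idem.
have AS : A *m Sg = A by rewrite -mulmxA Sigma_mx_idem.
split; first by rewrite [in LHS]E1 mulmxA SA -E1.
by rewrite [in LHS]E2 -mulmxA AS -E2.
Qed.

(** The hypotheses are the normal equations [A dz = Sg B dv] for a [dz] vanishing on [K]. Then [dz]
    and [G A dz] differ by a kernel vector [u] of [A] with [Sg u = u], and
    [|B^T u|^2 = <u, A u> = 0]. *)
Lemma pinv_solve (dz : 'cV[R]_L.-1) (dv : 'cV[R]_L) : Sg *m dz = dz ->
  Sg *m (B *m dv - B *m B^T *m dz) = 0 -> B^T *m dz = B^T *m G *m B *m dv.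
Proof.
move=> Sdz E; have [h1 h2 _ _] := pG; have [SG GS] := pinv_Sigma.
pose u := dz - G *m A *m dz.
have Su : Sg *m u = u by rewrite /u mulmxBr Sdz !mulmxA SG.
have Au : A *m u = 0.
  rewrite /u mulmxBr; have -> : A *m (G *m A *m dz) = A *m dz.
    by rewrite -[in RHS]h1 !mulmxA.
  by rewrite subrr.
have Bu : B^T *m u = 0.
  apply: frob0_eq0; rewrite -(@ler_sqr R) ?nnegrE ?frob_ge0// frob_sqr expr0n/=.
  rewrite dot_mul trmxK -{1}Su dot_mul Sigma_mx_sym -[X in _ *m (B *m (_ *m X))]Su.
  by rewrite !mulmxA Au /dot mulmx0 mxtrace0.
have -> : B^T *m dz = B^T *m (G *m (A *m dz)).
  by apply/eqP; rewrite -subr_eq0 -mulmxBr mulmxA; apply/eqP.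
have -> : A *m dz = Sg *m (B *m dv).
  rewrite -[LHS]mulmxA Sdz; apply/eqP; rewrite eq_sym -subr_eq0 -!mulmxA -mulmxBr.
  by rewrite mulmxA; apply/eqP.
by rewrite !mulmxA -(mulmxA _ G) GS.
Qed.

(** [B^T G B] is symmetric and idempotent, so the matrix is an orthogonal projection. *)
Lemma pinv_bound (x : 'cV[R]_L) : frob ((1%:M - B^T *m G *m B) *m x) <= frob x.
Proof.
have [h1 h2 _ _] := pG; have [SG GS] := pinv_Sigma.
have [E EE] : exists E, E = B^T *m G *m B by eexists.
have Esym : E^T = E by rewrite EE !trmx_mul trmxK (pinv_sym A_sym pG) mulmxA.
have Eid : E *m E = E.
  have -> : E *m E = B^T *m ((G *m Sg) *m B *m B^T *m (Sg *m G)) *m B.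
    by rewrite GS SG EE !mulmxA.
  by rewrite EE -{3}h2 !mulmxA.
rewrite -EE; apply: le_frob_sqr; rewrite mulmxBl mul1mx !(dotDl, dotDr, dotNl, dotNr).
have -> : dot (E *m x) (E *m x) = dot x (E *m x).
  by rewrite dot_mul Esym mulmxA Eid.
by rewrite (dotC (E *m x) x); lra.
Qed.

End Pinv.

Lemma Qset_bound v Q (x : 'cV[R]_L) : Qset lam v Q -> frob (Q *m x) <= frob x.
Proof. by move=> [K [G [_ pG ->]]]; exact: pinv_bound pG x. Qed.

(** On [K] the multiplier at [v] sits at a bound, where [z0 = z]; off [K] the entry of [B x]
    vanishes at [v], hence also at [v0]. These are the two hypotheses of [pinv_solve], and they hold
    for every admissible [K]. *)
Lemma x_tv_local v0 : exists2 e : R, 0 < e & forall v Q, frob (v - v0) < e ->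
  Qset lam v Q -> x_tv lam v - x_tv lam v0 = Q *m (v - v0).
Proof.
have [e e0 H] := tv_near v0; exists e => // v Q /H /= N [K [G [[K1 K2] pG ->]]].
have dx : x_tv lam v - x_tv lam v0 = (v - v0)
    - B^T *m (z_tv lam (B *m v) - z_tv lam (B *m v0)).
  by rewrite !x_tvE mulmxBr; apply/matrixP => k l; rewrite !mxE; ring.
rewrite mulmxBl mul1mx -(pinv_solve pG (dz := z_tv lam (B *m v) - z_tv lam (B *m v0))) //.
- apply/colP => i; rewrite Sigma_mxE; case: ifPn => // iK.
  by have [_ _ n3 _ _] := N i; rewrite !mxE (n3 (K2 i iK)) subrr.
- apply/colP => i; rewrite Sigma_mxE [RHS]mxE; case: ifPn => // iK.
  rewrite -mulmxA -mulmxBr -dx mulmxBr.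
  have [_ _ _ n4 _] := N i.
  have g0 : (B *m x_tv lam v) i 0 = 0 by apply: contraNeq iK => /K1.
  by rewrite [LHS]mxE g0 add0r mxE (n4 g0) oppr0.
Qed.

End TotalVariation.

Lemma Bmx_mulE (R : realType) L (i : 'I_L.-1) : exists a b : 'I_L,
  forall x : 'cV[R]_L, (@Bmx R L *m x) i 0 = x a 0 - x b 0.
Proof.
have iL : (i < L)%N by apply: leq_trans (ltn_ord i) (leq_pred _).
have iL1 : (i.+1 < L)%N by rewrite -ltn_predRL.
exists (Ordinal iL), (Ordinal iL1) => x; rewrite mxE.
under eq_bigr do rewrite mxE mulrBl.
rewrite sumrB (bigD1 (Ordinal iL))//= eqxx mul1r big1 ?addr0; last first.
  by move=> k; rewrite -val_eqE /= => /negbTE ->; rewrite mul0r.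
rewrite (bigD1 (Ordinal iL1))//= eqxx mul1r big1 ?addr0// => k.
by rewrite -val_eqE /= => /negbTE ->; rewrite mul0r.
Qed.

(** * Composition of soft thresholding with the total variation prox *)

Section FusedProx.
Context {R : realType} {L : nat}.
Variables (lam1 lam2 : R) (lam10 : 0 <= lam1) (lam20 : 0 <= lam2).
Implicit Types v w h : 'cV[R]_L.
Local Notation B := (@Bmx R L).

Definition prox_fused v : 'cV[R]_L := softv lam1 (x_tv lam2 v).

(* Soft thresholding preserves the order of the coordinates, so the dual
   certificate of the total variation prox is still one after it. *)
Lemma prox_fused_subgrad v w :
  fused lam1 lam2 (prox_fused v) + dot (v - prox_fused v) (w - prox_fused v)
    <= fused lam1 lam2 w.
Proof.
rewrite /prox_fused; set x := x_tv lam2 v; set y := softv lam1 x.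
have [_ K] := z_tv_kkt lam20 v; rewrite -x_tvE// -/x in K.
have xE := x_tvE lam20 v; rewrite -/x in xE.
set z := z_tv _ _ in xE K.
have vy : v - y = B^T *m z + (x - y).
  by rewrite [in RHS]xE -addrA [RHS]addrCA addNKr.
have zy i : z i 0 * (B *m y) i 0 = lam2 * `|(B *m y) i 0|.
  have [_] := K i; have [a [b ab]] := @Bmx_mulE R L i; rewrite !ab.
  rewrite /y !mxE; have [h|h|->] := ltgtP (x a 0) (x b 0) => zE.
  - have s := soft1_mono lam10 (ltW h).
    have -> : z i 0 = - lam2.
      have h' : x a 0 - x b 0 < 0 by rewrite subr_lt0.
      by apply: (mulIf (ltr0_neq0 h')); rewrite zE ltr0_norm// mulrN mulNr.
    by rewrite ler0_norm ?subr_le0// mulrN mulNr.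
  - have s := soft1_mono lam10 (ltW h).
    have -> : z i 0 = lam2.
      have h' : 0 < x a 0 - x b 0 by rewrite subr_gt0.
      by apply: (mulIf (lt0r_neq0 h')); rewrite zE gtr0_norm.
    by rewrite ger0_norm ?subr_ge0.
  - by rewrite subrr normr0 !mulr0.
have h1 := softv_subgrad lam10 x w; rewrite -/y in h1.
have h2 : lam2 * cvnorm1 (B *m y) + dot (B^T *m z) (w - y) <= lam2 * cvnorm1 (B *m w).
  rewrite dot_mul trmxK mulmxBr /cvnorm1 dotE !mulr_sumr -big_split.
  apply: ler_sum => i _; have [zl _] := K i.
  rewrite [X in z i 0 * X]mxE [X in z i 0 * (_ + X)]mxE /= mulrBr zy addrC subrK.
  by apply: le_trans (ler_norm _) _; rewrite normrM ler_wpM2r.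
by rewrite /fused vy dotDl; lra.
Qed.

Lemma prox_fused_homogeneous v0 : exists2 e : R, 0 < e &
  forall h (t : R), frob h < e -> 0 <= t <= 1 ->
  prox_fused (v0 + t *: h) - prox_fused v0
    = t *: (prox_fused (v0 + h) - prox_fused v0).
Proof.
have [e1 e10 H1] := x_tv_homogeneous lam20 v0.
have [e2 e20 H2] := softv_homogeneous lam10 (x_tv lam2 v0).
exists (Num.min e1 e2) => [|h t]; first by rewrite lt_min e10.
rewrite lt_min => /andP[he1 he2] t01; rewrite /prox_fused.
have E k : x_tv lam2 (v0 + k *: h) =
    x_tv lam2 v0 + (x_tv lam2 (v0 + k *: h) - x_tv lam2 v0) by rewrite subrKC.
have := E 1; rewrite scale1r => E1.
rewrite E H1// [in RHS]E1 H2//.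
have := x_tv_lip lam20 (v0 + h) v0; rewrite [v0 + h]addrC addrK => /le_lt_trans.
exact.
Qed.

Lemma jac_prox_fused_local v0 : exists2 e : R, 0 < e &
  forall v M, frob (v - v0) < e -> jac_prox_fused lam1 lam2 v M ->
  prox_fused v - prox_fused v0 = M *m (v - v0).
Proof.
have [e1 e10 H1] := x_tv_local lam20 v0.
have [e2 e20 H2] := Bsubdiff_softv_local lam10 (x_tv lam2 v0).
exists (Num.min e1 e2) => [|v M]; first by rewrite lt_min e10.
rewrite lt_min => /andP[ve1 ve2] [_ [Ups [Q [bU qQ ->]]]].
rewrite (prox_softv lam10) in bU; rewrite -mulmxA -H1// -H2//.
by apply: le_lt_trans ve2; exact: x_tv_lip.
Qed.

Lemma jac_prox_fused_bound v M h : jac_prox_fused lam1 lam2 v M ->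
  frob (M *m h) <= frob h.
Proof.
move=> [_ [Ups [Q [bU qQ ->]]]]; rewrite (prox_softv lam10) in bU.
rewrite -mulmxA; apply: le_trans (Bsubdiff_softv_bound lam10 _ bU) _.
exact: Qset_bound qQ.
Qed.

End FusedProx.

(** * The abstract semismooth Newton method *)

Section SymTuples.
Context {R : realType} {L p : nat}.
Implicit Types X Y Z : symtup R L p.

Lemma innerDl X Y Z : inner (X + Y) Z = inner X Z + inner Y Z.
Proof. exact: (ipDl innerL). Qed.
Lemma innerDr X Y Z : inner Z (X + Y) = inner Z X + inner Z Y.
Proof. exact: (ipDr innerC innerL). Qed.
Lemma innerNl X Z : inner (- X) Z = - inner X Z.
Proof. exact: (ipNl innerL). Qed.
Lemma innerNr X Z : inner Z (- X) = - inner Z X.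
Proof. exact: (ipNr innerC innerL). Qed.
Lemma innerZl a X Z : inner (a *: X) Z = a * inner X Z.
Proof. exact: (ipZl innerL). Qed.
Lemma innerZr a X Z : inner Z (a *: X) = a * inner Z X.
Proof. exact: (ipZr innerC innerL). Qed.
Lemma inner0l X : inner 0 X = 0.
Proof. exact: (ip0l innerL). Qed.
Lemma inner0r X : inner X 0 = 0.
Proof. by rewrite innerC inner0l. Qed.

Definition innerE := (innerDl, innerDr, innerNl, innerNr, innerZl, innerZr).

Lemma inner_CS X Y : inner X Y <= `|X| * `|Y|.
Proof. exact: (ip_CS innerC innerL inner_ge0). Qed.

Lemma inner_normE X : inner X X = `|X| ^+ 2.
Proof. by rewrite [`|X|]/(tupnorm X) sqr_sqrtr// inner_ge0. Qed.

Lemma inner_eq0 X : inner X X = 0 -> X = 0.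
Proof. by rewrite inner_normE => /eqP; rewrite sqrf_eq0 normr_eq0 => /eqP. Qed.

Lemma inner_abs X Y : `|inner X Y| <= `|X| * `|Y|.
Proof.
rewrite ler_norml inner_CS andbT lerNl -innerNl.
by apply: le_trans (inner_CS _ _) _; rewrite normrN.
Qed.

Lemma symtup_coord X l i j : `|X l i j| <= `|X|.
Proof.
rewrite -ler_sqr ?nnegrE// -inner_normE real_normK ?num_real//.
rewrite /inner (bigD1 l)//= -[leLHS]addr0 lerD//; last first.
  by apply: sumr_ge0 => k _; exact: mxinner_ge0.
rewrite mxinnerE (bigD1 i)//= -[leLHS]addr0 lerD//; last first.
  by do 2!apply: sumr_ge0 => ? _; rewrite -expr2 sqr_ge0.
rewrite (bigD1 j)//= -[leLHS]addr0 -expr2 lerD//.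
by apply: sumr_ge0 => ? _; rewrite -expr2 sqr_ge0.
Qed.

Lemma symtup_norm_le X (e : R) : 0 <= e -> (forall l i j, `|X l i j| <= e) ->
  `|X| <= (L * p * p)%:R * e.
Proof.
move=> e0 H; have h : `|X| ^+ 2 <= (L * p * p)%:R * e ^+ 2.
  rewrite -inner_normE /inner.
  apply: (@le_trans _ _ (\sum_(l < L) \sum_(i < p) \sum_(j < p) e ^+ 2)).
    apply: ler_sum => l _; rewrite mxinnerE; do 2!apply: ler_sum => ? _.
    by rewrite -expr2 -(real_normK (num_real (X l _ _))) ler_sqr ?nnegrE.
  by rewrite !sumr_const !card_ord -!mulrnA mulr_natl (mulnC p L) mulnA (mulnC p L).
rewrite -ler_sqr ?nnegrE ?mulr_ge0//; apply: le_trans h _.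
rewrite exprMn ler_wpM2r ?sqr_ge0//.
case: (L * p * p)%N => [|n]; first by rewrite expr0n.
by rewrite expr2 ler_peMr// ler1n.
Qed.

Lemma symmxBE (A B : symmx R p) i j : (A - B) i j = A i j - B i j.
Proof. by rewrite -[LHS]/(((A : 'M[R]_p) - (B : 'M[R]_p)) i j) !mxE. Qed.

(** Entrywise limits exist in [R], are symmetric as limits of symmetric entries, and entrywise
    convergence is convergence in norm in finite dimension. *)
Lemma symtup_complete (X : nat -> symtup R L p) :
  (forall e : R, 0 < e -> exists N, forall n, (N <= n)%N -> `|X n - X N| < e) ->
  cvg (X @ \oo).
Proof.
move=> cX.
have cc l i j : cvg ((fun n => X n l i j : R) @ \oo).
  apply/cauchy_cvgP/cauchy_exP => e /= /cX[N HN]; exists (X N l i j), N => // n /= Nn.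
  rewrite -ball_normE /=; apply: le_lt_trans (HN n Nn).
  by have := symtup_coord (X N - X n) l i j; rewrite distrC !ffunE symmxBE distrC.
pose M l : 'M[R]_p := \matrix_(i, j) lim ((fun n => X n l i j : R) @ \oo).
have sM l : M l \in @symmx_pred R p.
  apply/eqP; apply/matrixP => i j; rewrite !mxE.
  suff -> : (fun n => X n l j i : R) = (fun n => X n l i j) by [].
  by apply/funext => n; rewrite -{1}(symmxT (X n l)) mxE.
pose Y : symtup R L p := [ffun l => SymMx (sM l)].
apply/cvg_ex; exists Y; apply/cvgrPdist_lt => e e0.
pose k : R := (L * p * p)%:R + 1.
have k0 : 0 < k by rewrite ltr_wpDl.
have : \forall n \near \oo, forall lij : 'I_L * 'I_p * 'I_p,
    `|Y lij.1.1 lij.1.2 lij.2 - X n lij.1.1 lij.1.2 lij.2| < e / k.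
  apply: filter_forall => -[[l i] j] /=; rewrite ffunE /= mxE.
  by have /cvgrPdist_lt := cc l i j; apply; rewrite divr_gt0.
apply: filterS => n H.
apply: le_lt_trans (_ : (L * p * p)%:R * (e / k) < e).
  apply: symtup_norm_le => [|l i j]; first by rewrite divr_ge0 ?ltW.
  by have := ltW (H (l, i, j)); rewrite /= !ffunE /= !mxE.
by rewrite mulrCA gtr_pMr// ltr_pdivrMr// mul1r ltrDl.
Qed.

End SymTuples.

Section Gradient.
Context {R : realType} {L p : nat}.
Implicit Types (f : symtup R L p -> R) (X Y G H : symtup R L p).

Definition inner_l G (H : symtup R L p) : R^o := inner G H.

Fact inner_l_linear G : linear (inner_l G).
Proof. by move=> a H K; rewrite /inner_l !innerE. Qed.

HB.instance Definition _ G :=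
  GRing.isLinear.Build R (symtup R L p) R^o *:%R (inner_l G) (inner_l_linear G).

Lemma is_grad_quadratic f X G (C : R) : 0 <= C ->
  (forall Y, `|f Y - f X - inner G (Y - X)| <= C * `|Y - X| ^+ 2) ->
  is_grad f X G.
Proof.
move=> C0 HC.
have [//|//|h|h _|df dE] := @differentiable_quadratic R (symtup R L p) R^o
  (f : symtup R L p -> R^o) X (inner_l G) `|G| C.
- exact: inner_abs.
- by have := HC (h + X); rewrite addrK.
- by split=> // H; rewrite dE.
Qed.

Lemma is_grad_unique f X G G' : is_grad f X G -> is_grad f X G' -> G = G'.
Proof.
move=> [_ dG] [_ dG']; apply/eqP; rewrite -subr_eq0; apply/eqP/inner_eq0.
by rewrite innerDl innerNl -dG -dG' subrr.
Qed.

Lemma gradE f X G : is_grad f X G -> grad f X = G.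
Proof.
move=> fG; apply: xget_unique => // G' fG'; exact: is_grad_unique fG' fG.
Qed.

End Gradient.

(** * Conjugate gradients *)

Section ConjugateGradient.
Context {R : realType} {L p : nat}.
Variables (A : {linear symtup R L p -> symtup R L p}) (b : symtup R L p).
Hypothesis A_sym : forall D E, inner (A D) E = inner D (A E).
Hypothesis A_definite : forall D, inner D (A D) = 0 -> D = 0.

Let st n := iter n (cg_step A) (0, b, b).
Let x n := (st n).1.1.
Let r n := (st n).1.2.
Let d n := (st n).2.
Let a n := inner (r n) (r n) / inner (d n) (A (d n)).

Let xS n : x n.+1 = x n + a n *: d n.
Proof. by rewrite /x /a /r /d /st iterS; case: (iter n _ _) => -[]. Qed.

Let rS n : r n.+1 = r n - a n *: A (d n).
Proof. by rewrite /a /r /d /st iterS; case: (iter n _ _) => -[]. Qed.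

Let dS n : d n.+1 = r n.+1
  + (inner (r n.+1) (r n.+1) / inner (r n) (r n)) *: d n.
Proof. by rewrite /r /d /st iterS; case: (iter n _ _) => -[]. Qed.

Let rE n : r n = b - A (x n).
Proof.
elim: n => [|n IH]; first by rewrite /r /x /= linear0 subr0.
by rewrite rS IH xS linearD [A (_ *: _)]linearZ /= opprD addrA.
Qed.

Let r0d n : inner (r n) (r n) = 0 -> d n = 0.
Proof.
case: n => [|n]; first by move/inner_eq0.
by move=> h; rewrite dS h mul0r scale0r addr0; exact: inner_eq0.
Qed.

Let a_step n : inner (r n) (d n) = inner (r n) (r n) ->
  a n * inner (d n) (A (d n)) = inner (r n) (r n).
Proof.
move=> rd; rewrite /a; have [h|h] := eqVneq (inner (d n) (A (d n))) 0.
  by rewrite h mulr0 -rd (A_definite h) inner0r.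
by rewrite divfK.
Qed.

(** The classical joint induction: residuals are orthogonal to former directions, and directions are
    conjugate. It uses definiteness of either sign; the Newton operators are negative definite. *)
Let orth n : [/\ inner (r n) (d n) = inner (r n) (r n),
  forall i, (i < n)%N -> inner (r n) (d i) = 0 &
  forall i, (i < n)%N -> inner (d n) (A (d i)) = 0].
Proof.
elim: n => [|n [I4 I5 I3]]; first by split.
have J5 i : (i < n.+1)%N -> inner (r n.+1) (d i) = 0.
  rewrite ltnS leq_eqVlt rS !innerE A_sym => /orP[/eqP ->|h].
    by rewrite I4 a_step// subrr.
  by rewrite I5// I3// mulr0 subrr.
have J4 : inner (r n.+1) (d n.+1) = inner (r n.+1) (r n.+1).
  by rewrite dS !innerE J5// mulr0 addr0.
have J2 i : (i < n.+1)%N -> inner (r n.+1) (r i) = 0.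
  case: i => [|i] h; first exact: (J5 0%N h).
  have -> : r i.+1 = d i.+1 - (inner (r i.+1) (r i.+1) / inner (r i) (r i)) *: d i.
    by rewrite dS addrK.
  by rewrite !innerE !J5// ?mulr0 ?subrr// ltnW.
split=> // i; rewrite ltnS dS !innerE => ilen.
(* After termination the directions vanish and conjugacy is trivial; otherwise every divisor below
   is nonzero. *)
have [d0|d0] := eqVneq (d i) 0.
  by rewrite d0 linear0 !inner0r mulr0 addr0.
have ri0 : inner (r i) (r i) != 0 by apply: contra_neq d0 => /r0d.
have qi0 : inner (d i) (A (d i)) != 0 by apply: contra_neq d0 => /A_definite.
have ai0 : a i != 0 by rewrite mulf_neq0// invr_eq0.
have AdE : A (d i) = (a i)^-1 *: (r i - r i.+1).
  by rewrite rS opprB addrC subrK scalerA mulVf// scale1r.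
have h : inner (r n.+1) (A (d i)) = - (a i)^-1 * inner (r n.+1) (r i.+1).
  by rewrite AdE !innerE J2// sub0r mulrN mulNr.
rewrite h; move: ilen; rewrite leq_eqVlt => /orP[/eqP E|iltn].
  by rewrite E in ri0 qi0 h *; rewrite /a; field; rewrite qi0 ri0.
by rewrite J2// I3// !mulr0 addr0.
Qed.

(* The iterate is a combination of former directions, all orthogonal to the
   residual. *)
Lemma cg_residual_orth n : inner (A (cg A b n)) (cg A b n) = inner b (cg A b n).
Proof.
have : inner (r n) (x n) = 0.
  have [_ I5 _] := orth n; have : forall m, (m <= n)%N -> inner (r n) (x m) = 0.
    elim=> [|m IH] h; first by rewrite /x /= inner0r.
    by rewrite xS !innerE IH ?(ltnW h)// I5// mulr0 addr0.
  exact.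
by rewrite rE !innerE => /eqP; rewrite subr_eq0 => /eqP ->.
Qed.

End ConjugateGradient.

Section ShiftedOperator.
Context {R : realType} {L p : nat}.
Implicit Types (V : {linear symtup R L p -> symtup R L p}) (c : R).

Definition shift_op V c (Y : symtup R L p) : symtup R L p := V Y - c *: Y.

Fact shift_op_linear V c : linear (shift_op V c).
Proof.
move=> a X Y; rewrite /shift_op linearP scalerDr opprD addrACA scalerBr.
by rewrite !scalerA (mulrC a).
Qed.

HB.instance Definition _ V c :=
  GRing.isLinear.Build R (symtup R L p) (symtup R L p) *:%R (shift_op V c)
    (shift_op_linear V c).

Variables (V : {linear symtup R L p -> symtup R L p}) (c : R).
Hypothesis c0 : 0 < c.
Hypothesis V_sym : forall D E, inner (V D) E = inner D (V E).
Hypothesis V_le0 : forall D, inner (V D) D <= 0.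

Lemma shift_op_le D : inner (shift_op V c D) D <= - (c * `|D| ^+ 2).
Proof. by rewrite /shift_op !innerE inner_normE; have := V_le0 D; lra. Qed.

Lemma shift_op_lower D : c * `|D| <= `|shift_op V c D|.
Proof.
have h : c * `|D| ^+ 2 <= `|shift_op V c D| * `|D|.
  rewrite -[leRHS]opprK; apply: le_trans (_ : - inner (shift_op V c D) D <= _).
    by rewrite lerNr shift_op_le.
  by rewrite opprK -innerNl (le_trans (inner_CS _ _))// normrN.
have := normr_ge0 D; rewrite le_eqVlt => /orP[/eqP <-|D0]; first by rewrite mulr0.
by move: h; rewrite expr2 mulrA ler_pM2r.
Qed.

(** For [b] the negative gradient this is the ascent property, valid at every iterate, however early
    CG stops. *)
Lemma shift_op_cg b n :
  c * `|cg (shift_op V c) b n| ^+ 2 <= - inner b (cg (shift_op V c) b n).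
Proof.
rewrite -(cg_residual_orth (A := shift_op V c)).
- by rewrite lerNr shift_op_le.
- by move=> D E; rewrite /= /shift_op !innerE V_sym.
- move=> D /= h; have := shift_op_le D; rewrite innerC h oppr_ge0 pmulr_rle0//.
  by rewrite le_eqVlt ltNge sqr_ge0 orbF sqrf_eq0 normr_eq0 => /eqP.
Qed.

End ShiftedOperator.

(** Split at a threshold [s] strictly between [eta] and 1: above it [eta <= (eta / s) x], below it
    [x^tau <= s^tau < 1]. *)
Lemma inexact_residual (R : realType) (eta tau : R) : 0 < eta < 1 -> 0 < tau ->
  exists2 c : R, 0 <= c < 1 & forall x : R, 0 <= x ->
    Num.min eta (x `^ (1 + tau)) <= c * x.
Proof.
move=> /andP[e0 e1] t0; pose s := (1 + eta) / 2.
have s0 : 0 < s by rewrite /s; lra.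
have s1 : s < 1 by rewrite /s; lra.
have es : eta < s by rewrite /s; lra.
have h1 : eta / s < 1 by rewrite ltr_pdivrMr// mul1r.
have h2 : s `^ tau < 1.
  have -> : 1 = 1 `^ tau :> R by rewrite powR1.
  by rewrite gt0_ltr_powR// ?nnegrE ?ltW.
exists (Num.max (eta / s) (s `^ tau)) => [|x x0].
  by rewrite gt_max h1 h2 le_max powR_ge0 orbT.
have [xs|xs] := leP s x.
  rewrite ge_min; apply/orP; left; apply: (@le_trans _ _ (eta / s * x)).
    by rewrite mulrAC -mulrA ler_peMr ?(ltW e0)// ler_pdivlMr// mul1r.
  by rewrite ler_wpM2r// le_max lexx.
rewrite ge_min; apply/orP; right; rewrite powRD; last first.
  by apply/implyP => /eqP; lra.
rewrite powRr1// mulrC ler_wpM2r// le_max; apply/orP; right.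
by rewrite ge0_ler_powR ?nnegrE ?(ltW t0) ?(ltW s0) ?(ltW xs).
Qed.

(** * Global convergence and local rate from abstract hypotheses on [f], [g] and [jac] *)

Section AbstractSSN.
Context {R : realType} {L p : nat}.
Variables (f : symtup R L p -> R) (g : symtup R L p -> symtup R L p)
  (jac : symtup R L p -> set {linear symtup R L p -> symtup R L p})
  (s Lam kap : R).
Hypotheses (s0 : 0 < s) (Lam0 : 0 <= Lam) (kap0 : 0 <= kap).
Hypothesis f_concave : forall X Y,
  f Y <= f X + inner (g X) (Y - X) - (2 * s)^-1 * `|Y - X| ^+ 2.
Hypothesis g_lip : forall X Y, `|g X - g Y| <= Lam * `|X - Y|.
Hypothesis jac_op : forall X V, jac X V ->
  [/\ forall D E, inner (V D) E = inner D (V E),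
      forall D, inner (V D) D <= 0 & forall D, `|V D| <= kap * `|D|].
Hypothesis jac_semismooth : forall X0 : symtup R L p, exists2 e : R, 0 < e &
  exists2 C : R, 0 <= C & forall (X : symtup R L p) V, `|X - X0| < e -> jac X V ->
  `|g X - g X0 - shift_op V s^-1 (X - X0)| <= C * `|X - X0| ^+ 2.
Hypothesis g_homogeneous : forall X0 : symtup R L p, exists2 e : R, 0 < e &
  exists2 C : R, 0 <= C & forall (H : symtup R L p) (t : R), `|H| < e -> 0 <= t <= 1 ->
  `|g (X0 + t *: H) - g X0 - t *: (g (X0 + H) - g X0)| <= C * `|H| ^+ 2.

Let s20 : 0 < (2 * s)^-1. Proof. by rewrite invr_gt0 mulr_gt0. Qed.

Lemma ssn_f_lower X Y : f X + inner (g Y) (Y - X) <= f Y.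
Proof.
have := f_concave Y X; rewrite -(opprB Y X) innerNr normrN.
by have := mulr_ge0 (ltW s20) (sqr_ge0 `|Y - X|); lra.
Qed.

Lemma ssn_g_mono X Y : s^-1 * `|X - Y| ^+ 2 <= inner (g Y - g X) (X - Y).
Proof.
have := f_concave Y X; have := f_concave X Y.
rewrite -(opprB X Y) innerNr normrN => h1 h2.
have E : s^-1 = (2 * s)^-1 + (2 * s)^-1 by field; rewrite gt_eqF.
by rewrite innerDl innerNl E mulrDl; lra.
Qed.

(** Strong monotonicity of [- g] and Cauchy-Schwarz. It gives uniqueness of the zero of [g], and
    makes iterates with small gradients a Cauchy sequence. *)
Lemma ssn_g_dist X Y : `|X - Y| <= s * `|g X - g Y|.
Proof.
have h : s^-1 * `|X - Y| ^+ 2 <= `|g X - g Y| * `|X - Y|.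
  apply: le_trans (ssn_g_mono X Y) _.
  by rewrite (distrC (g X)); exact: inner_CS.
have := normr_ge0 (X - Y); rewrite le_eqVlt => /orP[/eqP <-|D0].
  by rewrite mulr_ge0// ltW.
by move: h; rewrite expr2 mulrA ler_pM2r// ler_pdivrMl.
Qed.

(** Concavity at [X] bounds the increment of [f] from above, and at [Y] from below by
    [<g Y, Y - X>]; the Lipschitz bound makes the two agree up to a quadratic term. *)
Lemma ssn_is_grad X : is_grad f X (g X).
Proof.
apply: (@is_grad_quadratic _ _ _ _ _ _ (Lam + (2 * s)^-1)) => [|Y].
  by rewrite addr_ge0// ltW.
have h1 := f_concave X Y; have h2 := ssn_f_lower X Y.
have h3 : inner (g Y) (Y - X) - inner (g X) (Y - X) >= - (Lam * `|Y - X| ^+ 2).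
  rewrite -innerNl -innerDl lerNl -innerNl.
  apply: le_trans (inner_CS _ _) _; rewrite normrN expr2 mulrA ler_wpM2r//.
have h4 := sqr_ge0 `|Y - X|; have h5 := mulr_ge0 (ltW s20) h4.
have h6 := mulr_ge0 Lam0 h4.
by rewrite ler_norml mulrDl; apply/andP; split; lra.
Qed.

Lemma ssn_gradE X : grad f X = g X.
Proof. exact: gradE (ssn_is_grad X). Qed.

Lemma ssn_f_bounded X Y : f Y <= f X + s / 2 * `|g X| ^+ 2.
Proof.
apply: le_trans (f_concave X Y) _; rewrite -addrA lerD2l.
have h := inner_CS (g X) (Y - X); rewrite -subr_ge0.
have -> : s / 2 * `|g X| ^+ 2 - (inner (g X) (Y - X) - (2 * s)^-1 * `|Y - X| ^+ 2)
  = (2 * s)^-1 * (s * `|g X| - `|Y - X|) ^+ 2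
    + (`|g X| * `|Y - X| - inner (g X) (Y - X)).
  by field; rewrite gt_eqF.
by rewrite addr_ge0 ?subr_ge0// mulr_ge0 ?sqr_ge0// ltW.
Qed.

(* Summing the concavity inequality over [n] equal pieces of a segment, on
   which [g] is nearly linear, approximates the integral of [g]. *)
Lemma ssn_partition X0 H (C : R) n : 0 <= C -> (0 < n)%N -> g X0 = 0 ->
  (forall t : R, 0 <= t <= 1 ->
    `|g (X0 + t *: H) - t *: g (X0 + H)| <= C * `|H| ^+ 2) ->
  f X0 - f (X0 + H) >=
    (n%:R - 1) / (2 * n%:R) * - inner (g (X0 + H)) H - C * `|H| ^+ 3.
Proof.
move=> C0 n0 g0 gh; set q := - inner _ H; have n0' : 0 < n%:R :> R by rewrite ltr0n.
pose Y (k : nat) := X0 + (k%:R / n%:R) *: H.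
have step k : (k < n)%N -> f (Y k) - f (Y k.+1) >=
    k%:R / n%:R ^+ 2 * q - C * `|H| ^+ 3 / n%:R.
  move=> kn; have := ssn_f_lower (Y k.+1) (Y k).
  have -> : Y k - Y k.+1 = - n%:R^-1 *: H.
    rewrite /Y opprD addrACA subrr add0r -scalerBl; congr (_ *: _).
    by rewrite -mulrBl -natr1; field; rewrite gt_eqF.
  have kn1 : 0 <= (k%:R / n%:R : R) <= 1.
    by rewrite divr_ge0//= ler_pdivrMr// mul1r ler_nat ltnW.
  have := gh _ kn1; rewrite -/(Y k); set E := g (Y k) - _ => EH.
  have -> : g (Y k) = (k%:R / n%:R) *: g (X0 + H) + E by rewrite subrKC.
  rewrite innerZr innerDl innerZl -[inner (g (X0 + H)) H]opprK -/q => h.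
  have hE : n%:R^-1 * inner E H <= C * `|H| ^+ 3 / n%:R.
    rewrite [leRHS]mulrC ler_pM2l ?invr_gt0// (le_trans (inner_CS _ _))//.
    by rewrite exprSr mulrA ler_wpM2r.
  have -> : k%:R / n%:R ^+ 2 * q = n%:R^-1 * (k%:R / n%:R * q).
    by field; rewrite gt_eqF.
  by lra.
(* A left Riemann sum: the [k / n^2] with [k < m] add up to [m (m - 1) / (2 n^2)], which for [m = n]
   falls short of 1/2 by [1 / (2 n)]. *)
have tele m : (m <= n)%N -> f X0 - f (Y m) >=
    m%:R * (m%:R - 1) / (2 * n%:R ^+ 2) * q - m%:R * (C * `|H| ^+ 3 / n%:R).
  elim: m => [|m IH] mn.
    by rewrite /Y !mul0r scale0r addr0 !subrr.
  have := IH (ltnW mn); have := step _ mn.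
  have -> : m.+1%:R * (m.+1%:R - 1) / (2 * n%:R ^+ 2) * q =
    m%:R * (m%:R - 1) / (2 * n%:R ^+ 2) * q + m%:R / n%:R ^+ 2 * q.
    by rewrite -natr1; field; rewrite gt_eqF.
  by rewrite -natr1; lra.
have := tele _ (leqnn n); rewrite /Y divff ?gt_eqF// scale1r.
have -> : n%:R * (n%:R - 1) / (2 * n%:R ^+ 2) * q
  = (n%:R - 1) / (2 * n%:R) * q by field; rewrite gt_eqF.
by have -> : n%:R * (C * `|H| ^+ 3 / n%:R) = C * `|H| ^+ 3 by field; rewrite gt_eqF.
Qed.

Variables (mu eta tau rho : R).
Hypotheses (hmu : 0 < mu < 2^-1) (heta : 0 < eta < 1) (htau : 0 < tau <= 1)
  (hrho : 0 < rho < 1).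
Variable X : nat -> symtup R L p.
Hypothesis hX : ssn f jac s mu eta tau rho X.

Let si0 : 0 < s^-1. Proof. by rewrite invr_gt0. Qed.

Lemma ssn_newton_step j : exists (V : {linear symtup R L p -> symtup R L p})
    (D : symtup R L p) (m : nat),
  [/\ jac (X j) V, s^-1 * `|D| ^+ 2 <= inner (g (X j)) D,
      `|shift_op V s^-1 D + g (X j)| <= Num.min eta (`|g (X j)| `^ (1 + tau)),
      armijo f mu rho (X j) D m /\ (forall n, (n < m)%N -> ~ armijo f mu rho (X j) D n)
    & X j.+1 = X j + rho ^+ m *: D].
Proof.
have [V [D [m [jV [n DE] r a XE]]]] := ssn_step hX j.
rewrite ssn_gradE in DE r; exists V, D, m; split=> //.
have [h1 h2 _] := jac_op jV.
rewrite DE; apply: le_trans (shift_op_cg si0 h1 h2 _ _) _.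
by rewrite innerNl opprK.
Qed.

Lemma armijoE Y D m : armijo f mu rho Y D m <->
  f Y + mu * rho ^+ m * inner (g Y) D <= f (Y + rho ^+ m *: D).
Proof. by rewrite /armijo ssn_gradE. Qed.

(** For a step [a], concavity gains at least [a <g(Y + a D), D>]. Replacing the gradient by [g Y]
    loses at most [a Lam |D|^2 <= <g Y, D> / 2] inside the product, and [mu < 1/2]. *)
Lemma armijo_small Y D m : s^-1 * `|D| ^+ 2 <= inner (g Y) D ->
  rho ^+ m * (s * Lam) <= 2^-1 -> armijo f mu rho Y D m.
Proof.
move=> h hm; apply/armijoE; have [r0 _] := andP hrho.
have a0 : 0 < rho ^+ m by rewrite exprn_gt0.
set a := rho ^+ m in hm a0 *.
have E : Y + a *: D - Y = a *: D by rewrite addrC addKr.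
have := ssn_f_lower Y (Y + a *: D); rewrite E.
have := g_lip (Y + a *: D) Y; rewrite E normrZ gtr0_norm// => gl.
have gi : inner (g (Y + a *: D)) D >= inner (g Y) D - Lam * a * `|D| ^+ 2.
  rewrite lerBlDl -lerBlDr -innerNl -innerDl (le_trans (inner_CS _ _))//.
  by rewrite expr2 mulrA ler_wpM2r// distrC -mulrA.
rewrite innerZr => fl; apply: le_trans fl; rewrite lerD2l.
have [m0 m1] := andP hmu.
have D0 := sqr_ge0 `|D|.
have i0 : 0 <= inner (g Y) D by apply: le_trans h; rewrite mulr_ge0// ltW.
have h' : `|D| ^+ 2 <= s * inner (g Y) D by rewrite -ler_pdivrMl.
have k1 : Lam * a * `|D| ^+ 2 <= 2^-1 * inner (g Y) D.
  apply: (@le_trans _ _ (Lam * a * (s * inner (g Y) D))).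
    by rewrite ler_wpM2l// mulr_ge0// ltW.
  rewrite mulrA ler_wpM2r//; apply: le_trans hm; rewrite le_eqVlt.
  by apply/orP; left; apply/eqP; ring.
have k2 : mu * inner (g Y) D <= 2^-1 * inner (g Y) D by rewrite ler_wpM2r// ltW.
rewrite -mulrA mulrCA ler_pM2l//; lra.
Qed.

(** A rejected exponent [m - 1] violates the smallness condition of [armijo_small], and the accepted
    step is only [rho] times shorter. The [+ 1] in the denominator handles [Lam = 0] and the case
    [m = 0]. *)
Lemma ssn_stepsize : exists2 a0 : R, 0 < a0 & forall Y D m,
  s^-1 * `|D| ^+ 2 <= inner (g Y) D ->
  (forall n, (n < m)%N -> ~ armijo f mu rho Y D n) -> a0 <= rho ^+ m.
Proof.
have [r0 r1] := andP hrho.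
have k0 : 0 < 2 * (s * Lam) + 1 by rewrite ltr_wpDl// mulr_ge0// mulr_ge0// ltW.
exists (rho / (2 * (s * Lam) + 1)) => [|Y D [|m] h hm]; first by rewrite divr_gt0.
  rewrite expr0 ler_pdivrMr// mul1r (le_trans (ltW r1))// lerDr.
  by rewrite mulr_ge0// mulr_ge0// ltW.
rewrite exprS ler_pM2l// leNgt; apply/negP => lt; apply: (hm m (ltnSn m)).
apply: armijo_small h _.
have : rho ^+ m * (2 * (s * Lam) + 1) <= 1.
  by rewrite -ler_pdivlMr// div1r ltW.
have := exprn_ge0 m (ltW r0); rewrite mulrDr mulr1.
have -> : rho ^+ m * (2 * (s * Lam)) = 2 * (rho ^+ m * (s * Lam)) by ring.
by lra.
Qed.

(** The residual is at most a fraction [c < 1] of the gradient, so the Newton operator maps [D] to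
    something of size at least [(1 - c) |g|]. As its norm is at most [kap + s^-1], this gives
    [|D| >= k |g|], and the Armijo gain is of order [|g|^2]. *)
Lemma ssn_descent : exists2 c : R, 0 < c &
  forall j, f (X j) + c * `|g (X j)| ^+ 2 <= f (X j.+1).
Proof.
have [a0 a00 ha] := ssn_stepsize.
have [t0 _] := andP htau; have [m0 _] := andP hmu.
have [c /andP[c0 c1] hc] := inexact_residual heta t0.
pose k := (1 - c) / (kap + s^-1).
have ks : 0 < kap + s^-1 by rewrite ltr_wpDl.
have k0 : 0 < k by rewrite divr_gt0// subr_gt0.
exists (mu * a0 * (s^-1 * k ^+ 2)).
  by apply: mulr_gt0; apply: mulr_gt0 => //; rewrite exprn_gt0.
move=> j; have [V [D [m [jV gD r [am hm] ->]]]] := ssn_newton_step j.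
have am0 := ha _ _ _ gD hm; move/armijoE: am; apply: le_trans; rewrite lerD2l.
have i0 : 0 <= inner (g (X j)) D by apply: le_trans gD; rewrite mulr_ge0 ?sqr_ge0 ?ltW.
apply: (@le_trans _ _ (mu * a0 * inner (g (X j)) D)); last first.
  by rewrite ler_wpM2r// ler_pM2l.
rewrite -mulrA ler_wpM2l ?mulr_ge0 ?(ltW m0) ?(ltW a00)//.
have kg : 0 <= k * `|g (X j)| by exact: mulr_ge0 (ltW k0) (normr_ge0 _).
apply: le_trans gD; rewrite -mulrA ler_pM2l// -exprMn ler_sqr ?nnegrE//.
have [_ _ Vk] := jac_op jV.
have nD : `|shift_op V s^-1 D| <= (kap + s^-1) * `|D|.
  apply: le_trans (ler_normB _ _) _; rewrite mulrDl normrZ (gtr0_norm si0).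
  by rewrite lerD2r.
have r' : `|shift_op V s^-1 D + g (X j)| <= c * `|g (X j)|.
  by apply: le_trans r _; exact: hc.
rewrite /k mulrAC ler_pdivrMr// mulrC.
have := ler_normB (shift_op V s^-1 D + g (X j)) (shift_op V s^-1 D).
rewrite [X in `|X| <= _]addrAC subrr add0r; lra.
Qed.

Lemma ssn_g_cvg0 (e : R) : 0 < e ->
  exists N, forall n, (N <= n)%N -> `|g (X n)| < e.
Proof.
move=> e0; have [c c0 hc] := ssn_descent.
have : cvg ((fun n => f (X n)) @ \oo).
  apply: nondecreasing_is_cvgn.
    apply/nondecreasing_seqP => n; apply: le_trans (hc n).
    by rewrite lerDl mulr_ge0 ?sqr_ge0// ltW.
  exists (f (X 0%N) + s / 2 * `|g (X 0%N)| ^+ 2) => _ [n _ <-].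
  exact: ssn_f_bounded.
case/cvg_ex => l /cvgrPdist_lt/(_ (c * e ^+ 2 / 2)).
rewrite divr_gt0 ?mulr_gt0 ?exprn_gt0// => /(_ isT)[N _ HN]; exists N => n Nn.
have := HN n Nn; have := HN n.+1 (leqW Nn); rewrite /= !ltr_distl => /andP[h1 h2] /andP[h3 h4].
rewrite -ltr_sqr ?nnegrE ?(ltW e0)// -(ltr_pM2l c0); have := hc n; lra.
Qed.

Lemma ssn_cvg : exists Xhat, g Xhat = 0 /\ X @ \oo --> Xhat.
Proof.
have /cvg_ex[Xh Xcvg] : cvg (X @ \oo).
  apply: symtup_complete => e e0.
  have es0 : 0 < e / (2 * s) by rewrite divr_gt0// mulr_gt0.
  have [N HN] := ssn_g_cvg0 es0.
  exists N => n Nn; apply: le_lt_trans (ssn_g_dist _ _) _.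
  have h1 := HN _ Nn; have h2 := HN _ (leqnn N).
  have h3 := ler_normB (g (X n)) (g (X N)).
  rewrite mulrC -ltr_pdivlMr//; apply: le_lt_trans h3 _.
  have -> : e / s = e / (2 * s) + e / (2 * s) by field; rewrite gt_eqF.
  by lra.
exists Xh; split=> //; apply/eqP; rewrite -normr_le0; apply/ler_addgt0Pl => e e0.
have e20 : 0 < e / 2 by rewrite divr_gt0.
have [N HN] := ssn_g_cvg0 e20.
have k0 : 0 < Lam + 1 by rewrite ltr_wpDl.
move/cvgrPdist_lt : Xcvg => /(_ (e / 2 / (Lam + 1))).
rewrite !divr_gt0// => /(_ isT)[M _ HM].
have h1 := HN _ (leq_maxl N M); have h2 := HM _ (leq_maxr N M).
have h3 := g_lip Xh (X (maxn N M)).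
have h4 := ler_normD (g Xh - g (X (maxn N M))) (g (X (maxn N M))).
rewrite subrK in h4; rewrite addr0.
have h5 : Lam * `|Xh - X (maxn N M)| <= e / 2.
  apply: (@le_trans _ _ ((Lam + 1) * `|Xh - X (maxn N M)|)).
    by rewrite ler_wpM2r// lerDl.
  by rewrite mulrC -ler_pdivlMr// ltW.
lra.
Qed.

(** Writing [N] for the Newton operator and [H = Y - Xh], [N (H + D)] is the CG residual minus the
    semismooth error [g Y - N H], and the inverse of [N] is bounded by [s]. For [|H| < 1] and
    [tau <= 1] the quadratic error is below [|H|^(1 + tau)]. *)
Lemma ssn_direction_bound Xh : g Xh = 0 -> exists2 e : R, 0 < e & exists2 K : R, 0 <= K &
  forall Y V D, `|Y - Xh| < e -> jac Y V ->
    `|shift_op V s^-1 D + g Y| <= Num.min eta (`|g Y| `^ (1 + tau)) ->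
    `|Y + D - Xh| <= K * `|Y - Xh| `^ (1 + tau).
Proof.
move=> gXh; have [e e0 [C C0 HC]] := jac_semismooth Xh; have [t0 t1] := andP htau.
exists (Num.min e 1) => [|]; first by rewrite lt_min e0 ltr01.
exists (s * (C + Lam `^ (1 + tau))).
  by rewrite mulr_ge0 ?(ltW s0)// addr_ge0// powR_ge0.
move=> Y V D; rewrite lt_min => /andP[Ye Y1] jV r.
have [V1 V2 _] := jac_op jV; have := shift_op_lower s^-1 V2 (Y + D - Xh).
rewrite ler_pdivrMl// => /le_trans; apply; rewrite -mulrA ler_pM2l//.
set H := Y - Xh in Ye Y1 *.
have -> : Y + D - Xh = H + D by rewrite /H addrAC.
have := HC _ _ Ye jV; rewrite gXh subr0 -/H => HC'.
have -> : shift_op V s^-1 (H + D) =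
    (shift_op V s^-1 D + g Y) - (g Y - shift_op V s^-1 H).
  rewrite linearD /=; move: (shift_op _ _ H) (shift_op _ _ D) => a b.
  by rewrite opprB addrACA subrr addr0 addrC.
apply: le_trans (ler_normB _ _) _; rewrite mulrDl addrC lerD//.
  apply: le_trans HC' _; rewrite ler_wpM2l// -powR_mulrn//.
  have := normr_ge0 H; rewrite le_eqVlt => /orP[/eqP <-|H0].
    by rewrite powR0 ?powR_ge0//; lra.
  by rewrite ger_powR ?H0 ?(ltW Y1)//; lra.
apply: le_trans r _; rewrite ge_min; apply/orP; right.
rewrite -powRM// ge0_ler_powR ?nnegrE ?mulr_ge0//; first lra.
by have := g_lip Y Xh; rewrite gXh subr0.
Qed.

(** Let [E = Y + D - Xh], [H = Y - Xh] and [q = - <g Y, H> >= |H|^2 / s]. The full step gains almost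
    [q / 2], by [ssn_partition] and smallness of [E], while Armijo asks for about [mu q]. Half of
    the margin [(1/2 - mu) q] pays for a finite [n], the other half, [th q], for the errors in
    [|H|^3] and in [E]. *)
Lemma ssn_unit_step Xh : g Xh = 0 -> exists2 e : R, 0 < e &
  forall Y V D, `|Y - Xh| < e -> jac Y V ->
    `|shift_op V s^-1 D + g Y| <= Num.min eta (`|g Y| `^ (1 + tau)) ->
    armijo f mu rho Y D 0.
Proof.
move=> gXh; have [e1 e10 [K K0 HK]] := ssn_direction_bound gXh.
have [e2 e20 [C C0 HC]] := g_homogeneous Xh; have [t0 t1] := andP htau.
have [m0 m1] := andP hmu.
pose th := (2^-1 - mu) / 2.
have th0 : 0 < th by rewrite divr_gt0// subr_gt0.
(* The bound equals [1/2 - th = mu + th]; any [n] with [1 / (2 n) <= th] will do. *)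
have [n n0 nth] : exists2 n : nat, (0 < n)%N & (2^-1 + mu) / 2 <= (n%:R - 1) / (2 * n%:R) :> R.
  have b0 : 0 <= (2 * th)^-1 by rewrite invr_ge0 mulr_ge0// ltW.
  have := archi_boundP b0; set n := Num.bound _ => nb.
  have n0 : 0 < n%:R :> R by apply: le_lt_trans nb.
  exists n; first by rewrite -(ltr0n R).
  have -> : (n%:R - 1) / (2 * n%:R) = 2^-1 - (2 * n%:R)^-1 :> R.
    by field; rewrite gt_eqF.
  have -> : (2^-1 + mu) / 2 = 2^-1 - th by rewrite /th; field.
  have thn : th^-1 <= 2 * n%:R.
    have -> : th^-1 = 2 * (2 * th)^-1 by field; rewrite gt_eqF.
    by rewrite ler_pM2l// ltW.
  rewrite lerD2l lerN2 -[leRHS]invrK lef_pV2// posrE ?invr_gt0// mulr_gt0//.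

(* Once [|E| <= w0 |H|], the two terms in [Lam] together cost at most half of [th |H|^2 / s]. *)
pose w0 := Num.min 1 (th / (4 * s * (Lam + 1))).
have L1 : 0 < Lam + 1 by rewrite ltr_wpDl.
have w00 : 0 < w0 by rewrite lt_min ltr01 divr_gt0// !mulr_gt0.
have [e3 e30 He3] : exists2 e3 : R, 0 < e3 & forall h : R, 0 <= h < e3 -> K * h `^ tau <= w0.
  exists ((w0 / (K + 1)) `^ tau^-1) => [|h /andP[h0 hh]].
    by rewrite powR_gt0// divr_gt0// ltr_wpDl.
  have K1 : 0 < K + 1 by rewrite ltr_wpDl.
  have : h `^ tau <= w0 / (K + 1).
    have Eb : ((w0 / (K + 1)) `^ tau^-1) `^ tau = w0 / (K + 1).
      by rewrite -powRrM mulVf ?gt_eqF// powRr1// divr_ge0 ?(ltW w00) ?(ltW K1).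
    by rewrite -[leRHS]Eb ge0_ler_powR ?nnegrE ?powR_ge0 ?(ltW t0) ?(ltW hh).
  rewrite ler_pdivlMr// mulrC => /(le_trans _); apply.
  by rewrite ler_wpM2r ?powR_ge0// lerDl.
(* For [|H| < e4] the cubic error costs at most the other half of [th |H|^2 / s]. *)
pose e4 := th / (2 * s * (C + 1)).
have e40 : 0 < e4 by rewrite divr_gt0// !mulr_gt0// ltr_wpDl.
exists (Num.min (Num.min e1 e2) (Num.min e3 e4)); first by rewrite !lt_min e10 e20 e30 e40.
move=> Y V D; rewrite !lt_min => /andP[/andP[h1 h2] /andP[h3 h4]] jV r.
have := HK _ _ _ h1 jV r; set E := Y + D - Xh; set H := Y - Xh in h1 h2 h3 h4 *.
rewrite powRD; last by apply/implyP => /eqP; lra.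
rewrite powRr1// mulrCA => hE.
have {}hE : `|E| <= w0 * `|H|.
  by apply: le_trans hE _; rewrite mulrC ler_wpM2r// He3// normr_ge0.
have YE : Xh + H = Y by rewrite subrKC.
have part : f Xh - f Y >= (n%:R - 1) / (2 * n%:R) * - inner (g Y) H - C * `|H| ^+ 3.
  rewrite -YE; apply: ssn_partition => // t t01.
  by have := HC H t h2 t01; rewrite gXh !subr0.
apply/armijoE; rewrite expr0 mulr1 scale1r.
have low := ssn_f_lower Xh (Y + D); rewrite -/E in low.
have gE : - (Lam * `|E| ^+ 2) <= inner (g (Y + D)) E.
  rewrite lerNl -innerNl (le_trans (inner_CS _ _))// normrN expr2 mulrA ler_wpM2r//.
  by have := g_lip (Y + D) Xh; rewrite gXh subr0.
have gl : `|g Y| <= Lam * `|H| by have := g_lip Y Xh; rewrite gXh subr0.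
have q0 := ssn_g_mono Y Xh; rewrite gXh sub0r innerNl -/H in q0.
have gD : inner (g Y) D <= Lam * `|H| * `|E| - inner (g Y) H.
  have -> : D = E - H by rewrite /E /H opprB addrA subrK addrC addKr.
  rewrite innerDr innerNr lerD2r; apply: le_trans (inner_CS _ _) _.
  by rewrite ler_wpM2r.
set q := - inner (g Y) H in part q0 gD *; set h := `|H| in hE gl q0 part gD h3 h4 *.
set k := `|E| in hE gE gD.
have hh0 : 0 <= h by exact: normr_ge0.
have kk0 : 0 <= k by exact: normr_ge0.
have w01 : w0 <= 1 by rewrite ge_min lexx.
have w0L : w0 * (2 * Lam) <= th / (2 * s).
  apply: (@le_trans _ _ (th / (4 * s * (Lam + 1)) * (2 * (Lam + 1)))).
    by apply: ler_pM; rewrite ?(ltW w00) ?mulr_ge0 ?ge_min ?lexx ?orbT// ler_pM2l// lerDl.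
  rewrite le_eqVlt; apply/orP; left; apply/eqP.
  by field; rewrite !gt_eqF.
have k2 : k ^+ 2 <= w0 * h ^+ 2.
  apply: (@le_trans _ _ ((w0 * h) ^+ 2)); first by rewrite ler_sqr ?nnegrE ?mulr_ge0 ?(ltW w00).
  by rewrite exprMn ler_wpM2r ?sqr_ge0// expr2 ler_piMr// ltW.
have hk : h * k <= w0 * h ^+ 2.
  by apply: (@le_trans _ _ (h * (w0 * h))); [rewrite ler_wpM2l|rewrite mulrCA -expr2].
have Ch : C * h ^+ 3 <= th / (2 * s) * h ^+ 2.
  rewrite exprS mulrA ler_wpM2r ?sqr_ge0//.
  apply: (@le_trans _ _ (C * e4)); first by rewrite ler_wpM2l// ltW.
  rewrite /e4 mulrA ler_pdivrMr ?mulr_gt0 ?ltr_wpDl// mulrC.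
  have -> : th / (2 * s) * (2 * s * (C + 1)) = th * (C + 1) by field; rewrite gt_eqF.
  by rewrite ler_pM2l// lerDl.
have thq : th * q <= (n%:R - 1) / (2 * n%:R) * q - mu * q.
  rewrite -mulrBl ler_wpM2r//; last by rewrite lerBrDr; apply: le_trans nth; rewrite /th; lra.
  by apply: le_trans q0; rewrite mulr_ge0 ?sqr_ge0// ltW.
have thh : th / s * h ^+ 2 <= th * q by rewrite -mulrA ler_pM2l.
have mD : mu * inner (g Y) D <= Lam * (h * k) + mu * q.
  apply: (@le_trans _ _ (mu * (Lam * h * k + q))); first by rewrite ler_wpM2l// ltW.
  rewrite mulrDr lerD2r -mulrA ler_piMl ?mulr_ge0//; lra.
have f1 := ler_wpM2l Lam0 hk; have f2 := ler_wpM2l Lam0 k2.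
have f3 := ler_wpM2r (sqr_ge0 h) w0L.
have f4 : th / s * h ^+ 2 = th / (2 * s) * h ^+ 2 + th / (2 * s) * h ^+ 2.
  by field; rewrite gt_eqF.
lra.
Qed.

Lemma ssn_superlinear : exists Xh : symtup R L p,
  [/\ is_grad f Xh 0 /\ (forall Y, is_grad f Y 0 -> Y = Xh),
      forall Y, f Y <= f Xh,
      X @ \oo --> Xh &
      ((fun j => `|X j.+1 - Xh|) : nat -> R^o)
        =O_\oo ((fun j => `|X j - Xh| `^ (1 + tau)) : nat -> R^o)].
Proof.
have [Xh [gXh Xcvg]] := ssn_cvg; exists Xh; split=> //.
- split=> [|Y Y0]; first by rewrite -gXh; exact: ssn_is_grad.
  have gY : g Y = 0 by apply: is_grad_unique (ssn_is_grad Y) Y0.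
  apply/eqP; rewrite -subr_eq0 -normr_le0; apply: le_trans (ssn_g_dist _ _) _.
  by rewrite gY gXh subrr normr0 mulr0.
- move=> Y; apply: le_trans (f_concave Xh Y) _; rewrite gXh inner0l addr0.
  by rewrite gerDl oppr_le0 mulr_ge0 ?sqr_ge0 ?(ltW s20).
- have [e1 e10 [K K0 HK]] := ssn_direction_bound gXh.
  have [e2 e20 Hu] := ssn_unit_step gXh.
  apply/eqO_exP; exists (K + 1); first by rewrite ltr_wpDl.
  move/cvgrPdist_lt : Xcvg => /(_ (Num.min e1 e2)); rewrite lt_min e10 e20.
  move=> /(_ isT); apply: filterS => j; rewrite lt_min distrC => /andP[h1 h2].
  have [V [D [m [jV gD r [am hm] XE]]]] := ssn_newton_step j.
  have m0 : m = 0%N.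
    by case: m hm {am XE} => // m /(_ 0%N isT) []; exact: Hu h2 jV r.
  have := HK _ _ _ h1 jV r.
  rewrite XE m0 expr0 scale1r normr_id => /le_trans; apply.
  by rewrite ger0_norm ?powR_ge0// ler_wpM2r ?powR_ge0// lerDl.
Qed.

End AbstractSSN.

(** * The dual function *)

Section Entries.
Context {R : realType} {L p : nat}.
Implicit Types X Y U : symtup R L p.

Lemma entryD X Y i j : entry (X + Y) i j = entry X i j + entry Y i j.
Proof. by apply/colP => l; rewrite !mxE ffunE -[LHS]/(((X l : 'M[R]_p) + (Y l : 'M[R]_p)) i j) mxE. Qed.

Lemma entryZ a X i j : entry (a *: X) i j = a *: entry X i j.
Proof. by apply/colP => l; rewrite !mxE ffunE -[LHS]/((a *: (X l : 'M[R]_p)) i j) mxE. Qed.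

Lemma entryB X Y i j : entry (X - Y) i j = entry X i j - entry Y i j.
Proof. by rewrite -scaleN1r entryD entryZ scaleN1r. Qed.

Lemma entryC X i j : entry X i j = entry X j i.
Proof. by apply/colP => l; rewrite !mxE -[in LHS](symmxT (X l)) mxE. Qed.

Lemma entry_inj X Y : (forall i j, entry X i j = entry Y i j) -> X = Y.
Proof.
move=> XY; apply/ffunP => l; apply/val_inj/matrixP => i j.
by have /colP/(_ l) := XY i j; rewrite !mxE.
Qed.

Lemma inner_entry X Y :
  inner X Y = \sum_i \sum_j dot (entry X i j) (entry Y i j).
Proof.
rewrite /inner; under eq_bigr do rewrite mxinnerE.
rewrite exchange_big; apply: eq_bigr => i _; rewrite exchange_big.
by apply: eq_bigr => j _; rewrite dotE; apply: eq_bigr => l _; rewrite !mxE.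
Qed.

Lemma entry_norm X i j : frob (entry X i j) <= `|X|.
Proof.
rewrite -ler_sqr ?nnegrE ?frob_ge0// frob_sqr -inner_normE inner_entry.
rewrite (bigD1 i)//= (bigD1 j)//= -addrA lerDl addr_ge0//.
  by apply: sumr_ge0 => *; exact: dot_ge0.
by do 2!apply: sumr_ge0 => * ; exact: dot_ge0.
Qed.

Lemma entry_norm_le X Y : (forall i j, frob (entry X i j) <= frob (entry Y i j)) ->
  `|X| <= `|Y|.
Proof.
move=> XY; rewrite -ler_sqr ?nnegrE// -!inner_normE !inner_entry.
do 2!apply: ler_sum => ? _; rewrite -!frob_sqr ler_sqr ?nnegrE ?frob_ge0//.
Qed.

Lemma symtup_component X l : `|X l| <= `|X|.
Proof.
rewrite -ler_sqr ?nnegrE// -mxinner_normE -inner_normE /inner (bigD1 l)//= lerDl.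
by apply: sumr_ge0 => k _; exact: mxinner_ge0.
Qed.

Lemma symtup_component_le X Y c : 0 <= c -> (forall l, `|X l| <= c * `|Y l|) ->
  `|X| <= c * `|Y|.
Proof.
move=> c0 XY; rewrite -ler_sqr ?nnegrE ?mulr_ge0// exprMn -!inner_normE mulr_sumr.
apply: ler_sum => l _; rewrite !mxinner_normE -exprMn.
by rewrite ler_sqr ?nnegrE ?mulr_ge0.
Qed.

Lemma symtup_norm_sum X (c : 'I_L -> R) : (forall l, `|X l| <= c l) ->
  `|X| <= \sum_l c l.
Proof.
move=> Xc; have c0 l : 0 <= c l by apply: le_trans (Xc l).
rewrite -ler_sqr ?nnegrE ?sumr_ge0// -inner_normE expr2 mulr_suml.
apply: ler_sum => l _; rewrite mxinner_normE expr2 ler_pM//.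
by apply: le_trans (Xc l) _; rewrite (bigD1 l)//= lerDl sumr_ge0.
Qed.

End Entries.

(** * The proximal map of the regularizer on tuples of matrices *)

Section ProxFgl.
Context {R : realType} {L p : nat}.
Variables (lam1 lam2 s : R).
Hypotheses (lam10 : 0 <= lam1) (lam20 : 0 <= lam2) (s0 : 0 < s).
Implicit Types X Y U T : symtup R L p.

Definition prox_fgl_mx U (l : 'I_L) : 'M[R]_p := \matrix_(i, j)
  if i == j then U l i i
  else (s *: prox_fused lam1 lam2 (s^-1 *: entry U i j)) l 0.

Fact prox_fgl_subproof U l : prox_fgl_mx U l \in @symmx_pred R p.
Proof.
apply/eqP; apply/matrixP => i j; rewrite mxE [LHS]mxE [RHS]mxE eq_sym entryC.
by case: eqP => // ->.
Qed.

(* The proximal map of [s * fgl], which acts entrywise since [fgl] is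
   separable; [sigma]-scaling is homogeneity of [fused]. *)
Definition prox_fgl U : symtup R L p := [ffun l => SymMx (prox_fgl_subproof U l)].

Lemma entry_prox_fgl U i j : entry (prox_fgl U) i j =
  if i == j then entry U i i
  else s *: prox_fused lam1 lam2 (s^-1 *: entry U i j).
Proof.
apply/colP => l; rewrite mxE ffunE -[LHS]/(prox_fgl_mx U l i j) mxE.
by case: eqP => _; rewrite !mxE.
Qed.

Lemma fusedZ a (x : 'cV[R]_L) : 0 <= a -> fused lam1 lam2 (a *: x) = a * fused lam1 lam2 x.
Proof.
move=> a0; rewrite /fused -scalemxAr mulrDr.
have E n (y : 'cV[R]_n) : cvnorm1 (a *: y) = a * cvnorm1 y.
  rewrite /cvnorm1 mulr_sumr; apply: eq_bigr => i _.
  by rewrite mxE normrM ger0_norm.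
by rewrite !E; ring.
Qed.

(** Sum over the entries of [prox_fused_subgrad], rescaled by [s^2]. On the unpenalised diagonal
    [U - prox_fgl U] vanishes and contributes nothing. *)
Lemma prox_fgl_subgrad U T : inner (U - prox_fgl U) (T - prox_fgl U)
  <= s * (fgl lam1 lam2 T - fgl lam1 lam2 (prox_fgl U)).
Proof.
rewrite inner_entry /fgl -sumrB mulr_sumr; apply: ler_sum => i _.
rewrite -sumrB mulr_sumr (bigD1 i)//= !entryB entry_prox_fgl eqxx subrr.
rewrite [X in X + _](_ : _ = 0) ?add0r; last first.
  by rewrite -(scale0r (0 : 'cV[R]_L)) dotZl mul0r.
under eq_bigl do rewrite eq_sym; apply: ler_sum => j ij.
rewrite !entryB !entry_prox_fgl (negbTE ij).
set u := entry U i j; set w := entry T i j; set y := prox_fused _ _ _.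
have := prox_fused_subgrad lam10 lam20 (s^-1 *: u) (s^-1 *: w); rewrite -/y.
rewrite fusedZ ?invr_ge0 ?(ltW s0)// fusedZ ?(ltW s0)//.
have E z : s^-1 *: z - y = s^-1 *: (z - s *: y).
  by rewrite scalerBr scalerA mulVf ?gt_eqF// scale1r.
rewrite !E dotZl dotZr mulrA; set d := dot _ _; set fw := fused _ _ w.
set fy := fused _ _ y => h; have := ler_wpM2l (ltW (mulr_gt0 s0 s0)) h.
have -> : s * s * (fy + s^-1 * s^-1 * d) = s * s * fy + d by field; rewrite gt_eqF.
have -> : s * s * (s^-1 * fw) = s * fw by field; rewrite gt_eqF.
by lra.
Qed.

Lemma prox_fgl_lip U U' : `|prox_fgl U - prox_fgl U'| <= `|U - U'|.
Proof.
have h : `|prox_fgl U - prox_fgl U'| ^+ 2 <=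
    inner (U - U') (prox_fgl U - prox_fgl U').
  have := prox_fgl_subgrad U (prox_fgl U'); have := prox_fgl_subgrad U' (prox_fgl U).
  rewrite -inner_normE !innerE (innerC (prox_fgl U') (prox_fgl U)).
  by lra.
have := le_trans h (inner_CS _ _).
have := normr_ge0 (prox_fgl U - prox_fgl U'); rewrite le_eqVlt => /orP[/eqP <-//|h0].
by rewrite expr2 ler_pM2r.
Qed.

Lemma jac_prox_fglP (Z : symtup R L p) G : jac_prox_fgl lam1 lam2 Z G ->
  exists A : 'I_p -> 'I_p -> 'M[R]_L,
  [/\ forall i j, psdmx (A i j),
      forall i j (x : 'cV[R]_L), frob (A i j *m x) <= frob x,
      forall i j, i != j -> jac_prox_fused lam1 lam2 (entry Z i j) (A i j),
      forall i, A i i = 1%:M &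
      forall Y i j, entry (G Y) i j = A i j *m entry Y i j].
Proof.
move=> [M [HM HG]].
(* One family for the three cases of the definition; below the diagonal, membership follows from
   symmetry of [Z]. *)
pose A (i j : 'I_p) := if (i < j)%N then M i j else if i == j then 1%:M else M j i.
have Ajac i j : i != j -> jac_prox_fused lam1 lam2 (entry Z i j) (A i j).
  rewrite /A; case: ltngtP => h ij; first exact: HM.
    by rewrite (negbTE ij) entryC; exact: HM.
  by move: ij; rewrite -val_eqE /= h eqxx.
have Aii i : A i i = 1%:M by rewrite /A ltnn eqxx.
exists A; split=> //.
- move=> i j; have [->|ij] := eqVneq i j.
    rewrite Aii; split=> [|x]; first exact: trmx1.
    by rewrite mulmx1 -trace_mx11; exact: trmul_ge0.
  by have [] := Ajac _ _ ij.
- move=> i j x; have [->|ij] := eqVneq i j; first by rewrite Aii mul1mx.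
  exact: jac_prox_fused_bound (Ajac _ _ ij).
- move=> Y i j; rewrite HG /A; case: ltngtP => h //;
    by case: eqP => // ij; rewrite mul1mx -ij.
Qed.

Lemma jac_prox_fgl_op (Z : symtup R L p) G : jac_prox_fgl lam1 lam2 Z G ->
  [/\ forall D E, inner (G D) E = inner D (G E),
      forall D, 0 <= inner (G D) D & forall D, `|G D| <= `|D|].
Proof.
move=> /jac_prox_fglP[A [Apsd Ab _ _ GE]]; split=> [D E|D|D].
- rewrite !inner_entry; apply: eq_bigr => i _; apply: eq_bigr => j _.
  by rewrite !GE dot_mul; have [-> _] := Apsd i j.
- rewrite inner_entry; apply: sumr_ge0 => i _; apply: sumr_ge0 => j _.
  rewrite GE dotC /dot trace_mx11 mulmxA.
  by have [_] := Apsd i j; apply.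
- by apply: entry_norm_le => i j; rewrite GE.
Qed.

Lemma prox_fgl_local U0 : exists2 e : R, 0 < e & forall U G, `|U - U0| < e ->
  jac_prox_fgl lam1 lam2 (s^-1 *: U) G -> prox_fgl U - prox_fgl U0 = G (U - U0).
Proof.
have [ij|ij e e' ee' H v M he|e e0 H] := @ex_eps_forall R ('I_p * 'I_p)%type
  (fun ij e => forall v M, frob (v - s^-1 *: entry U0 ij.1 ij.2) < e ->
    jac_prox_fused lam1 lam2 v M ->
    prox_fused lam1 lam2 v - prox_fused lam1 lam2 (s^-1 *: entry U0 ij.1 ij.2)
      = M *m (v - s^-1 *: entry U0 ij.1 ij.2)).
- exact: jac_prox_fused_local.
- by apply: H; exact: lt_le_trans he ee'.
exists (s * e) => [|U G Ue jG]; first by rewrite mulr_gt0.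
have [A [_ _ Ajac A1 GE]] := jac_prox_fglP jG.
apply: entry_inj => i j; rewrite entryB !entry_prox_fgl GE entryB.
have [<-|ij] := eqVneq i j; first by rewrite A1 mul1mx.
rewrite -scalerBr (H (i, j) (s^-1 *: entry U i j) (A i j)) /= -?scalerBr.
- by rewrite -scalemxAr scalerA mulfV ?gt_eqF// scale1r.
- rewrite frobZ gtr0_norm ?invr_gt0// ltr_pdivrMl//.
  by rewrite -entryB; apply: le_lt_trans (entry_norm _ _ _) Ue.
- by rewrite -entryZ; exact: Ajac.
Qed.

Lemma prox_fgl_homogeneous U0 : exists2 e : R, 0 < e &
  forall H (t : R), `|H| < e -> 0 <= t <= 1 ->
  prox_fgl (U0 + t *: H) - prox_fgl U0 = t *: (prox_fgl (U0 + H) - prox_fgl U0).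
Proof.
have [ij|ij e e' ee' K h t he|e e0 K] := @ex_eps_forall R ('I_p * 'I_p)%type
  (fun ij e => forall h (t : R), frob h < e -> 0 <= t <= 1 ->
    let v := s^-1 *: entry U0 ij.1 ij.2 in
    prox_fused lam1 lam2 (v + t *: h) - prox_fused lam1 lam2 v
      = t *: (prox_fused lam1 lam2 (v + h) - prox_fused lam1 lam2 v)).
- exact: prox_fused_homogeneous.
- by apply: K; exact: lt_le_trans he ee'.
exists (s * e) => [|H t He t01]; first by rewrite mulr_gt0.
apply: entry_inj => i j; rewrite entryZ !entryB !entry_prox_fgl !entryD !entryZ.
have [_|ij] := eqVneq i j; first by rewrite !(addrC (entry U0 i i)) !addrK.
have := K (i, j) (s^-1 *: entry H i j) t; rewrite /= => Kij.
have E : s^-1 *: (entry U0 i j + t *: entry H i j)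
    = s^-1 *: entry U0 i j + t *: (s^-1 *: entry H i j).
  by rewrite scalerDr !scalerA mulrC.
have E' : s^-1 *: (entry U0 i j + entry H i j)
    = s^-1 *: entry U0 i j + s^-1 *: entry H i j by exact: scalerDr.
have scale (a b c : 'cV[R]_L) : a - c = t *: (b - c) ->
    s *: a - s *: c = t *: (s *: b - s *: c).
  by move=> h; rewrite -!scalerBr h !scalerA mulrC.
rewrite E E'; apply/scale/Kij => //.
rewrite frobZ gtr0_norm ?invr_gt0// ltr_pdivrMl//.
exact: le_lt_trans (entry_norm _ _ _) He.
Qed.

End ProxFgl.

Lemma subrACA (V : zmodType) (a b c d : V) : (a - b) - (c - d) = (a - c) - (b - d).
Proof. by rewrite !opprD !opprK addrACA. Qed.

Lemma homogeneous_cancel (R : comNzRingType) (V : lmodType R) t r (a b c d e : V) :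
  a - t *: b - r *: (t *: d) - t *: (c - b - r *: d) = a - t *: e - t *: (c - e).
Proof.
rewrite !scalerBr !scalerA (mulrC r) [LHS]subrACA subrr subr0.
by rewrite [LHS]subrACA [RHS]subrACA !subrr !subr0.
Qed.

Lemma norm_sqr_shift (R : realType) L p (A B C : symtup R L p) :
  `|A - C| ^+ 2 = `|A - B| ^+ 2 + 2 * inner (B - C) (A - B) + `|B - C| ^+ 2.
Proof.
have -> : A - C = (A - B) + (B - C) by rewrite addrA subrK.
move: (A - B) (B - C) => a b; rewrite -!inner_normE !(innerDl, innerDr) (innerC b a).
by ring.
Qed.

(** * Minimisers, gradient and surrogate Jacobian of the dual function *)

Section DualFunction.
Context {R : realType} {L p : nat}.
Variables (S : symtup R L p) (lam1 lam2 s : R) (Theta Omega Xbar : symtup R L p).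
Hypotheses (lam10 : 0 <= lam1) (lam20 : 0 <= lam2) (s0 : 0 < s).
Implicit Types X Y T M D : symtup R L p.

Local Notation fgl12 := (@fgl R L p lam1 lam2).

Definition Upt X : symtup R L p := Theta + s *: (X - S).

Definition argT X : symtup R L p := prox_fgl lam1 lam2 s (Upt X).

Definition argO X : symtup R L p := [ffun l => phi_plus s (Omega l - s *: X l)].

Definition objective T M X : R :=
  - \sum_l ln (\det (M l : 'M[R]_p)) + inner S T + fgl12 T - inner (T - M) X
  + (2 * s)^-1 * (`|T - Theta| ^+ 2 + `|M - Omega| ^+ 2).

Lemma ln_det_phi_plus (A X : symmx R p) : pdmx X ->
  ln (\det X) - ln (\det (phi_plus s A)) <=
    s^-1 * mxinner (phi_plus s A - A) (X - phi_plus s A).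
Proof.
move=> Xpd; have [Q [e C]] := phi_plusP A s0.
apply: le_trans (ln_det_le C Xpd) _; rewrite le_eqVlt; apply/orP; left; apply/eqP.
have [_ _ _ E] := C; rewrite /mxinner symmxT -[symmx_val (_ - A)]/((phi_plus s A : 'M[R]_p) - A) E.
by rewrite -scalemxAl mxtraceZ mulrA mulVf ?gt_eqF// mul1r.
Qed.

Lemma argO_pd X l : pdmx (argO X l).
Proof. by rewrite ffunE; have [Q [e /phi_cert_pd]] := phi_plusP (Omega l - s *: X l) s0. Qed.

(** Around [T0], [M0] the linear parts of the squares and of the pairing with [X] are cancelled by
    the subgradient inequality for [fgl] and the gradient inequality for [ln det]. What remains,
    identity [E], is [(|T - T0|^2 + |M - M0|^2) / (2 s)]. *)
Lemma objective_min T M X : (forall l, pdmx (M l)) ->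
  objective (argT X) (argO X) X <= objective T M X.
Proof.
move=> Mpd; rewrite /objective; set T0 := argT X; set M0 := argO X.
have h1 : \sum_l ln (\det (M l : 'M[R]_p)) - \sum_l ln (\det (M0 l : 'M[R]_p))
    <= s^-1 * inner (M0 - (Omega - s *: X)) (M - M0).
  rewrite -sumrB /inner mulr_sumr; apply: ler_sum => l _.
  have := ln_det_phi_plus (Omega l - s *: X l) (Mpd l).
  by rewrite /M0 !ffunE.
have h2 : s^-1 * inner (Upt X - T0) (T - T0) <= fgl12 T - fgl12 T0.
  by rewrite ler_pdivrMl//; exact: prox_fgl_subgrad.
clearbody T0 M0.
have k0 : 0 < (2 * s)^-1 by rewrite invr_gt0 mulr_gt0.
have h3 := mulr_ge0 (ltW k0) (sqr_ge0 `|T - T0|).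
have h4 := mulr_ge0 (ltW k0) (sqr_ge0 `|M - M0|).
have E : inner S T - inner S T0 - inner (T - M) X + inner (T0 - M0) X
    + (2 * s)^-1 * (`|T - Theta| ^+ 2 + `|M - Omega| ^+ 2)
    - (2 * s)^-1 * (`|T0 - Theta| ^+ 2 + `|M0 - Omega| ^+ 2)
    + s^-1 * inner (Upt X - T0) (T - T0)
    - s^-1 * inner (M0 - (Omega - s *: X)) (M - M0)
  = (2 * s)^-1 * `|T - T0| ^+ 2 + (2 * s)^-1 * `|M - M0| ^+ 2.
  have -> : `|T - Theta| ^+ 2 = `|T - T0| ^+ 2 + 2 * inner (T0 - Theta) (T - T0)
      + `|T0 - Theta| ^+ 2 by exact: norm_sqr_shift.
  have -> : `|M - Omega| ^+ 2 = `|M - M0| ^+ 2 + 2 * inner (M0 - Omega) (M - M0)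
      + `|M0 - Omega| ^+ 2 by exact: norm_sqr_shift.
  have -> : inner (T - M) X = inner (T0 - M0) X + inner X (T - T0) - inner X (M - M0).
    by rewrite !(innerDr, innerNr, innerDl, innerNl) !(innerC X); ring.
  have -> : inner S T = inner S T0 + inner S (T - T0) by rewrite -innerDr subrKC.
  move: (T - T0) (M - M0) => a b; rewrite /Upt.
  rewrite !(innerDl, innerNl, innerZl); field; rewrite gt_eqF//.
move: E h1 h2 h3 h4.
move: (\sum_l _) (\sum_l _) (fgl12 _) (fgl12 _) => a1 a2 a3 a4.
move: (inner S T) (inner S T0) (inner (T - M) X) (inner (T0 - M0) X) => b1 b2 b3 b4.
move: ((2 * s)^-1 * (`|T - Theta| ^+ 2 + `|M - Omega| ^+ 2)) => c1.
move: ((2 * s)^-1 * (`|T0 - Theta| ^+ 2 + `|M0 - Omega| ^+ 2)) => c2.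
move: (s^-1 * inner (Upt X - T0) _) (s^-1 * inner (M0 - _) _) => d1 d2.
move: ((2 * s)^-1 * `|T - T0| ^+ 2) ((2 * s)^-1 * `|M - M0| ^+ 2) => e1 e2.
by lra.
Qed.

Lemma objective_affine T M X Y :
  objective T M Y = objective T M X - inner (T - M) (Y - X).
Proof. by rewrite /objective [inner (T - M) (Y - X)]innerDr innerNr; ring. Qed.

Lemma PhiE X : Phi S lam1 lam2 s Theta Omega X
  = (objective (argT X) (argO X) X)%:E.
Proof.
have valE T M : (forall l, pdmx (M l)) ->
    (\sum_l (neglogdet (M l) + (mxinner (S l) (T l))%:E)
     + (fgl12 T - inner (T - M) X
        + (2 * s)^-1 * (`|T - Theta| ^+ 2 + `|M - Omega| ^+ 2))%:E)%E
    = (objective T M X)%:E.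
  move=> Mpd.
  rewrite (eq_bigr (fun l => (- ln (\det (M l : 'M[R]_p)) + mxinner (S l) (T l))%:E)).
    rewrite sumEFin -EFinD /objective big_split /= sumrN -/(inner S T).
    by congr EFin; ring.
  by move=> l _; rewrite /neglogdet asboolT.
apply/eqP; rewrite eq_le; apply/andP; split.
  apply: ereal_inf_lbound; exists (argT X), (argO X); rewrite valE//.
  exact: argO_pd.
apply: le_ereal_inf_tmp => _ [T [M ->]].
have [Mpd|Mpd] := pselect (forall l, pdmx (M l)).
  by rewrite valE// lee_fin objective_min.
(* A component that is not positive definite makes its summand infinite, and no other summand is
   [-oo]. *)
rewrite [X in (_ <= X)%E](_ : _ = +oo%E) ?leey//.
have /existsNP[l nl] := Mpd.
rewrite (bigD1 l)//= /neglogdet asboolF// addye//; last first.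
  rewrite esum_eqNy negb_exists; apply/forallP => i; rewrite negb_and.
  by apply/orP; right; case: ifP.
Qed.

Let f : symtup R L p -> R := Phi_hat S lam1 lam2 s Theta Omega Xbar.

Definition dual_grad X : symtup R L p := argO X - argT X - s^-1 *: (X - Xbar).

(** The minimisers at [X] compete at [Y], and the objective is affine in its dual argument with
    slope [argO X - argT X]. The proximal square expands exactly and supplies the strong
    concavity. *)
Lemma Phi_hat_concave X Y :
  f Y <= f X + inner (dual_grad X) (Y - X) - (2 * s)^-1 * `|Y - X| ^+ 2.
Proof.
rewrite /f /Phi_hat !PhiE /=.
have := objective_min (argT X) Y (@argO_pd X).
rewrite (objective_affine (argT X) (argO X) X Y) (norm_sqr_shift Y X Xbar).
have -> : inner (dual_grad X) (Y - X)
    = - inner (argT X - argO X) (Y - X) - s^-1 * inner (X - Xbar) (Y - X).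
  by rewrite /dual_grad !(innerDl, innerNl, innerZl); ring.
have -> : (2 * s)^-1 * (`|Y - X| ^+ 2 + 2 * inner (X - Xbar) (Y - X) + `|X - Xbar| ^+ 2)
    = (2 * s)^-1 * `|Y - X| ^+ 2 + s^-1 * inner (X - Xbar) (Y - X)
      + (2 * s)^-1 * `|X - Xbar| ^+ 2.
  by move: (`|_|) (inner _ _) (`|_|) => a b c; field; rewrite gt_eqF.
move: (objective _ _ Y) (objective _ _ X) (inner _ _) (_ * inner _ _) => a b c d.
move: ((2 * s)^-1 * `|Y - X| ^+ 2) ((2 * s)^-1 * `|X - Xbar| ^+ 2) => e1 e2.
by lra.
Qed.

Lemma UptB X Y : Upt X - Upt Y = s *: (X - Y).
Proof. by rewrite /Upt opprD addrACA subrr add0r -scalerBr opprB addrA subrK. Qed.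

Lemma shiftB l X Y : (Omega l - s *: X l) - (Omega l - s *: Y l) = - (s *: (X - Y) l).
Proof. by rewrite subrACA subrr sub0r -scalerBr !ffunE. Qed.

Lemma dual_gradB X Y : dual_grad X - dual_grad Y
  = argO X - argO Y - (argT X - argT Y) - s^-1 *: (X - Y).
Proof.
rewrite /dual_grad [in LHS]subrACA (subrACA (argO X)) -scalerBr.
by rewrite (subrACA X) subrr subr0.
Qed.

Lemma dual_grad_lip X Y : `|dual_grad X - dual_grad Y| <= (2 * s + s^-1) * `|X - Y|.
Proof.
rewrite dual_gradB.
apply: le_trans (ler_normB _ _) _; rewrite mulrDl lerD//; last first.
  by rewrite normrZ gtr0_norm ?invr_gt0.
apply: le_trans (ler_normB _ _) _; rewrite -mulrA mulr2n mulrDl mul1r lerD//.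
  apply: symtup_component_le (ltW s0) _ => l; rewrite !ffunE.
  apply: le_trans (phi_plus_lip _ _ s0) _; rewrite shiftB normrN normrZ gtr0_norm//.
  by rewrite !ffunE.
apply: le_trans (prox_fgl_lip _ _ _ _ _) _ => //.
by rewrite UptB normrZ gtr0_norm.
Qed.

Definition dargO X D : symtup R L p :=
  [ffun l => - (s *: 'd (@phi_plus R p s) (Omega l - s *: X l) (D l))].

Lemma dargOZ X t D : dargO X (t *: D) = t *: dargO X D.
Proof. by apply/ffunP => l; rewrite !ffunE (linearZ_LR ('d _ _)) scalerN !scalerA (mulrC s). Qed.

(** The radius [s^-1] becomes 1 after scaling by [s], the radius of [phi_plus_local]. Both points
    may move, since the semismooth estimate differentiates at [X] and not at the centre. *)
Lemma argO_local X0 : exists2 C : R, 0 <= C & forall X Y,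
  `|X - X0| < s^-1 -> `|Y - X0| < s^-1 ->
  `|argO Y - argO X - dargO X (Y - X)| <= C * `|Y - X| ^+ 2.
Proof.
have /choice[c cP] : forall l : 'I_L, exists C, 0 <= C /\ forall A A',
    `|A - (Omega l - s *: X0 l)| <= 1 -> `|A' - (Omega l - s *: X0 l)| <= 1 ->
    `|phi_plus s A' - phi_plus s A - 'd (@phi_plus R p s) A (A' - A)|
      <= C * `|A' - A| ^+ 2.
  by move=> l; have [C ? ?] := phi_plus_local (Omega l - s *: X0 l) s0; exists C.
exists (\sum_l c l * s ^+ 2) => [|X Y X1 Y1].
  by apply: sumr_ge0 => l _; rewrite mulr_ge0 ?sqr_ge0//; have [] := cP l.
rewrite mulr_suml; apply: symtup_norm_sum => l; have [cl0 clP] := cP l.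
have near Z : `|Z - X0| < s^-1 ->
    `|(Omega l - s *: Z l) - (Omega l - s *: X0 l)| <= 1.
  move=> Zs; rewrite shiftB normrN normrZ gtr0_norm// -ler_pdivlMl// mulr1.
  exact: le_trans (symtup_component _ _) (ltW Zs).
have := clP _ _ (near _ X1) (near _ Y1).
rewrite shiftB normrN normrZ gtr0_norm// (linearN ('d _ _)) (linearZ_LR ('d _ _)) => h.
have -> : (argO Y - argO X - dargO X (Y - X)) l
  = phi_plus s (Omega l - s *: Y l) - phi_plus s (Omega l - s *: X l)
    - - (s *: 'd (@phi_plus R p s) (Omega l - s *: X l) ((Y - X) l)).
  by rewrite !ffunE.
apply: le_trans h _; rewrite -mulrA ler_wpM2l// exprMn ler_pM2l ?exprn_gt0//.
by rewrite ler_sqr ?nnegrE//; exact: symtup_component.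
Qed.

Lemma jac_grad_Phi_op X (V : {linear symtup R L p -> symtup R L p}) :
  jac_grad_Phi S lam1 lam2 s Theta Omega X V ->
  [/\ forall D E, inner (V D) E = inner D (V E),
      forall D, inner (V D) D <= 0 & forall D, `|V D| <= (2 * s) * `|D|].
Proof.
move=> [G jG VE0]; have [Gsym Gge0 Gb] := jac_prox_fgl_op lam10 jG.
have VE D : V D = dargO X D - s *: G D.
  by apply/ffunP => l; rewrite VE0 !ffunE addrC.
split=> [D E|D|D]; rewrite ?VE.
- rewrite !(innerDl, innerNl, innerZl, innerDr, innerNr, innerZr) Gsym.
  congr (_ - _); apply: eq_bigr => l _.
  by rewrite !ffunE !(mxinnerNl, mxinnerNr, mxinnerZl, mxinnerZr) diff_phi_plus_selfadj.
- rewrite innerDl innerNl innerZl -oppr_ge0 opprD opprK addr_ge0//; last first.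
    by rewrite mulr_ge0 ?(ltW s0).
  rewrite -innerNl; apply: sumr_ge0 => l _.
  rewrite !ffunE opprK mxinnerZl mulr_ge0 ?(ltW s0)//; exact: diff_phi_plus_ge0.
- apply: le_trans (ler_normB _ _) _; rewrite -mulrA mulr2n mulrDl mul1r lerD//.
    apply: symtup_component_le => [|l]; first exact: ltW.
    rewrite ffunE normrN normrZ gtr0_norm// ler_pM2l//; exact: diff_phi_plus_bound.
  by rewrite normrZ gtr0_norm// ler_pM2l.
Qed.

(** The [argT] increment is reproduced exactly by [G] and the linear term by the shift, so only the
    Taylor remainder of [argO] from [X] back to [X0] survives. *)
Lemma dual_grad_semismooth X0 : exists2 e : R, 0 < e & exists2 C : R, 0 <= C &
  forall X V, `|X - X0| < e -> jac_grad_Phi S lam1 lam2 s Theta Omega X V ->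
  `|dual_grad X - dual_grad X0 - shift_op V s^-1 (X - X0)| <= C * `|X - X0| ^+ 2.
Proof.
have [e1 e10 H1] := prox_fgl_local lam10 lam20 s0 (Upt X0).
have [C C0 CP] := argO_local X0.
exists (Num.min s^-1 (e1 / s)); first by rewrite lt_min invr_gt0 s0 divr_gt0.
exists C => // X V; rewrite lt_min => /andP[Xs Xe] [G jG VE].
have TE : argT X - argT X0 = s *: G (X - X0).
  rewrite -linearZ/= -UptB; apply: H1 => //.
  by rewrite UptB normrZ gtr0_norm// mulrC -ltr_pdivlMr.
have {}VE : V (X - X0) = dargO X (X - X0) - s *: G (X - X0).
  by apply/ffunP => l; rewrite VE !ffunE addrC.
have -> : dual_grad X - dual_grad X0 - shift_op V s^-1 (X - X0)
    = - (argO X0 - argO X - dargO X (X0 - X)).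
  rewrite -[X0 - X]opprB -[- (X - X0)]scaleN1r (dargOZ X (-1) (X - X0)) scaleN1r opprK.
  rewrite dual_gradB /shift_op VE TE subrACA subrr subr0 subrACA subrr subr0.
  by rewrite opprD opprB.
by rewrite normrN (distrC X); apply: CP => //; rewrite subrr normr0 invr_gt0.
Qed.

(** The [argT] part is exactly homogeneous and the linear part cancels. Subtracting the differential
    of [argO] at [X0] leaves two Taylor remainders, whence [2 * C]. *)
Lemma dual_grad_homogeneous X0 : exists2 e : R, 0 < e & exists2 C : R, 0 <= C &
  forall D (t : R), `|D| < e -> 0 <= t <= 1 ->
  `|dual_grad (X0 + t *: D) - dual_grad X0
     - t *: (dual_grad (X0 + D) - dual_grad X0)| <= C * `|D| ^+ 2.
Proof.
have [e1 e10 H1] := prox_fgl_homogeneous lam10 lam20 s0 (Upt X0).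
have [C C0 CP] := argO_local X0.
exists (Num.min s^-1 (e1 / s)); first by rewrite lt_min invr_gt0 s0 divr_gt0.
exists (2 * C) => [|D t]; first by rewrite mulr_ge0.
rewrite lt_min => /andP[Ds De] /andP[t0 t1].
have addK Y : X0 + Y - X0 = Y by rewrite addrC addKr.
have UE Y : Upt (X0 + Y) = Upt X0 + s *: Y.
  by rewrite -[LHS](subrK (Upt X0)) UptB addK addrC.
have TE : argT (X0 + t *: D) - argT X0 = t *: (argT (X0 + D) - argT X0).
  rewrite /argT !UE scalerA (mulrC s) -scalerA; apply: H1; last by rewrite t0.
  by rewrite normrZ gtr0_norm// mulrC -ltr_pdivlMr.
have q Y : `|Y| < s^-1 -> `|argO (X0 + Y) - argO X0 - dargO X0 Y| <= C * `|Y| ^+ 2.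
  move=> Ys; have := CP X0 (X0 + Y); rewrite addK subrr normr0 invr_gt0.
  by apply.
have tD : `|t *: D| <= `|D| by rewrite normrZ ger0_norm// ler_piMl.
have -> : dual_grad (X0 + t *: D) - dual_grad X0
    - t *: (dual_grad (X0 + D) - dual_grad X0)
  = (argO (X0 + t *: D) - argO X0 - dargO X0 (t *: D))
    - t *: (argO (X0 + D) - argO X0 - dargO X0 D).
  have := dual_gradB (X0 + t *: D) X0; rewrite addK TE => ->.
  have := dual_gradB (X0 + D) X0; rewrite addK => ->.
  by rewrite (dargOZ X0 t D); exact: homogeneous_cancel.
apply: le_trans (ler_normB _ _) _; rewrite normrZ ger0_norm//.
rewrite -mulrA mulr2n mulrDl mul1r lerD//.
  apply: le_trans (q _ (le_lt_trans tD Ds)) _.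
  by rewrite ler_wpM2l// ler_sqr ?nnegrE.
by apply: le_trans (q _ Ds); rewrite ler_piMl.
Qed.

End DualFunction.

Theorem theorem3p2 (R : realType) (L p : nat) (hL : (2 <= L)%N) (hp : (0 < p)%N)
  (S : symtup R L p) (hS : forall l, psdmx (S l))
  (lam1 lam2 : R) (hlam1 : 0 <= lam1) (hlam2 : 0 <= lam2)
  (sigma : nat -> R) (Theta Omega Xbar : nat -> symtup R L p)
  (hrppa : rppa S lam1 lam2 sigma Theta Omega Xbar)
  (k : nat)
  (mu eta tau rho : R) (hmu : 0 < mu < 2^-1) (heta : 0 < eta < 1)
  (htau : 0 < tau <= 1) (hrho : 0 < rho < 1)
  (X : nat -> symtup R L p)
  (hX : ssn (Phi_hat S lam1 lam2 (sigma k) (Theta k) (Omega k) (Xbar k))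
            (jac_grad_Phi S lam1 lam2 (sigma k) (Theta k) (Omega k))
            (sigma k) mu eta tau rho X) :
  let f := Phi_hat S lam1 lam2 (sigma k) (Theta k) (Omega k) (Xbar k) in
  exists Xhat : symtup R L p,
    [/\ is_grad f Xhat 0 /\ (forall Y, is_grad f Y 0 -> Y = Xhat),
        forall Y, f Y <= f Xhat,
        X @ \oo --> Xhat &
        ((fun j => `|X j.+1 - Xhat|) : nat -> R^o)
          =O_\oo ((fun j => `|X j - Xhat| `^ (1 + tau)) : nat -> R^o)].
Proof.
have s0 := rppa_sigma_gt0 hrppa k.
(* Each of the two nonexpansive proximal maps is composed with a scaling by [sigma k], hence
   [2 * sigma k]; the proximal square adds its inverse to the Lipschitz constant. *)
apply: (ssn_superlinear (g := dual_grad S lam1 lam2 (sigma k) (Theta k) (Omega k) (Xbar k))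
  (Lam := 2 * sigma k + (sigma k)^-1) (kap := 2 * sigma k) s0 _ _ _ _ _ _ _ hmu heta htau hrho hX).
- by rewrite addr_ge0 ?mulr_ge0 ?invr_ge0// ltW.
- by rewrite mulr_ge0// ltW.
- exact: Phi_hat_concave.
- exact: dual_grad_lip.
- exact: jac_grad_Phi_op.
- exact: dual_grad_semismooth.
- exact: dual_grad_homogeneous.
Qed.
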